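(* The comparison functor $\Phi:\mathbf{Str.T}\to\mathbf{T.Sch}^T$ is an embedding, that is, it is fully faithful on the level of morphisms and faithful (injective) on the level of objects.
   Context: Planar graphs. A graph is a triple $(H,P,\sigma)$ with $H$ a finite set (half-edges), $P$ a partition of $H$ into nonempty blocks (vertices), $\sigma$ an involution of $H$ (its orbits are the edges), such that a vertex containing a two-element $\sigma$-orbit equals that orbit; such vertices and edges are called virtual, all other vertices real. A leg is a half-edge fixed by $\sigma$ (real leg) or lying in a virtual edge (virtual leg). An orientation $\mathrm{sgn}:H\to\{+,-\}$ takes different values on the two elements of each two-element orbit; $In(v),Out(v)$ (resp. $In(\Gamma),Out(\Gamma)$) are the sets of half-edges in $v$ (resp. of legs) of sign $+$, $-$. The graph is directed if all $In(v),Out(v)$ are nonempty. The source (target) of an edge is the vertex containing its $-$ ($+$) half-edge, if there is one; $e\to e'$ means there are edges $e=e_1,\dots,e_n=e'$, $n\ge 1$, with the target of $e_i$ equal to the source of $e_{i+1}$. A planar graph is a directed graph with a linear order $\prec$ on its edges such that for all distinct edges: $e_1\to e_2$ implies $e_1\prec e_2$; and if $e_1\to e_2$ and $e_1\prec e_3\prec e_2$ then $e_1\to e_3$ or $e_3\to e_2$. The sets $In(\cdot)$, $Out(\cdot)$ are ordered by $\prec$ applied to the edges containing their elements. A graph is unitary if it consists of exactly one virtual vertex; prime if it has exactly one vertex and is not unitary. $\Gamma_1\otimes\Gamma_2$ is the disjoint union, with all edges of $\Gamma_1$ preceding those of $\Gamma_2$. If $Out(\Gamma_1)=\{o_1,\dots,o_n\}$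 and $In(\Gamma_2)=\{i_1,\dots,i_n\}$ in increasing order, $\Gamma_2\circ\Gamma_1$ is obtained from the disjoint union by grafting $o_k$ to $i_k$ for each $k$: if both are real legs, join them into an edge $\bar e_k=\{o_k,i_k\}$; if exactly one is virtual, delete its virtual edge, the edge of the other being $\bar e_k$; if both are virtual, delete $o_k,i_k$ and let $\bar e_k=\{\sigma_1(o_k),\sigma_2(i_k)\}$ be a virtual edge (and a virtual vertex). The order of edges is $A_1,\bar e_1,B_1,\dots,A_n,\bar e_n,B_n$, where $A_k$ is the set of edges of $\Gamma_1$ strictly between the edges of $o_{k-1}$ and $o_k$ (before that of $o_1$ if $k=1$) and $B_k$ the set of edges of $\Gamma_2$ strictly between the edges of $i_k$ and $i_{k+1}$ (after that of $i_n$ if $k=n$), each with its own order. Categories. $\mathbf{Str.T}$ is the category of small strict monoidal (tensor) categories and strict monoidal functors. $W(S)$ is the set of words (including the empty one) in a set $S$. A tensor scheme $\mathcal{D}$ consists of sets $Ob(\mathcal{D})$, $Mor(\mathcal{D})$ and maps $s,t:Mor(\mathcal{D})\to W(Ob(\mathcal{D}))$ whose values are nonempty words; a morphism $\varphi$ of tensor schemes consists of maps $\varphi_o$ on objects and $\varphi_m$ on morphisms compatible with $s,t$ (with $\varphi_o$ extended letterwise). $\mathbf{T.Sch}$ is the category of tensor schemes. A diagram in a tensor scheme $\mathcal{D}$ is a planar graph $\Gamma$ with a $\sigma$-invariant map $\gamma_o$ from half-edges to $Ob(\mathcal{D})$ and a map $\gamma_m$ from real vertices to $Mor(\mathcal{D})$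 such that $s(\gamma_m(v))$, $t(\gamma_m(v))$ are the words of values of $\gamma_o$ along $In(v)$, $Out(v)$. Its domain and codomain are the words of values of $\gamma_o$ along $In(\Gamma)$, $Out(\Gamma)$. Isomorphisms are bijections of half-edges preserving all structure; tensor product and composition are those of planar graphs with inherited decorations. $F(\mathcal{D})$ is the strict tensor category with objects $W(Ob(\mathcal{D}))$ (tensor product: concatenation), morphisms the isomorphism classes of diagrams in $\mathcal{D}$ from domain to codomain, with composition and tensor product of diagrams, identities being tensor products of unitary diagrams. $F(\varphi)$ relabels diagrams. $U(\mathcal{V})$ is the tensor scheme with $Ob(U(\mathcal{V}))=Ob(\mathcal{V})$ whose morphisms are the isomorphism classes of prime diagrams in $\mathcal{V}$, i.e. triples $(x_1\cdots x_m;\,y_1\cdots y_n;\,f)$ with $m,n\ge1$ and $f:x_1\otimes\cdots\otimes x_m\to y_1\otimes\cdots\otimes y_n$ in $\mathcal{V}$, with source $x_1\cdots x_m$, target $y_1\cdots y_n$. $U(K)$ applies $K$ to all labels. $F$ is left adjoint to $U$. The unit $\eta_{\mathcal{D}}$ sends $x$ to the one-letter word $\langle x\rangle$ and $f:x_1\cdots x_m\to y_1\cdots y_n$ to $(\langle x_1\rangle\cdots\langle x_m\rangle;\langle y_1\rangle\cdots\langle y_n\rangle;[v,\gamma_f])$, with $[v,\gamma_f]$ the prime diagram whose vertex is decorated by $f$. The counit $\varepsilon_{\mathcal{V}}:FU(\mathcal{V})\to\mathcal{V}$ sends $x_1\cdots x_m$ to $x_1\otimes\cdots\otimes x_m$ and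 is the strict tensor functor sending the prime diagram with vertex decorated by $(x_1\cdots x_m;y_1\cdots y_n;f)$ to $f$. $T=UF$ is the induced monad on $\mathbf{T.Sch}$, with unit $\eta$ and multiplication $\mu=U\varepsilon F$. $\mathbf{T.Sch}^T$ is its category of (Eilenberg–Moore) algebras, called tensor manifolds. The comparison functor is $\Phi(\mathcal{V})=(U(\mathcal{V}),U(\varepsilon_{\mathcal{V}}))$, $\Phi(K)=U(K)$. *)

(* Defs.v *)
From mathcomp Require Import all_boot.
From mathcomp Require Import boolp.

Set Implicit Arguments.
Unset Strict Implicit.
Unset Printing Implicit Defensive.

(** * Categories, functors, adjunctions, monads and their algebras *)

Record category := Category {
  Ob :> Type;
  Hom : Ob -> Ob -> Type;
  cid : forall x, Hom x x;
  ccomp : forall x y z, Hom y z -> Hom x y -> Hom x z;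
  ccompA : forall x y z t (h : Hom z t) (g : Hom y z) (f : Hom x y),
    ccomp h (ccomp g f) = ccomp (ccomp h g) f;
  ccomp1l : forall x y (f : Hom x y), ccomp (cid y) f = f;
  ccomp1r : forall x y (f : Hom x y), ccomp f (cid x) = f }.
Arguments Hom : clear implicits.
Arguments Hom {c}.
Arguments cid {c}.

Notation "g ∘ f" := (ccomp g f) (at level 40, left associativity).

Record functor (C D : category) := Functor {
  fob :> C -> D;
  fmap : forall x y, Hom x y -> Hom (fob x) (fob y);
  fmap_id : forall x, fmap (cid x) = cid (fob x);
  fmap_comp : forall x y z (g : Hom y z) (f : Hom x y),
    fmap (g ∘ f) = fmap g ∘ fmap f }.
Arguments fmap {C D} F {x y} : rename.

Definition faithful C D (F : functor C D) :=
  forall x y : C, injective (@fmap C D F x y).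
Definition full C D (F : functor C D) :=
  forall (x y : C) (g : Hom (F x) (F y)), exists f : Hom x y, fmap F f = g.
Definition is_embedding C D (F : functor C D) :=
  [/\ full F, faithful F & injective (fob F)].

Record adjunction C D (F : functor C D) (G : functor D C) := Adjunction {
  unit : forall x : C, Hom x (G (F x));
  counit : forall y : D, Hom (F (G y)) y;
  unit_nat : forall (x x' : C) (f : Hom x x'),
    fmap G (fmap F f) ∘ unit x = unit x' ∘ f;
  counit_nat : forall (y y' : D) (g : Hom y y'),
    g ∘ counit y = counit y' ∘ fmap F (fmap G g);
  triangleL : forall x, counit (F x) ∘ fmap F (unit x) = cid (F x);
  triangleR : forall y, fmap G (counit y) ∘ unit (G y) = cid (G y) }.

Record monad (C : category) := Monad {
  endo :> functor C C;
  eta : forall x, Hom x (endo x);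
  mu : forall x, Hom (endo (endo x)) (endo x);
  eta_nat : forall (x x' : C) (f : Hom x x'), fmap endo f ∘ eta x = eta x' ∘ f;
  mu_nat : forall (x x' : C) (f : Hom x x'),
    fmap endo f ∘ mu x = mu x' ∘ fmap endo (fmap endo f);
  mu_etal : forall x, mu x ∘ eta (endo x) = cid (endo x);
  mu_etar : forall x, mu x ∘ fmap endo (eta x) = cid (endo x);
  mu_mu : forall x, mu x ∘ mu (endo x) = mu x ∘ fmap endo (mu x) }.

Record algebra C (T : monad C) := Algebra {
  carrier : C;
  act : Hom (T carrier) carrier;
  act_eta : act ∘ eta T carrier = cid carrier;
  act_mu : act ∘ mu T carrier = act ∘ fmap T act }.

Record alg_hom C (T : monad C) (A B : algebra T) := AlgHom {
  alg_map :> Hom (carrier A) (carrier B);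
  alg_mapP : alg_map ∘ act A = act B ∘ fmap T alg_map }.

Lemma alg_hom_eq C (T : monad C) (A B : algebra T) (f g : alg_hom A B) :
  alg_map f = alg_map g -> f = g.
Proof.
case: f g => [f fP] [g gP] /= e; rewrite {}e in fP *.
by congr AlgHom; apply: Prop_irrelevance.
Qed.

Section EilenbergMoore.
Variables (C : category) (T : monad C).

Lemma alg_id_subproof (A : algebra T) :
  cid (carrier A) ∘ act A = act A ∘ fmap T (cid (carrier A)).
Proof. by rewrite fmap_id ccomp1l ccomp1r. Qed.

Lemma alg_comp_subproof (A B D : algebra T) (g : alg_hom B D)
    (f : alg_hom A B) :
  (alg_map g ∘ alg_map f) ∘ act A = act D ∘ fmap T (alg_map g ∘ alg_map f).
Proof. by rewrite fmap_comp -ccompA alg_mapP !ccompA alg_mapP. Qed.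

Definition EM : category.
Proof.
refine (@Category (algebra T) (@alg_hom C T)
  (fun A => AlgHom (alg_id_subproof A))
  (fun A B D g f => AlgHom (alg_comp_subproof g f)) _ _ _).
- by move=> A B D E h g f; apply: alg_hom_eq; apply: ccompA.
- by move=> A B f; apply: alg_hom_eq; apply: ccomp1l.
- by move=> A B f; apply: alg_hom_eq; apply: ccomp1r.
Defined.
End EilenbergMoore.

Section Comparison.
Variables (C D : category) (F : functor C D) (G : functor D C).
Variable adj : adjunction F G.

Definition functor_comp (A B E : category) (K : functor B E)
  (H : functor A B) : functor A E.
Proof.
refine (@Functor A E (fun x => K (H x)) (fun x y f => fmap K (fmap H f)) _ _).
- by move=> x; rewrite !fmap_id.
- by move=> x y z g f; rewrite !fmap_comp.
Defined.

Definition induced_monad : monad C.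
Proof.
refine (@Monad C (functor_comp G F) (unit adj)
  (fun x => fmap G (counit adj (F x))) _ _ _ _ _).
- exact: unit_nat.
- by move=> x x' f /=; rewrite -!fmap_comp counit_nat.
- by move=> x; apply: (triangleR adj (F x)).
- by move=> x /=; rewrite -fmap_comp triangleL fmap_id.
- by move=> x /=; rewrite -!fmap_comp counit_nat.
Defined.

Definition comparison_ob (y : D) : algebra induced_monad.
Proof.
refine (@Algebra C induced_monad (G y) (fmap G (counit adj y)) _ _).
- exact: (triangleR adj y).
- by rewrite /= -!fmap_comp counit_nat.
Defined.

Definition comparison_hom (y z : D) (k : Hom y z) :
  alg_hom (comparison_ob y) (comparison_ob z).
Proof.
refine (@AlgHom C induced_monad (comparison_ob y) (comparison_ob z)
  (fmap G k) _).
by rewrite /= -!fmap_comp counit_nat.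
Defined.

Definition comparison : functor D (EM induced_monad).
Proof.
refine (@Functor D (EM induced_monad) comparison_ob comparison_hom _ _).
- by move=> y; apply: alg_hom_eq; apply: fmap_id.
- by move=> x y z g f; apply: alg_hom_eq; apply: fmap_comp.
Defined.
End Comparison.

(** * The category Str.T of small strict tensor categories *)

(* An arrow together with its endpoints; the strict associativity and unit
   laws of the tensor product of arrows are equalities of such triples,
   since their two sides live in different hom types. *)
Record arr (ob : Type) (hom : ob -> ob -> Type) := Arr {
  arr_dom : ob;
  arr_cod : ob;
  arr_hom : hom arr_dom arr_cod }.
Arguments Arr {ob hom arr_dom arr_cod}.

Record tensor_struct (ob : Type) (hom : ob -> ob -> Type) := TensorStruct {
  tid : forall x, hom x x;
  tcomp : forall x y z, hom y z -> hom x y -> hom x z;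
  ten : ob -> ob -> ob;
  tunit : ob;
  tenm : forall x y x' y',
    hom x y -> hom x' y' -> hom (ten x x') (ten y y');
  tcompA : forall x y z t (h : hom z t) (g : hom y z) (f : hom x y),
    tcomp h (tcomp g f) = tcomp (tcomp h g) f;
  tcomp1l : forall x y (f : hom x y), tcomp (tid y) f = f;
  tcomp1r : forall x y (f : hom x y), tcomp f (tid x) = f;
  tenA : associative ten;
  ten1l : left_id tunit ten;
  ten1r : right_id tunit ten;
  tenm_id : forall x y, tenm (tid x) (tid y) = tid (ten x y);
  tenm_comp : forall x y z x' y' z' (g : hom y z) (f : hom x y)
      (g' : hom y' z') (f' : hom x' y'),
    tenm (tcomp g f) (tcomp g' f') = tcomp (tenm g g') (tenm f f');
  tenmA : forall x y x' y' x'' y''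
      (f : hom x y) (f' : hom x' y') (f'' : hom x'' y''),
    Arr (tenm f (tenm f' f'')) = Arr (tenm (tenm f f') f'');
  tenm1l : forall x y (f : hom x y), Arr (tenm (tid tunit) f) = Arr f;
  tenm1r : forall x y (f : hom x y), Arr (tenm f (tid tunit)) = Arr f }.

Record strT := StrT {
  tob : Type;
  thom : tob -> tob -> Type;
  tstr : tensor_struct thom }.
Arguments thom {V} : rename.

Record strT_functor (V W : strT) := StrTFunctor {
  sob : tob V -> tob W;
  shom : forall x y, thom x y -> thom (sob x) (sob y);
  shom_id : forall x, shom (tid (tstr V) x) = tid (tstr W) (sob x);
  shom_comp : forall x y z (g : thom y z) (f : thom x y),
    shom (tcomp (tstr V) g f) = tcomp (tstr W) (shom g) (shom f);
  sob_ten : forall x y, sob (ten (tstr V) x y) = ten (tstr W) (sob x) (sob y);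
  sob_unit : sob (tunit (tstr V)) = tunit (tstr W);
  shom_ten : forall x y x' y' (f : thom x y) (f' : thom x' y'),
    Arr (shom (tenm (tstr V) f f')) = Arr (tenm (tstr W) (shom f) (shom f')) }.
Arguments shom {V W} K {x y} : rename.

Lemma arr_inj ob (hom : ob -> ob -> Type) x y (f g : hom x y) :
  Arr f = Arr g -> f = g.
Proof.
move=> e.
have aux (p q : arr hom) (epq : p = q) (e1 : arr_dom p = arr_dom q)
    (e2 : arr_cod p = arr_cod q) :
  ecast c (hom (arr_dom q) c) e2 (ecast d (hom d (arr_cod p)) e1 (arr_hom p))
    = arr_hom q.
  by case: _ / epq e1 e2 => e1 e2; rewrite (Prop_irrelevance e1 erefl)
       (Prop_irrelevance e2 erefl).
exact: aux e erefl erefl.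
Qed.

Lemma strT_functor_eq V W (K L : strT_functor V W) :
  (forall x, sob K x = sob L x) ->
  (forall x y (f : thom x y), Arr (shom K f) = Arr (shom L f)) -> K = L.
Proof.
case: K L => [ko kh k1 k2 k3 k4 k5] [lo lh l1 l2 l3 l4 l5] /= eo eh.
have {}eo : ko = lo by apply: funext.
subst lo.
have {}eh : kh = lh.
  apply: functional_extensionality_dep => x.
  apply: functional_extensionality_dep => y.
  by apply: funext => f; apply: arr_inj.
subst lh; congr StrTFunctor; exact: Prop_irrelevance.
Qed.

Definition strT_id (V : strT) : strT_functor V V.
Proof. by refine (@StrTFunctor V V id (fun _ _ f => f) _ _ _ _ _). Defined.

Lemma shom_Arr V W (K : strT_functor V W) x y x' y'
    (f : @thom V x y) (g : @thom V x' y') :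
  Arr f = Arr g -> Arr (shom K f) = Arr (shom K g).
Proof.
pose k (p : arr (@thom V)) := Arr (shom K (arr_hom p)).
by move=> e; apply: (congr1 k e).
Qed.

Definition strT_comp (V W X : strT) (L : strT_functor W X)
  (K : strT_functor V W) : strT_functor V X.
Proof.
refine (@StrTFunctor V X (fun x => sob L (sob K x))
  (fun _ _ f => shom L (shom K f)) _ _ _ _ _).
- by move=> x; rewrite !shom_id.
- by move=> *; rewrite !shom_comp.
- by move=> *; rewrite !sob_ten.
- by rewrite !sob_unit.
- by move=> *; rewrite (shom_Arr L (shom_ten K _ _)) shom_ten.
Defined.

Definition Str_T : category.
Proof.
refine (@Category strT strT_functor strT_id strT_comp _ _ _);
  by move=> *; apply: strT_functor_eq.
Defined.

(* The tensor product of a word of objects, the unit object for the empty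
   word; a one-letter word evaluates to its letter by computation. *)
Definition tens (V : strT) (w : seq (tob V)) : tob V :=
  if w is x :: w' then foldl (ten (tstr V)) x w' else tunit (tstr V).
Arguments tens : clear implicits.

(** * The category T.Sch of tensor schemes *)

Record neword (S : Type) := NeWord { first_letter : S; next_letters : seq S }.
Coercion word_of_neword S (w : neword S) : seq S :=
  first_letter w :: next_letters w.
Definition nemap S S' (f : S -> S') (w : neword S) : neword S' :=
  NeWord (f (first_letter w)) (map f (next_letters w)).

(* The set of morphisms with its source and target maps to nonempty words is
   given by its fibres [sfib v w], as the hom sets of a category are; the set
   itself is the total space [Mor]. *)
Record tscheme := TScheme {
  sOb : Type;
  sfib : neword sOb -> neword sOb -> Type }.
Arguments sfib {D} : rename.

Record Mor (D : tscheme) := MkMor {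
  src : neword (sOb D);
  tgt : neword (sOb D);
  lab : sfib src tgt }.
Arguments MkMor {D src tgt}.

Record tscheme_hom (D E : tscheme) := TSchemeHom {
  hob : sOb D -> sOb E;
  hmor : Mor D -> Mor E;
  hmor_src : forall m, src (hmor m) = nemap hob (src m);
  hmor_tgt : forall m, tgt (hmor m) = nemap hob (tgt m) }.

Lemma tscheme_hom_eq D E (f g : tscheme_hom D E) :
  hob f =1 hob g -> hmor f =1 hmor g -> f = g.
Proof.
case: f g => [fo fm f1 f2] [go gm g1 g2] /= eo em.
have {}eo : fo = go by apply: funext.
have {}em : fm = gm by apply: funext.
subst go gm.
by rewrite (Prop_irrelevance f1 g1) (Prop_irrelevance f2 g2).
Qed.

Lemma nemap_id S (w : neword S) : nemap id w = w.
Proof. by case: w => x w; rewrite /nemap /= map_id. Qed.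

Lemma nemap_comp S S' S'' (g : S' -> S'') (f : S -> S') (w : neword S) :
  nemap (fun x => g (f x)) w = nemap g (nemap f w).
Proof. by case: w => x w; rewrite /nemap /= -map_comp. Qed.

Definition tscheme_id (D : tscheme) : tscheme_hom D D.
Proof.
by refine (@TSchemeHom D D id id _ _) => m; rewrite nemap_id.
Defined.

Definition tscheme_comp (D E G : tscheme) (g : tscheme_hom E G)
  (f : tscheme_hom D E) : tscheme_hom D G.
Proof.
refine (@TSchemeHom D G (fun x => hob g (hob f x))
  (fun m => hmor g (hmor f m)) _ _) => m.
- by rewrite !hmor_src -nemap_comp.
- by rewrite !hmor_tgt -nemap_comp.
Defined.

Definition T_Sch : category.
Proof.
refine (@Category tscheme tscheme_hom tscheme_id tscheme_comp _ _ _);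
  by move=> *; apply: tscheme_hom_eq.
Defined.

(** * The functor U : Str.T -> T.Sch *)

(* [Mor (U_ob V)] is the set of triples (x_1...x_m; y_1...y_n; f). *)
Definition U_ob (V : strT) : tscheme :=
  @TScheme (tob V) (fun v w => thom (tens V v) (tens V w)).

Lemma sob_tens V W (K : strT_functor V W) (w : seq (tob V)) :
  sob K (tens V w) = tens W (map (sob K) w).
Proof.
case: w => [|x w]; first exact: sob_unit.
by elim: w x => //= y w IHw x; rewrite IHw /= sob_ten.
Qed.

Definition U_mor V W (K : strT_functor V W) (m : Mor (U_ob V)) :
    Mor (U_ob W) :=
  @MkMor (U_ob W) (nemap (sob K) (src m)) (nemap (sob K) (tgt m))
    (ecast y (thom _ y) (sob_tens K (tgt m))
      (ecast x (thom x _) (sob_tens K (src m)) (shom K (lab m)))).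

Definition U_hom V W (K : strT_functor V W) :
  tscheme_hom (U_ob V) (U_ob W).
Proof.
by refine (@TSchemeHom (U_ob V) (U_ob W) (sob K) (U_mor K) _ _).
Defined.

Lemma Arr_ecast V (x x' y y' : tob V) (ex : x = x') (ey : y = y')
    (f : thom x y) :
  Arr (ecast c (thom x' c) ey (ecast d (thom d y) ex f)) = Arr f.
Proof. by case: _ / ex; case: _ / ey. Qed.

Lemma U_Mor_eq V (m m' : Mor (U_ob V)) :
  src m = src m' -> tgt m = tgt m' ->
  Arr (lab m : thom (tens V (src m)) (tens V (tgt m))) =
  Arr (lab m' : thom (tens V (src m')) (tens V (tgt m'))) -> m = m'.
Proof.
case: m m' => [s t f] [s' t' f'] /= es et.
by subst s' t' => e; rewrite (arr_inj e).
Qed.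

Definition U : functor Str_T T_Sch.
Proof.
refine (@Functor Str_T T_Sch U_ob U_hom _ _).
- move=> V; apply: tscheme_hom_eq => //= m.
  apply: U_Mor_eq; [exact: nemap_id|exact: nemap_id|].
  exact: (@Arr_ecast V).
- move=> V W X L K; apply: tscheme_hom_eq => //= m.
  apply: U_Mor_eq; [exact: nemap_comp|exact: nemap_comp|].
  apply: (etrans (@Arr_ecast X _ _ _ _ _ _ _)).
  apply/esym/(etrans (@Arr_ecast X _ _ _ _ _ _ _)).
  by apply: shom_Arr; apply: (@Arr_ecast W).
Defined.

(** * Planar graphs *)

(* [sgn h = true] encodes the sign +.  The linear order on the edges, i.e. on
   the orbits of [sigma], is given as a relation between half-edges: [prec h k]
   means that the edge of [h] strictly precedes the edge of [k]. *)
Record pregraph := PreGraph {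
  he : finType;
  vtx : {set {set he}};
  sigma : he -> he;
  sgn : he -> bool;
  prec : rel he }.

Section Graph.
Variable G : pregraph.
Implicit Types (h k : he G) (v : {set he G}).

Definition edge h : {set he G} := [set h; sigma h].

Definition virtual h := (sigma h != h) && (edge h \in vtx G).

Definition virtual_vertex v := [exists h in v, virtual h && (v == edge h)].

Definition leg h := (sigma h == h) || virtual h.

Definition same_vertex h k := [exists v in vtx G, (h \in v) && (k \in v)].

(* The target of the edge of [h] is the source of the edge of [k]. *)
Definition edge_step h k :=
  [exists h' in edge h, exists k' in edge k,
    [&& sgn h', ~~ sgn k' & same_vertex h' k']].

(* The relation e -> e' between the edges of two half-edges; it is only used
   for distinct edges. *)
Definition reach : rel (he G) := connect edge_step.

Record is_planar_graph : Prop := IsPlanarGraph {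
  vtx_partition : partition (vtx G) [set: he G];
  sigmaK : involutive (@sigma G);
  virtual_orbit : forall v h, v \in vtx G -> sigma h != h ->
    edge h \subset v -> v = edge h;
  sgn_sigma : forall h, sigma h != h -> sgn (sigma h) = ~~ sgn h;
  directed_in : forall v, v \in vtx G -> exists2 h, h \in v & sgn h;
  directed_out : forall v, v \in vtx G -> exists2 h, h \in v & ~~ sgn h;
  prec_sigmal : forall h k, prec (sigma h) k = prec h k;
  prec_sigmar : forall h k, prec h (sigma k) = prec h k;
  prec_irr : irreflexive (@prec G);
  prec_trans : transitive (@prec G);
  prec_total : forall h k, k \notin edge h -> prec h k || prec k h;
  prec_reach : forall h k, k \notin edge h -> reach h k -> prec h k;
  prec_between : forall h k l,
    reach h k -> prec h l -> prec l k -> reach h l \/ reach l k }.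

Definition ordered (A : {set he G}) : seq (he G) :=
  sort (fun h k => ~~ prec k h) (enum A).

Definition ins_at v := ordered [set h in v | sgn h].
Definition outs_at v := ordered [set h in v | ~~ sgn h].
Definition ins := ordered [set h | leg h & sgn h].
Definition outs := ordered [set h | leg h & ~~ sgn h].
End Graph.
Arguments sigma {G} : rename.
Arguments sgn {G} : rename.
Arguments prec {G} : rename.
Arguments ins : clear implicits.
Arguments outs : clear implicits.

Definition empty_graph : pregraph :=
  @PreGraph void set0 id (fun _ => true) (fun _ _ => false).

Definition unitary_graph : pregraph :=
  @PreGraph bool [set setT] negb id (fun _ _ => false).

(* The graph with one vertex, m incoming and n outgoing half-edges, all of
   them real legs; the incoming edges precede the outgoing ones. *)
Definition prime_graph (m n : nat) : pregraph :=
  @PreGraph ('I_m + 'I_n)%type [set setT] id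
    (fun h => if h is inl _ then true else false)
    (fun h k => match h, k with
                | inl i, inl j => i < j
                | inr i, inr j => i < j
                | inl _, inr _ => true
                | inr _, inl _ => false
                end).

Definition tensor_graph (G1 G2 : pregraph) : pregraph :=
  @PreGraph (he G1 + he G2)%type
    ([set [set inl h | h in v] | v : {set he G1} in vtx G1] :|:
     [set [set inr h | h in v] | v : {set he G2} in vtx G2])
    (fun h => match h with inl h => inl (sigma h) | inr h => inr (sigma h) end)
    (fun h => match h with inl h => sgn h | inr h => sgn h end)
    (fun h k => match h, k with
                | inl h, inl k => prec h k
                | inr h, inr k => prec h k
                | inl _, inr _ => true
                | inr _, inl _ => false
                end).

(** ** Grafting: the composite of G1 followed by G2 *)

Section Graft.
Variables G1 G2 : pregraph.
Let G := tensor_graph G1 G2.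
Implicit Types x y : he G.

(* The half-edge that [x] is grafted to, if any: the k-th element of
   [outs G1] and the k-th element of [ins G2] are mates. *)
Definition mate x : option (he G) :=
  match x with
  | inl h => omap inr (onth (ins G2) (index h (outs G1)))
  | inr h => omap inl (onth (outs G1) (index h (ins G2)))
  end.

(* A virtual half-edge is deleted if it is grafted, or if the other half of its
   edge is grafted to a real leg. *)
Definition kept x : bool :=
  ~~ (virtual x &&
      (mate x || if mate (sigma x) is Some y then ~~ virtual y else false)).

Definition graft_he : finType := {x : he G | kept x}.

(* To be applied to the half-edges that are kept. *)
Definition graft_sigma x : he G :=
  match mate x, mate (sigma x) with
  | Some y, _ => if virtual y then x else y
  | None, Some y => sigma y
  | None, None => sigma x
  end.

Definition graft_vertex x : {set he G} :=
  if virtual x then [set x; graft_sigma x] else pblock (vtx G) x.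

(* The position of an edge in the order A_1, e_1, B_1, ..., A_n, e_n, B_n: the
   index of its group (counted from 0), and 0, 1 or 2 according to whether it
   lies in some A_k, is some e_k or lies in some B_k. *)
Definition graft_pos x : nat * nat :=
  match x with
  | inl h => (count (fun o => prec o h) (outs G1),
              if (h \in outs G1) || (sigma h \in outs G1) then 1 else 0)
  | inr h => let k := count (fun i => prec i h) (ins G2) in
             if (h \in ins G2) || (sigma h \in ins G2) then (k, 1)
             else (k.-1, 2)
  end.

Definition graft_prec x y : bool :=
  let: (k, c) := graft_pos x in let: (l, d) := graft_pos y in
  [|| k < l, (k == l) && (c < d) |
      [&& k == l, c == d &
          match x, y with
          | inl h, inl h' => prec h h'
          | inr h, inr h' => prec h h'
          | _, _ => false
          end]].

Definition comp_graph : pregraph :=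
  @PreGraph graft_he
    [set [set y : graft_he | \val y \in graft_vertex (\val x)] | x : graft_he]
    (fun x : graft_he => insubd x (graft_sigma (\val x)))
    (fun x : graft_he => sgn (\val x : he G))
    (fun x y : graft_he => graft_prec (\val x) (\val y)).
End Graft.

(** * Diagrams in a tensor scheme *)

(* The decoration of the real vertices is recorded at their half-edges: [deco h]
   is the decoration of the vertex containing [h] if this vertex is real, and
   [None] if it is virtual. *)
Record prediagram (D : tscheme) := PreDiagram {
  graph :> pregraph;
  color : he graph -> sOb D;
  deco : he graph -> option (Mor D) }.
Arguments color {D G} : rename.
Arguments deco {D G} : rename.

Section Diagram.
Variable D : tscheme.
Implicit Types G : prediagram D.

Record is_diagram G : Prop := IsDiagram {
  diagram_planar : is_planar_graph G;
  color_sigma : forall h : he G, color (sigma h) = color h;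
  deco_virtual : forall v h, v \in vtx G -> virtual_vertex v -> h \in v ->
    deco h = None;
  deco_real : forall v, v \in vtx G -> ~~ virtual_vertex v ->
    exists m : Mor D,
      [/\ forall h, h \in v -> deco h = Some m,
          src m = map color (ins_at v) :> seq (sOb D) &
          tgt m = map color (outs_at v) :> seq (sOb D)] }.

Definition ddom G : seq (sOb D) := map color (ins G).
Definition dcod G : seq (sOb D) := map color (outs G).

Definition diso G G' : Prop :=
  exists2 f : he G -> he G', bijective f &
    [/\ forall h, f (sigma h) = sigma (f h),
        forall h, sgn (f h) = sgn h,
        vtx G' = [set [set f h | h in v] | v : {set he G} in vtx G],
        forall h k, prec (f h) (f k) = prec h k &
        forall h, color (f h) = color h /\ deco (f h) = deco h].

Definition empty_diagram : prediagram D :=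
  @PreDiagram D empty_graph (of_void _) (of_void _).

Definition unitary_diagram (x : sOb D) : prediagram D :=
  @PreDiagram D unitary_graph (fun _ => x) (fun _ => None).

Definition prime_diagram (m : Mor D) : prediagram D :=
  @PreDiagram D (prime_graph (size (src m)) (size (tgt m)))
    (fun h => match h with
              | inl i => tnth (in_tuple (src m)) i
              | inr j => tnth (in_tuple (tgt m)) j
              end)
    (fun _ => Some m).

Definition tensor_diagram G1 G2 : prediagram D :=
  @PreDiagram D (tensor_graph G1 G2)
    (fun h => match h with inl h => color h | inr h => color h end)
    (fun h => match h with inl h => deco h | inr h => deco h end).

Definition identity_diagram (w : seq (sOb D)) : prediagram D :=
  foldr (fun x G => tensor_diagram (unitary_diagram x) G) empty_diagram w.

(* [G1] followed by [G2] *)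
Definition comp_diagram G2 G1 : prediagram D :=
  @PreDiagram D (comp_graph G1 G2)
    (fun x => @color D (tensor_diagram G1 G2) (val x))
    (fun x => @deco D (tensor_diagram G1 G2) (val x)).

(* The isomorphism classes of diagrams with domain [v] and codomain [w]. *)
Record diagram_class (v w : seq (sOb D)) := DiagramClass {
  members :> prediagram D -> Prop;
  membersP : exists G,
    [/\ is_diagram G, ddom G = v, dcod G = w & members = diso G] }.

(* The operations on isomorphism classes induced by those on diagrams. *)
Record is_free_struct (S : tensor_struct diagram_class) : Prop := IsFreeStruct {
  free_unit : tunit S = [::];
  free_ten : forall v w, ten S v w = v ++ w;
  free_id : forall w, members (tid S w) = diso (identity_diagram w);
  free_comp : forall u v w (g : diagram_class v w) (f : diagram_class u v) G1 G2,
    f G1 -> g G2 -> members (tcomp S g f) = diso (comp_diagram G2 G1);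
  free_tenm : forall v w v' w' (f : diagram_class v w) (f' : diagram_class v' w')
      G1 G2,
    f G1 -> f' G2 -> members (tenm S f f') = diso (tensor_diagram G1 G2) }.
End Diagram.
Arguments empty_diagram {D}.

Definition relabel D E (p : tscheme_hom D E) (G : prediagram D) : prediagram E :=
  @PreDiagram E G (fun h => hob p (color h)) (fun h => omap (hmor p) (deco h)).

(** * The adjunction F -| U *)

(* [is_free_struct] and the equations below determine all the data, so a
   [free_functor] is the functor F, and its fields express that F(D) is indeed a
   strict tensor category and F(p) a strict tensor functor. *)
Record free_functor := FreeFunctor {
  free_str : forall D : tscheme, tensor_struct (@diagram_class D);
  free_strP : forall D, is_free_struct (free_str D);
  free_hom : forall D E (p : tscheme_hom D E),
    strT_functor (StrT (free_str D)) (StrT (free_str E));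
  free_hom_ob : forall D E (p : tscheme_hom D E) w,
    sob (free_hom p) w = map (hob p) w;
  free_hom_mor : forall D E (p : tscheme_hom D E) v w (f : diagram_class v w) G,
    f G -> members (shom (free_hom p) f : diagram_class _ _)
           = diso (relabel p G) }.

Lemma diagram_class_arr_eq (D : tscheme) v w v' w'
    (f : @diagram_class D v w) (g : @diagram_class D v' w') :
  v = v' -> w = w' -> members f = members g -> Arr f = Arr g.
Proof.
move=> ev ew; subst v' w'; case: f g => [f fP] [g gP] /= e; subst g.
by rewrite (Prop_irrelevance fP gP).
Qed.

Lemma diso_refl (D : tscheme) (G : prediagram D) : diso G G.
Proof.
exists id; first by exists id.
split=> //; apply/setP=> v; apply/idP/imsetP => [vG|[u uG ->]].
- by exists v; rewrite ?imset_id.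
- by rewrite imset_id.
Qed.

Lemma diagram_class_rep (D : tscheme) v w (f : @diagram_class D v w) :
  exists2 G, f G & members f = diso G.
Proof. by case: f => f /= [G [_ _ _ ->]]; exists G => //; apply: diso_refl. Qed.

Lemma relabel_id D (G : prediagram D) : relabel (tscheme_id D) G = G.
Proof.
case: G => G c d; congr PreDiagram.
by apply: funext => h /=; case: (d h).
Qed.

Lemma relabel_comp D E X (q : tscheme_hom E X) (p : tscheme_hom D E)
    (G : prediagram D) :
  relabel (tscheme_comp q p) G = relabel q (relabel p G).
Proof.
case: G => G c d; congr PreDiagram.
by apply: funext => h /=; case: (d h).
Qed.

Section FreeFunctor.
Variable A : free_functor.

Definition F_ob (D : tscheme) : strT := StrT (free_str A D).

Lemma F_id D : free_hom A (tscheme_id D) = strT_id (F_ob D).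
Proof.
apply: strT_functor_eq => /= [w|v w f]; first by rewrite free_hom_ob map_id.
have [G fG ef] := diagram_class_rep f.
apply: diagram_class_arr_eq; rewrite ?free_hom_ob ?map_id //.
by rewrite (@free_hom_mor A _ _ _ _ _ _ _ fG) relabel_id ef.
Qed.

Lemma F_comp D E X (q : tscheme_hom E X) (p : tscheme_hom D E) :
  free_hom A (tscheme_comp q p) = strT_comp (free_hom A q) (free_hom A p).
Proof.
apply: strT_functor_eq => /= [w|v w f].
  by rewrite !free_hom_ob -map_comp.
have [G fG _] := diagram_class_rep f.
have pG := @free_hom_mor A _ _ p _ _ _ _ fG.
apply: diagram_class_arr_eq; rewrite ?free_hom_ob -?map_comp //.
rewrite (@free_hom_mor A _ _ _ _ _ _ _ fG) relabel_comp.
by rewrite (@free_hom_mor A _ _ q _ _ _ (relabel p G)) // pG; apply: diso_refl.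
Qed.

Definition F : functor T_Sch Str_T :=
  @Functor T_Sch Str_T F_ob (@free_hom A) F_id F_comp.
End FreeFunctor.

(* The adjunction of F and U, with the prescribed unit and counit; again all
   data are determined by the equations. *)
Record free_adjunction := FreeAdjunction {
  fa_free :> free_functor;
  fa_adj :> adjunction (F fa_free) U;
  fa_unit_ob : forall (D : tscheme) (x : sOb D),
    hob (unit fa_adj D) x = [:: x];
  fa_unit_mor : forall (D : tscheme) (m : Mor D),
    members (lab (hmor (unit fa_adj D) m) : diagram_class _ _)
    = diso (prime_diagram m);
  fa_counit_ob : forall (V : strT) (w : seq (tob V)),
    sob (counit fa_adj V) w = tens V w;
  fa_counit_mor : forall (V : strT) (m : Mor (U_ob V))
      (p : diagram_class (src m) (tgt m)),
    members p = diso (prime_diagram m) ->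
    Arr (shom (counit fa_adj V) p)
    = Arr (lab m : thom (tens V (src m)) (tens V (tgt m))) }.

(* The category of tensor manifolds, i.e. of algebras over T = UF. *)
Definition tensor_manifolds (A : free_adjunction) : category :=
  EM (induced_monad A).

Definition Phi (A : free_adjunction) : functor Str_T (tensor_manifolds A) :=
  comparison A.

(* Main.v *)
From mathcomp Require Import all_boot zify.
From mathcomp Require Import boolp.
Require Import Defs.

Set Implicit Arguments.
Unset Strict Implicit.
Unset Printing Implicit Defensive.

(** The planar order of a diagram is an order in which its edges can be read
    one after the other. All inputs of a real vertex precede all its outputs, so
    the vertex may be said to fire when its last input is read. At each moment
    the front of this process consists of the edges that wait for the other
    inputs of their target, of the unread outputs of fired vertices, and of the
    unread inputs of the diagram. The betweenness axiom of planar graphs forces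
    the waiting edges to form a stack, from the top of which a firing vertex
    takes its inputs ([waiting_close]); it forces the outputs of the vertex to
    come before all other unread edges ([pending_close]); and it forces inputs
    of the diagram to be read only when no such output is left
    ([pending_input]). Reading a diagram is thus the run of a shift-reduce
    machine, and the diagram can be reconstructed from the record of this run,
    its code: the list that tells for each edge its colour, whether it is an
    input, and whether it leaves the diagram, waits, or lets a vertex with a
    given decoration fire. Codes are a complete invariant of diagrams
    ([coded_uniq], [coded_eq_diso]).

    The tensor product of diagrams concatenates codes ([coded_tensor]), and
    composition interleaves them ([coded_comp]). The laws of a strict tensor
    category become short inductions on lists, and this gives F ([free]). In
    order to compute codes, half-edges are eliminated once and for all: a
    diagram is presented by its edges, each with at most one source and one
    target among the real vertices ([wiring], [wired]).

    The counit evaluates a code: it composes the decorations of the vertices in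
    the order in which they fire, each tensored with the identity of the rest of
    the front. By the interchange law this is a strict tensor functor
    ([ev_cat], [ev_blend]). One triangle identity says that a prime diagram has
    its decoration as value ([ev_prime]), the other one that evaluation in F(D)
    of a code, with each decoration replaced by its prime diagram, gives the code
    back ([ev_unit]).

    The comparison functor is then treated for an arbitrary adjunction with the
    prescribed unit and counit. An arrow of V is a morphism of U(V) between
    one-letter words, hence faithfulness. It is also the value of a prime
    diagram. The square that defines morphisms of algebras says that they
    commute with evaluation; as evaluation preserves identities, composition and
    tensor products, so does each morphism of algebras, hence fullness
    ([alg_functor], [alg_functorE]). Finally, if V and W have the same algebra,
    then they have the same objects and arrows, and by fullness the identity of
    this algebra comes from a strict tensor functor that is the identity on
    objects and arrows; therefore all operations of V and W coincide
    ([scheme_id_eq]). *)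

(** * Codes of planar diagrams *)

Section Codes.
Variable D : tscheme.

(** What happens to an edge once it is read in the planar order: it is an
    output, or it waits for the remaining inputs of its target, or it is the
    last input of a vertex decorated by [m], which fires at this moment. *)
Inductive status := Out | Wait | Close of Mor D.

Record entry := Entry { ecolor : sOb D; is_in : bool; stat : status }.

Definition is_out e := if stat e is Out then true else false.

Definition starts_in (l : seq entry) := if l is e :: _ then is_in e else true.

(** The grafting order A_1, e_1, B_1, ..., A_n, e_n, B_n as an interleaving:
    entries of the second code that are not inputs come as early as possible,
    an output of the first code is glued to the next input of the second. *)
Inductive blend : seq entry -> seq entry -> seq entry -> Prop :=
| BlendNil : blend [::] [::] [::]
| BlendL x l1 l2 l : ~~ is_out x -> starts_in l2 -> blend l1 l2 l ->
    blend (x :: l1) l2 (x :: l)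
| BlendR y l1 l2 l : ~~ is_in y -> blend l1 l2 l -> blend l1 (y :: l2) (y :: l)
| BlendJ c b s l1 l2 l : blend l1 l2 l ->
    blend (Entry c b Out :: l1) (Entry c true s :: l2) (Entry c b s :: l).

(** The cases exclude each other: when the second code starts with an input, it
    has to wait for an output of the first code. *)
Lemma blend_fun l1 l2 l l' : blend l1 l2 l -> blend l1 l2 l' -> l = l'.
Proof.
have clash y l3 : starts_in (y :: l3) -> ~~ is_in y -> l = l'.
  by move=> /= ->.
move=> B; elim: B l' clash => {l1 l2 l} [|x l1 l2 l xo st _ IH|
    y l1 l2 l yi _ IH|c b s l1 l2 l _ IH] l' clash B'; inversion B'; subst => //;
  try (by apply: clash; eassumption);
  by congr cons; apply: IH => // y' l3 /= ->.
Qed.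

Lemma blend_starts l1 l2 l :
  blend l1 l2 l -> starts_in l1 -> starts_in l2 -> starts_in l.
Proof. by case=> //= y ? ? ? /negPf ->. Qed.

Lemma blend_assoc l1 l2 l3 l12 l : blend l1 l2 l12 -> blend l12 l3 l ->
  exists2 l23, blend l2 l3 l23 & blend l1 l23 l.
Proof.
move=> B B'; elim: B' l1 l2 B => {l12 l3 l}.
- by move=> l1 l2 B; inversion B; subst; exists [::]; constructor.
- move=> x l12 l3 l xo st _ IH l1 l2 B; inversion B as [|x' k1 k2 k xo' st' Bk|
    y k1 k2 k yi Bk|c b s k1 k2 k Bk]; subst; have [l23 B1 B2] := IH _ _ Bk.
  + exists l23 => //; constructor=> //.
    exact: blend_starts B1 _ _.
  + by exists (x :: l23); constructor.
  + by exists (Entry c true s :: l23); constructor.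
- move=> y l12 l3 l yi _ IH l1 l2 B; have [l23 B1 B2] := IH _ _ B.
  by exists (y :: l23); constructor.
- move=> c b s l12 l3 l _ IH l1 l2 B; inversion B as [|x' k1 k2 k xo' st' Bk|
    y k1 k2 k yi Bk|c' b' s' k1 k2 k Bk]; subst => //;
    have [l23 B1 B2] := IH _ _ Bk.
  + by exists (Entry c b s :: l23); constructor.
  + by exists (Entry c true s :: l23); constructor.
Qed.

(** The interchange law for codes. If [k2] did not start with an input, its first
    entry would have to come earlier, before the last entries of [l1]. *)
Lemma blend_cat l1 l2 l k1 k2 k : blend l1 l2 l -> starts_in k2 ->
  blend k1 k2 k -> blend (l1 ++ k1) (l2 ++ k2) (l ++ k).
Proof.
move=> B st Bk; elim: B => {l1 l2 l} //= [x l1 l2 l xo sl _ IH|*|*]; constructor=> //.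
by case: l2 sl {IH}.
Qed.

Definition id_code (w : seq (sOb D)) := [seq Entry c true Out | c <- w].

Definition prime_code (m : Mor D) :=
  rcons
    [seq Entry c true Wait
       | c <- belast (first_letter (src m)) (next_letters (src m))]
    (Entry (last (first_letter (src m)) (next_letters (src m))) true (Close m))
  ++ [seq Entry c false Out | c <- tgt m].

(** The front of the reading process consists of the words [L] of the edges
    that wait, [P] of the unread outputs of fired vertices, [I] of the unread
    inputs. The next edge comes from [P] as long as [P] is not empty. *)
Definition reads b (c : sOb D) P I P' I' :=
  if b then [/\ P = [::], P' = [::] & I = c :: I'] else P = c :: P' /\ I = I'.

(** The runs of the shift-reduce machine: [Wait] shifts, [Close m] pops the
    source of [m] from the stack [L] and puts its target in front of [P], and
    [Out] needs the empty stack, since an output of the diagram cannot lie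
    between two inputs of a vertex.
    The last word consists of the outputs to come. *)
Inductive valid : seq entry -> seq (sOb D) -> seq (sOb D) -> seq (sOb D) ->
  seq (sOb D) -> Prop :=
| ValidNil : valid [::] [::] [::] [::] [::]
| ValidOut c b l P I P' I' W : reads b c P I P' I' ->
    valid l [::] P' I' W -> valid (Entry c b Out :: l) [::] P I (c :: W)
| ValidWait c b l L P I P' I' W : reads b c P I P' I' ->
    valid l (rcons L c) P' I' W -> valid (Entry c b Wait :: l) L P I W
| ValidClose c b m l L P I L' P' I' W : reads b c P I P' I' ->
    rcons L c = L' ++ src m -> valid l L' (tgt m ++ P') I' W ->
    valid (Entry c b (Close m) :: l) L P I W.

Lemma reads_cat b c P I P' I' : reads b c P I P' I' -> P ++ I = c :: P' ++ I'.
Proof. by case: b => [[-> -> ->]|[-> ->]]. Qed.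

Lemma valid_inputs l L P I W :
  valid l L P I W -> I = [seq ecolor e | e <- l & is_in e].
Proof.
elim=> //= {l L P I W} [c b l P I P' I' W|c b l L P I P' I' W|
    c b m l L P I L' P' I' W].
- by case: b => /= [[_ _ ->]|[_ ->]] _ ->.
- by case: b => /= [[_ _ ->]|[_ ->]] _ ->.
- by case: b => /= [[_ _ ->]|[_ ->]] _ _ ->.
Qed.

Lemma valid_outputs l L P I W :
  valid l L P I W -> W = [seq ecolor e | e <- l & is_out e].
Proof. by elim=> //= *; f_equal. Qed.

Lemma valid_starts l L I W : valid l L [::] I W -> starts_in l.
Proof.
have rd b c I' P' I'' : reads b c [::] I' P' I'' -> b by case: b => // -[].
by move=> V; inversion V; subst => //=; apply: rd; eassumption.
Qed.

Lemma blend_id_l l L P I W : valid l L P I W -> blend (id_code I) l l.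
Proof.
elim=> {l L P I W} [|c b l P I P' I' W|c b l L P I P' I' W|
    c b m l L P I L' P' I' W]; first by constructor.
- by case: b => -[/= *]; subst; constructor.
- by case: b => -[/= *]; subst; constructor.
- by case: b => -[/= *]; subst; constructor.
Qed.

Lemma blend_id_r l L P I W : valid l L P I W -> blend l (id_code W) l.
Proof.
elim=> {l L P I W} [|c b l P I P' I' W|c b l L P I P' I' W|
    c b m l L P I L' P' I' W]; first exact: BlendNil.
- by move=> _ _; apply: BlendJ.
- by move=> _ _; apply: BlendL => //; case: W.
- by move=> _ _ _; apply: BlendL => //; case: W.
Qed.

End Codes.
Arguments Out {D}.
Arguments Wait {D}.

(** * Evaluation in a strict tensor category *)

(** Arrows are composed together with their endpoints, so that the objects met
    on the way, which agree only up to associativity and unit laws, need no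
    transport. If the arrows do not compose, the value of [acomp] is junk. *)
Section ArrAlgebra.
Variable V : strT.
Let S := tstr V.
Notation A := (arr (@thom V)).

Definition aid x : A := Arr (tid S x).
Definition aten (f g : A) : A := Arr (tenm S (arr_hom f) (arr_hom g)).
Definition acomp (g f : A) : A :=
  if pselect (arr_cod f = arr_dom g) is left e then
    Arr (tcomp S (arr_hom g) (ecast y (thom _ y) e (arr_hom f)))
  else f.

Lemma acompE x y z (g : @thom V y z) (f : @thom V x y) :
  acomp (Arr g) (Arr f) = Arr (tcomp S g f).
Proof.
by rewrite /acomp /=; case: pselect => // e; rewrite (Prop_irrelevance e erefl).
Qed.

Lemma acomp_typed g f : arr_cod f = arr_dom g ->
  arr_dom (acomp g f) = arr_dom f /\ arr_cod (acomp g f) = arr_cod g.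
Proof. by case: g f => y z g [x y' f] /= e; subst; rewrite acompE. Qed.

Lemma acompA h g f : arr_cod f = arr_dom g -> arr_cod g = arr_dom h ->
  acomp h (acomp g f) = acomp (acomp h g) f.
Proof.
case: h g f => z t h [y z' g] [x y' f] /= e e'; subst.
by rewrite !acompE tcompA.
Qed.

Lemma acomp1l x f : arr_cod f = x -> acomp (aid x) f = f.
Proof. by case: f => y z f /= <-; rewrite acompE tcomp1l. Qed.

Lemma acomp1r x f : arr_dom f = x -> acomp f (aid x) = f.
Proof. by case: f => y z f /= <-; rewrite acompE tcomp1r. Qed.

Lemma aten_comp g f g' f' : arr_cod f = arr_dom g -> arr_cod f' = arr_dom g' ->
  aten (acomp g f) (acomp g' f') = acomp (aten g g') (aten f f').
Proof.
case: g f g' f' => y z g [x y1 f] [y' z' g'] [x' y1' f'] /= e e'; subst.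
by rewrite !acompE /aten /= tenm_comp.
Qed.

Lemma aten_id x y : aten (aid x) (aid y) = aid (ten S x y).
Proof. by rewrite /aten /= tenm_id. Qed.

Lemma atenA f g h : aten f (aten g h) = aten (aten f g) h.
Proof. by case: f g h => ? ? f [? ? g] [? ? h]; apply: tenmA. Qed.

Lemma aten1l f : aten (aid (tunit S)) f = f.
Proof. by case: f => ? ? f; apply: tenm1l. Qed.

Lemma aten1r f : aten f (aid (tunit S)) = f.
Proof. by case: f => ? ? f; apply: tenm1r. Qed.

(** [tens] brackets to the left, whereas words are built from the right. *)
Lemma tens_cons x w : tens V (x :: w) = ten S x (tens V w).
Proof.
case: w => [|y w] /=; first by rewrite ten1r.
by elim: w y => //= z w IH y; rewrite -!tenA in IH * => /=; rewrite -IH tenA.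
Qed.

Lemma tens_cat u w : tens V (u ++ w) = ten S (tens V u) (tens V w).
Proof.
elim: u => [|x u IH]; first by rewrite /= ten1l.
by rewrite cat_cons !tens_cons IH tenA.
Qed.

End ArrAlgebra.

(** ** Values of codes *)

Section Evaluation.
Variable V : strT.
Let S := tstr V.
Notation D := (U_ob V).
Notation A := (arr (@thom V)).
Implicit Types (l : seq (entry D)) (L R P I W : seq (tob V)) (m : Mor D).

Definition vertex_arr m : A := Arr (lab m : thom (tens V (src m)) (tens V (tgt m))).

Definition layer L m R : A :=
  aten (aid (tens V L)) (aten (vertex_arr m) (aid (tens V R))).

(** The value of the part [l] of a code that remains to be read, when the
    waiting edges are [L] and the other edges of the front are [R]. *)
Fixpoint ev l L R : A :=
  match l with
  | [::] => aid (tens V (L ++ R))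
  | Entry c _ Out :: l' => aten (aid c) (ev l' L (behead R))
  | Entry c _ Wait :: l' => ev l' (rcons L c) (behead R)
  | Entry c _ (Close m) :: l' =>
      let L' := take (size (rcons L c) - size (src m)) (rcons L c) in
      acomp (ev l' L' (tgt m ++ behead R)) (layer L' m (behead R))
  end.

Lemma ev_close c b m l L L' R : rcons L c = L' ++ src m ->
  ev (@Entry D c b (Close m) :: l) L (c :: R)
  = acomp (ev l L' (tgt m ++ R)) (layer L' m R).
Proof.
move=> /= e; set L1 := take _ _; have -> // : L1 = L'.
by rewrite /L1 e size_cat addnK take_size_cat.
Qed.

Definition typed (f : A) u w := arr_dom f = tens V u /\ arr_cod f = tens V w.

Lemma layer_typed L m R : typed (layer L m R) (L ++ src m ++ R) (L ++ tgt m ++ R).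
Proof. by split; rewrite !tens_cat. Qed.

Lemma aid_typed w : typed (aid (tens V w)) w w.
Proof. by []. Qed.

Lemma aten_typed f g u w u' w' : typed f u w -> typed g u' w' ->
  typed (aten f g) (u ++ u') (w ++ w').
Proof.
by case=> [e1 e2] [e3 e4]; split; rewrite tens_cat /= ?e1 ?e2 ?e3 ?e4.
Qed.

Lemma acomp_typed' g f u v w : typed f u v -> typed g v w -> typed (acomp g f) u w.
Proof.
move=> [e1 e2] [e3 e4].
by rewrite /typed; have [-> ->] := acomp_typed (etrans e2 (esym e3)).
Qed.

Lemma acompA_typed h g f u v w z : typed f u v -> typed g v w -> typed h w z ->
  acomp (acomp h g) f = acomp h (acomp g f).
Proof. by move=> [_ e1] [e2 e3] [e4 _]; rewrite acompA ?e1 ?e2 ?e3 ?e4. Qed.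

Lemma aten_comp_l x g f u v w : typed f u v -> typed g v w ->
  aten (aid x) (acomp g f) = acomp (aten (aid x) g) (aten (aid x) f) :> A.
Proof. by move=> [_ e1] [e2 _]; rewrite -aten_comp ?acomp1l ?e1 ?e2. Qed.

Lemma ev_typed l L P I W : valid l L P I W ->
  typed (ev l L (P ++ I)) (L ++ P ++ I) W.
Proof.
elim=> {l L P I W} [|c b l P I P' I' W /reads_cat -> _ IH|
   c b l L P I P' I' W /reads_cat -> _|
   c b m l L P I L' P' I' W /reads_cat -> e _].
- exact: aid_typed.
- exact: (@aten_typed _ _ [:: c] [:: c]) (aid_typed _) IH.
- by rewrite cat_rcons.
- rewrite (ev_close _ _ _ e) -catA => IH.
  have <- : L' ++ src m ++ P' ++ I' = L ++ c :: P' ++ I'.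
    by rewrite catA -e cat_rcons.
  exact: acomp_typed' (layer_typed _ _ _) IH.
Qed.

Lemma layer_catl L0 L m R :
  layer (L0 ++ L) m R = aten (aid (tens V L0)) (layer L m R).
Proof. by rewrite /layer tens_cat -aten_id !atenA. Qed.

Lemma layer_catr L m R R0 :
  layer L m (R ++ R0) = aten (layer L m R) (aid (tens V R0)).
Proof. by rewrite /layer tens_cat -aten_id !atenA. Qed.

(** The interchange law: a vertex and an arrow to the right of it may be
    evaluated in either order. *)
Lemma layer_slide L m R f u w : typed f u w ->
  acomp (aten (aid (tens V (L ++ tgt m ++ R))) f) (layer L m (R ++ u))
  = acomp (layer L m (R ++ w)) (aten (aid (tens V (L ++ src m ++ R))) f).
Proof.
move=> [e1 e2]; have [t1 t2] := layer_typed L m R.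
rewrite !layer_catr -(@aten_comp _ (aid _) _ _ (aid _) t2 (esym e1))
  -(@aten_comp _ _ (aid _) (aid _) _ (esym t1) e2).
by rewrite !acomp1l // !acomp1r.
Qed.

(** The front of [l1] is always to the left of the inputs of [l2], which are
    read only when [l1] is exhausted. Hence every layer of [l1] acts on the left
    factor, and the layers of [l2] see no front but their own. *)
Lemma ev_cat l1 l2 L P I1 W1 I2 W2 : valid l1 L P I1 W1 ->
  valid l2 [::] [::] I2 W2 ->
  ev (l1 ++ l2) L (P ++ I1 ++ I2) = aten (ev l1 L (P ++ I1)) (ev l2 [::] I2).
Proof.
move=> V1 V2; have T2 := ev_typed V2.
elim: V1 => {l1 L P I1 W1} [|c b l P I P' I' W /reads_cat e _ IH|
   c b l L P I P' I' W /reads_cat e _|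
   c b m l L P I L' P' I' W /reads_cat e e' Vl].
- by rewrite /= aten1l.
- by rewrite catA e /= -catA IH atenA.
- by move=> IH; rewrite catA e /= -catA.
- rewrite -!catA => IH; rewrite (catA P) e !cat_cons -catA.
  rewrite !(ev_close _ _ _ e') IH (catA P') layer_catr.
  have [T1 _] := ev_typed Vl; rewrite -catA in T1.
  rewrite -{2}[ev l2 _ _](@acomp1r _ (tens V I2)); last by case: T2.
  have [_ T3] := layer_typed L' m (P' ++ I').
  by rewrite -aten_comp ?T3 ?T1 //; case: T2.
Qed.

Lemma ev_id w : ev (id_code w : seq (entry D)) [::] w = aid (tens V w).
Proof. by elim: w => //= c w ->; rewrite aten_id -/(tens V (c :: w)) tens_cons. Qed.

Lemma reads_pending b (c : sOb D) P I P' I' : reads b c P I P' I' -> b -> P = [::].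
Proof. by case: b => // -[]. Qed.

Lemma valid_pending l L P I W : valid l L P I W -> starts_in l -> P = [::].
Proof. by case=> //= > /reads_pending. Qed.

(** Evaluation turns composition of codes into composition: while [l1] and
    [l2] are read in the order of the composite, the front of the composite is
    that of [l2] in which the unread inputs are replaced by the front of [l1].
    Both codes cannot be in the middle of their work, which is the last
    hypothesis. Indeed, an entry of [l1] alone is read only when no output of a
    vertex of [l2] is pending. Such outputs arise when an output of [l1], or
    another of them, is read; and an output of [l1] is only read when no edge of
    [l1] waits. *)
Lemma ev_blend l1 l2 l : blend l1 l2 l -> forall L1 P1 I W L2 P2 Z,
  valid l1 L1 P1 I W -> valid l2 L2 P2 W Z -> L1 = [::] \/ P2 = [::] ->
  ev l (L2 ++ L1) (P2 ++ P1 ++ I) = acomp (ev l2 L2 (P2 ++ W))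
    (aten (aid (tens V (L2 ++ P2))) (ev l1 L1 (P1 ++ I))).
Proof.
elim=> {l1 l2 l} [|x l1 l2 l xo st _ IH|y l1 l2 l yi _ IH|c b s l1 l2 l _ IH]
  L1 P1 I W L2 P2 Z V1 V2 LP.
- inversion V1; subst; inversion V2; subst.
  by rewrite /= aten_id acomp1l //= ten1l.
- have T2 := ev_typed V2.
  have P20 := valid_pending V2 st; subst P2.
  inversion V1 as [|c b l0 P I0 P' I' W0 rd V1'|c b l0 L P I0 P' I' W0 rd V1'|
    c b m l0 L P I0 L' P' I' W0 rd eL V1']; subst => //;
    have E := IH _ _ _ _ _ _ _ V1' V2 (or_intror erefl).
  + by rewrite -rcons_cat in E; move: E; rewrite /= (reads_cat rd).
  + have eL2 : rcons (L2 ++ L1) c = (L2 ++ L') ++ src m.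
      by rewrite rcons_cat eL catA.
    rewrite !cat0s (reads_cat rd) (ev_close _ _ _ eL2) (ev_close _ _ _ eL).
    rewrite catA E layer_catl cats0.
    have T1 := ev_typed V1'; rewrite -catA in T1.
    have t := layer_typed L' m (P' ++ I').
    rewrite -catA (aten_comp_l _ t T1).
    by rewrite (acompA_typed (aten_typed (aid_typed _) t)
      (aten_typed (aid_typed _) T1) T2).
- move: yi; inversion V2 as [|c b l0 P I0 P' I' W0 rd V2'|
    c b l0 L P I0 P' I' W0 rd V2'| c b m l0 L P I0 L' P' I' W0 rd eL V2'];
    subst; case: b rd V2 => // -[eP eI] V2 _; subst;
    (have {LP} eL1 : L1 = [::] by case: LP); subst L1;
    have E := IH _ _ _ _ _ _ _ V1 V2' (or_introl erefl);
    have T1 := ev_typed V1; have T2 := ev_typed V2'.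
  + rewrite !cat_cons !cat0s [LHS]/= E [ev (_ :: _) _ (c :: _)]/=.
    rewrite tens_cons -aten_id -atenA -aten_comp ?acomp1l //.
    by case: (aten_typed (aid_typed P') T1) => _ ->; case: T2.
  + by rewrite !cats0 in E *; rewrite [LHS]/= E cat_rcons.
  + rewrite !cats0 in E *; rewrite !cat_cons !(ev_close _ _ _ eL).
    rewrite -!catA in E T2; rewrite E -(cat_rcons c L2 P') eL -catA.
    have t := layer_typed L' m (P' ++ I').
    have t1 := aten_typed (aid_typed (L' ++ src m ++ P')) T1.
    have t2 := aten_typed (aid_typed (L' ++ tgt m ++ P')) T1.
    rewrite -!catA in t1 t2; rewrite (acompA_typed t1 t T2).
    by rewrite -(layer_slide _ _ _ T1) (acompA_typed (layer_typed _ _ _) t2 T2).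
- inversion V1 as [|c' b' l0 P I0 P' I' W0 rd V1'| |]; subst.
  have T1 := ev_typed V1'.
  inversion V2 as [|c' b' l0 P I0 P2' I2' W0' rd2 V2'|
    c' b' l0 L P I0 P2' I2' W0' rd2 V2'|
    c' b' m l0 L P I0 L' P2' I2' W0' rd2 eL V2'];
    subst; case: rd2 => eP eP' [eW]; subst; have T2 := ev_typed V2';
    rewrite !cat0s (reads_cat rd);
    have E := IH _ _ _ _ _ _ _ V1' V2' (or_introl erefl).
  + rewrite !cat0s in E; rewrite [LHS]/= E [ev (_ :: _) _ (c :: _)]/=.
    rewrite !aten1l in E *.
    rewrite [ev (_ :: _) _ (c :: _)]/= -aten_comp ?acomp1l //.
    by case: T1 => _ ->; case: T2.
  + rewrite !cats0 !cat0s in E *; rewrite [LHS]/= E [ev (_ :: _) _ (c :: _)]/=.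
    by rewrite -cats1 tens_cat -aten_id -atenA.
  + rewrite !cats0 in E *; rewrite !(ev_close _ _ _ eL) E.
    have -> : aten (aid (tens V L2)) (ev (@Entry D c b Out :: l1) [::] (c :: P' ++ I'))
        = aten (aid (tens V (L' ++ src m ++ [::]))) (ev l1 [::] (P' ++ I')).
      by rewrite cats0 -eL -cats1 tens_cat -aten_id -atenA.
    have t1 := aten_typed (aid_typed (L' ++ src m ++ [::])) T1.
    have t2 := aten_typed (aid_typed (L' ++ tgt m ++ [::])) T1.
    rewrite -!catA in t1 t2 T2; rewrite (acompA_typed t1 (layer_typed _ _ _) T2).
    rewrite -(layer_slide _ _ _ T1) -(acompA_typed (layer_typed _ _ _) t2 T2).
    by rewrite cats0.
Qed.

Lemma ev_comp l1 l2 l I W Z : blend l1 l2 l -> valid l1 [::] [::] I W ->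
  valid l2 [::] [::] W Z -> ev l [::] I = acomp (ev l2 [::] W) (ev l1 [::] I).
Proof.
move=> B V1 V2; have := ev_blend B V1 V2 (or_introl erefl).
by rewrite /= aten1l.
Qed.

Lemma ev_outputs b w : ev [seq @Entry D c b Out | c <- w] [::] w = aid (tens V w).
Proof. by elim: w => //= c w ->; rewrite aten_id -/(tens V (c :: w)) tens_cons. Qed.

Lemma ev_prime m : ev (prime_code m) [::] (src m) = vertex_arr m.
Proof.
rewrite /prime_code cat_rcons -[X in ev _ _ X]cats0.
have reads_src x s L k R :
    ev ([seq @Entry D c true Wait | c <- belast x s] ++ k) L ((x :: s) ++ R)
    = ev k (L ++ belast x s) (last x s :: R).
  elim: s x L => [|y s IH] x L /=; first by rewrite cats0.
  by rewrite IH cat_rcons.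
rewrite reads_src cat0s (@ev_close _ _ _ _ _ [::]); last by rewrite -lastI.
have [t1 t2] := layer_typed [::] m [::].
rewrite !cats0 ev_outputs acomp1l; first by rewrite /layer aten1l aten1r.
by rewrite t2 /= cats0.
Qed.

End Evaluation.

Section CodeValidity.
Variable D : tscheme.

Lemma valid_id (w : seq (sOb D)) : valid (id_code w) [::] [::] w w.
Proof. by elim: w => [|c w]; [constructor | apply: ValidOut]. Qed.

Lemma valid_prime (m : Mor D) : valid (prime_code m) [::] [::] (src m) (tgt m).
Proof.
rewrite /prime_code cat_rcons.
have reads_src x s L k W : valid k (L ++ belast x s) [::] [:: last x s] W ->
    valid ([seq @Entry D c true Wait | c <- belast x s] ++ k) L [::] (x :: s) W.
  elim: s x L => [|y s IH] x L /=; first by rewrite cats0.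
  by move=> v; apply: ValidWait => //; apply: IH; rewrite cat_rcons.
apply: reads_src; apply: (@ValidClose _ _ _ _ _ _ _ _ [::]) => //.
  by rewrite -lastI.
by rewrite cats0; elim: (tgt m : seq _) => [|c w]; [constructor | apply: ValidOut].
Qed.

Lemma valid_cat (l1 l2 : seq (entry D)) L P I1 W1 I2 W2 : valid l1 L P I1 W1 ->
  valid l2 [::] [::] I2 W2 -> valid (l1 ++ l2) L P (I1 ++ I2) (W1 ++ W2).
Proof.
have rc b (c : sOb D) P' I P'' I' : reads b c P' I P'' I' ->
    reads b c P' (I ++ I2) P'' (I' ++ I2).
  by case: b => [[-> -> ->]|[-> ->]].
move=> V1 V2; elim: V1 => {l1 L P I1 W1} //= *.
- by apply: ValidOut; first by apply: rc; eassumption.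
- by apply: ValidWait; first by apply: rc; eassumption.
- by apply: ValidClose; first by [apply: rc; eassumption]; eassumption.
Qed.

End CodeValidity.

(** * Wirings: planar graphs described by their edges *)

(** The half-edges are forgotten: an edge has at most one source and at most one
    target, both real vertices. Virtual edges are those that have neither, and
    virtual vertices disappear. *)
Record wiring (D : tscheme) := Wiring {
  wE : finType;
  wlt : rel wE;
  wV : finType;
  wS : wE -> option wV;
  wT : wE -> option wV;
  wcol : wE -> sOb D;
  wdec : wV -> Mor D }.
Arguments wlt {D X} : rename.
Arguments wS {D X} : rename.
Arguments wT {D X} : rename.
Arguments wcol {D X} : rename.
Arguments wdec {D X} : rename.

Section Wiring.
Variables (D : tscheme) (X : wiring D).
Implicit Types (e i o : wE X) (v : wV X).
Notation lt := (@wlt D X).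
Notation S := (@wS D X).
Notation T := (@wT D X).

Definition wstep e e' := [exists v, (T e == Some v) && (S e' == Some v)].
Definition wreach : rel (wE X) := connect wstep.
Definition wedges := sort (fun e e' => ~~ lt e' e) (enum (wE X)).
Definition wins v := [seq e <- wedges | T e == Some v].
Definition wouts v := [seq e <- wedges | S e == Some v].
Definition winputs := [seq e <- wedges | S e == None].
Definition woutputs := [seq e <- wedges | T e == None].

Record planar_order : Prop := PlanarOrder {
  wlt_irr : irreflexive lt;
  wlt_trans : transitive lt;
  wlt_total : forall e e', e != e' -> lt e e' || lt e' e;
  win_ex : forall v, exists e, T e = Some v;
  wout_ex : forall v, exists e, S e = Some v;
  wstep_lt : forall e e', wstep e e' -> lt e e';
  wbetween : forall e e' e'', wreach e e'' -> lt e e' -> lt e' e'' ->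
    wreach e e' \/ wreach e' e'' }.

Record planar : Prop := Planar {
  planar_ordered :> planar_order;
  wdec_src : forall v, src (wdec v) = map wcol (wins v) :> seq (sOb D);
  wdec_tgt : forall v, tgt (wdec v) = map wcol (wouts v) :> seq (sOb D) }.

Definition wlast e := [forall e', (T e' == T e) ==> ~~ lt e e'].

Definition wentry e := Entry (wcol e) (S e == None)
  (if T e is Some v then if wlast e then Close (wdec v) else Wait else Out).

Definition wcode := map wentry wedges.

Lemma wstepP e e' : reflect (exists2 v, T e = Some v & S e' = Some v) (wstep e e').
Proof.
apply: (iffP existsP) => [[v /andP[/eqP e1 /eqP e2]]|[v e1 e2]]; exists v => //.
by rewrite e1 e2 !eqxx.
Qed.

Lemma mem_wedges e : e \in wedges.
Proof. by rewrite mem_sort mem_enum. Qed.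

Hypothesis PX : planar_order.
Let irr := wlt_irr PX.
Let trans := wlt_trans PX.

Lemma wlt_asym e e' : lt e e' -> lt e' e = false.
Proof. by move=> l; apply/negP=> l'; have := trans l l'; rewrite irr. Qed.

Lemma wlt_neq e e' : lt e e' -> e != e'.
Proof. by apply: contraTneq => ->; rewrite irr. Qed.

Lemma wnlt e e' : ~~ lt e e' -> e = e' \/ lt e' e.
Proof.
move=> n; case: (eqVneq e e') => [|/(wlt_total PX)]; first by left.
by rewrite (negPf n); right.
Qed.

Lemma wedges_sorted : pairwise lt wedges.
Proof.
have tot : total (fun e e' => ~~ lt e' e).
  by move=> e e' /=; case: (boolP (lt e e')) => [/wlt_asym ->|]; rewrite ?orbT.
have tr : transitive (fun e e' => ~~ lt e' e).
  move=> y x z /= /wnlt[->//|l] /wnlt[->|l']; first by rewrite (wlt_asym l).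
  by rewrite (wlt_asym (trans l l')).
have: pairwise (fun e e' => ~~ lt e' e) wedges.
  by rewrite -sorted_pairwise //; apply: sort_sorted.
have: uniq wedges by rewrite sort_uniq enum_uniq.
elim: wedges => //= e s IH /andP[es us] /andP[al ps].
rewrite IH // andbT; apply/allP => e' e's.
case: (wnlt (allP al _ e's)) => // eq_e.
by rewrite -eq_e e's in es.
Qed.

Lemma sorted_uniq_eq (s s' : seq (wE X)) : pairwise lt s -> pairwise lt s' ->
  s =i s' -> s = s'.
Proof.
by rewrite -!sorted_pairwise //; apply: irr_sorted_eq.
Qed.

Lemma wreach_lt e e' : wreach e e' -> e = e' \/ lt e e'.
Proof.
move=> /connectP[p]; elim: p e => [|f p IH] e /=; first by left.
move=> /andP[/(wstep_lt PX) l pp] ep; right.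
by case: (IH _ pp ep) => [<-//|]; apply: trans.
Qed.

Lemma wreach_from e e' : wreach e e' -> e <> e' ->
  exists v o, [/\ T e = Some v, S o = Some v & wreach o e'].
Proof.
move=> /connectP[[|f p] /=]; first by move=> _ ->.
move=> /andP[/wstepP[v Te Sf] pp] ep _; exists v, f; split=> //.
by apply/connectP; exists p.
Qed.

Lemma wreach_to e e' : wreach e e' -> e <> e' ->
  exists v i, [/\ T i = Some v, S e' = Some v & wreach e i].
Proof.
move=> /connectP[p]; elim/last_ind: p => [|p f _]; first by move=> _ /= ->.
rewrite rcons_path last_rcons => /andP[pp /wstepP[v Tl Sf]] -> _.
by exists v, (last e p); split=> //; apply/connectP; exists p.
Qed.

Lemma wstep_lt' e e' v : T e = Some v -> S e' = Some v -> lt e e'.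
Proof. by move=> Te Se; apply: wstep_lt => //; apply/wstepP; exists v. Qed.

Lemma wstep_reach e e' v : T e = Some v -> S e' = Some v -> wreach e e'.
Proof. by move=> Te Se; apply: connect1; apply/wstepP; exists v. Qed.

(** Betweenness is applied to [i] and an output [o] of [v]. The edge [e] cannot be
    reached from [i], because it would come after all inputs of [v]; hence [o] is
    reached from [e], and this path enters [v] through an input. *)
Lemma between_inputs i j e v : T i = Some v -> T j = Some v -> lt i e -> lt e j ->
  exists2 w, T e = Some w & exists2 j', T j' = Some v & wreach e j'.
Proof.
move=> Ti Tj lie lej; have [o So] := wout_ex PX v.
have lo := wstep_lt' Tj So.
case: (wbetween PX (wstep_reach Ti So) lie (trans lej lo)) => r.
  have [] := wreach_from r; first by move=> ie; rewrite ie irr in lie.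
  move=> w [o' [Ti' So' r']]; move: Ti'; rewrite Ti => -[?]; subst w.
  have := wstep_lt' Tj So'; case: (wreach_lt r') => [->|l].
    by rewrite wlt_asym.
  by rewrite (wlt_asym (trans l lej)).
have neo : e <> o by move=> eo; rewrite -eo (wlt_asym lej) in lo.
have [w [o' [Te _ _]]] := wreach_from r neo; exists w => //.
have [v' [j' [Tj' So' r']]] := wreach_to r neo; exists j' => //.
by move: So' Tj'; rewrite So => -[->].
Qed.

(** ** Reading the edges in the planar order *)

Section Reading.

(** If [s] consists of the unread edges, then the vertex [v] is fed by [s] if and
    only if it has not fired. *)
Definition fed (s : seq (wE X)) v := has (fun j => T j == Some v) s.
Arguments fed : simpl never.

(** Here [s'] decides which vertices have not fired, and [s] is searched: the edges
    read so far in [waiting], unread edges in [pending]. Two lists are needed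
    because in the middle of a step the edge being read has left [s], while its
    target has not fired. *)
Definition waiting (s' s : seq (wE X)) :=
  [seq x <- s | if T x is Some v then fed s' v else false].
Definition pending (s' s : seq (wE X)) :=
  [seq x <- s | if S x is Some v then ~~ fed s' v else false].

Lemma fedP s v : reflect (exists2 j, j \in s & T j = Some v) (fed s v).
Proof.
apply: (iffP hasP) => -[j js Tj]; exists j => //; first exact/eqP.
by rewrite Tj.
Qed.

Arguments waiting : simpl never.
Arguments pending : simpl never.

Variables (pre : seq (wE X)) (e : wE X) (suf : seq (wE X)).
Hypothesis edgesE : wedges = pre ++ e :: suf.

Lemma readP x : [\/ x \in pre /\ lt x e, x = e | x \in suf /\ lt e x].
Proof.
have := mem_wedges x; rewrite edgesE mem_cat inE.
have := wedges_sorted; rewrite edgesE pairwise_cat /= allrel_consr.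
case/and3P=> /andP[/allP l1 _] _ /andP[/allP l2 _].
case/or3P=> [xp|/eqP ->|xs]; [constructor 1|by constructor 2|constructor 3].
  by split=> //; apply: l1.
by split=> //; apply: l2.
Qed.

Lemma mem_pre x : (x \in pre) = lt x e.
Proof.
case: (readP x) => [[-> ->]|->|[xs ex]] //; have := wedges_sorted;
  rewrite edgesE pairwise_cat allrel_consr => /and3P[/andP[/allP l1 _] _ _].
  by rewrite irr; apply/negP=> /l1; rewrite irr.
by rewrite wlt_asym //; apply/negP=> /l1; rewrite wlt_asym.
Qed.

Lemma mem_suf x : (x \in suf) = lt e x.
Proof.
case: (readP x) => [[xs ex]|->|[-> ->]] //; have := wedges_sorted;
  rewrite edgesE pairwise_cat /= => /and3P[_ _ /andP[/allP l1 _]].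
  by rewrite wlt_asym //; apply/negP=> /l1; rewrite wlt_asym.
by rewrite irr; apply/negP=> /l1; rewrite irr.
Qed.

Lemma fed_suf v : fed suf v -> exists2 j, T j = Some v & lt e j.
Proof. by case/fedP=> j; rewrite mem_suf; exists j. Qed.

Lemma nfed_suf v j : ~~ fed suf v -> T j = Some v -> j = e \/ lt j e.
Proof.
move=> nf Tj; case: (readP j) => [[]|->|[js _]]; [by right|by left|].
by case/fedP: nf; exists j.
Qed.

Lemma fed_here v : fed (e :: suf) v = (T e == Some v) || fed suf v.
Proof. by []. Qed.

Lemma not_fed v x : S x = Some v -> x = e \/ lt x e -> ~~ fed (e :: suf) v.
Proof.
move=> Sx le_xe; apply/negP=> /orP[/eqP Te|/fed_suf[j Tj lj]].
  have := wstep_lt' Te Sx; case: le_xe => [->|/wlt_asym->] //; by rewrite irr.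
have := wstep_lt' Tj Sx; case: le_xe => [->|l]; first by rewrite wlt_asym.
by rewrite (wlt_asym (trans l lj)).
Qed.

(** If an output [p] of a fired vertex [u] came after [e], then [e] would lie
    between an input of [u] and [p]. As [e] has no source, [p] would be reached
    from [e], through an input of [u] that is still unread. *)
Lemma pending_input : S e = None -> pending (e :: suf) (e :: suf) = [::].
Proof.
move=> Se; rewrite /pending /= Se; apply/eqP; rewrite -[_ == _]negbK -has_filter.
apply/hasP=> -[p ps]; case Sp: (S p) => [u|//] nf.
have [i Ti] := win_ex PX u.
have nf' : ~~ fed suf u by apply: contra nf => f; apply/orP; right.
have ie : lt i e.
  case: (nfed_suf nf' Ti) => // ie; move: nf.
  by rewrite fed_here -ie Ti eqxx.
have ep : lt e p by rewrite -mem_suf.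
case: (wbetween PX (wstep_reach Ti Sp) ie ep) => r.
  have [] := wreach_to r; first by move=> ie'; rewrite ie' irr in ie.
  by move=> ? [? [_]]; rewrite Se.
have [|v [j [Tj Sp' r']]] := wreach_to r.
  by move=> ep'; rewrite ep' irr in ep.
move: Sp'; rewrite Sp => -[?]; subst v.
have /negP[] := nf; apply/orP; case: (wreach_lt r') => [->|lj].
  by left; apply/eqP.
by right; apply/fedP; exists j => //; rewrite mem_suf.
Qed.

Lemma pending_output u : S e = Some u ->
  pending (e :: suf) (e :: suf) = e :: pending (e :: suf) suf.
Proof. by move=> Se; rewrite /pending /= Se (not_fed Se) //; left. Qed.

(** A waiting edge has a later companion with the same target; an edge between
    the two has a target by [between_inputs]. *)
Lemma waiting_out : T e = None -> waiting (e :: suf) pre = [::].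
Proof.
move=> Te; apply/eqP; rewrite -[_ == _]negbK -has_filter; apply/hasP=> -[i ip].
case Ti: (T i) => [v|//]; rewrite fed_here Te /= => /fed_suf[j Tj lej].
have lie : lt i e by rewrite -mem_pre.
by have [w] := between_inputs Ti Tj lie lej; rewrite Te.
Qed.

Lemma waiting_out' : T e = None -> waiting suf (rcons pre e) = [::].
Proof.
move=> Te; rewrite /waiting filter_rcons Te -[RHS](waiting_out Te).
by apply: eq_filter => x; case: (T x) => // v; rewrite fed_here Te.
Qed.

Lemma pending_not_last : ~~ wlast e || (T e == None) ->
  pending suf suf = pending (e :: suf) suf.
Proof.
move=> nl; apply: eq_filter => x; case: (S x) => // v; rewrite fed_here.
case: eqP => // Te; rewrite Te orbF in nl.
case/forallPn: nl => j; rewrite negb_imply negbK => /andP[/eqP Tj lej].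
suff -> : fed suf v by [].
by apply/fedP; exists j; rewrite ?mem_suf // Tj.
Qed.

Lemma waiting_wait v : T e = Some v -> ~~ wlast e ->
  waiting suf (rcons pre e) = rcons (waiting (e :: suf) pre) e.
Proof.
move=> Te /forallPn[j]; rewrite negb_imply negbK => /andP[/eqP Tj lej].
have fv : fed suf v by apply/fedP; exists j; rewrite ?mem_suf // Tj.
rewrite /waiting filter_rcons Te fv; congr rcons; apply: eq_filter => x.
case: (T x) => // w; rewrite fed_here Te.
by case: (eqVneq (Some v)) => // -[<-].
Qed.

Lemma last_nfed v : T e = Some v -> wlast e -> ~~ fed suf v.
Proof.
move=> Te /forallP la; apply/negP=> /fed_suf[j Tj lej].
by have := la j; rewrite Te Tj eqxx lej.
Qed.

Lemma pairwise_pre : pairwise lt (rcons pre e).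
Proof.
by have := wedges_sorted; rewrite edgesE -cat_rcons pairwise_cat => /and3P[].
Qed.

Lemma pairwise_suf : pairwise lt suf.
Proof.
by have := wedges_sorted; rewrite edgesE -cat_rcons pairwise_cat => /and3P[].
Qed.

(** The inputs of [v] are on top of the stack of waiting edges: an edge between
    two inputs of [v] leads to an input of [v], hence its target has fired
    already. Both sides enumerate the same edges in increasing order. *)
Lemma waiting_close v : T e = Some v -> wlast e ->
  rcons (waiting (e :: suf) pre) e = waiting suf (rcons pre e) ++ wins v.
Proof.
move=> Te la; have nf := last_nfed Te la.
have insE : wins v = rcons [seq x <- pre | T x == Some v] e.
  rewrite /wins edgesE -cat_rcons filter_cat filter_rcons Te eqxx.
  rewrite [X in _ ++ X](_ : _ = [::]) ?cats0 //; apply/eqP.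
  by rewrite -[_ == _]negbK -has_filter.
have below : waiting suf (rcons pre e) = waiting suf pre.
  by rewrite /waiting filter_rcons Te (negPf nf).
rewrite insE below -rcons_cat; congr rcons.
have pp : pairwise lt pre.
  by have := pairwise_pre; rewrite pairwise_rcons => /andP[].
apply: sorted_uniq_eq.
- exact: pairwise_filter.
- rewrite pairwise_cat !pairwise_filter //= andbT; apply/allrelP => i j.
  rewrite !mem_filter; case Ti: (T i) => [w|] //= /andP[fw ip] /andP[/eqP Tj jp].
  have [k Tk lek] := fed_suf fw.
  case: (boolP (lt i j)) => // /wnlt[ij|lji].
    by move: Tj; rewrite -ij Ti => -[wv]; rewrite -wv fw in nf.
  exfalso; have lie : lt i e by rewrite -mem_pre.
  have [w' Ti' [j' Tj' r]] := between_inputs Tj Te lji lie.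
  have [|u [o [Ti2 So r']]] := wreach_from r.
    by move=> ij; move: Ti; rewrite ij Tj' => -[wv]; rewrite -wv (negPf nf) in fw.
  move: Ti2; rewrite Ti => -[?]; subst u.
  have lko := trans lek (wstep_lt' Tk So).
  have leo : lt e j' by case: (wreach_lt r') => [<-|]; last exact: trans.
  by case: (nfed_suf nf Tj') leo => [->|/wlt_asym ->] //; rewrite irr.
- move=> x; rewrite mem_cat !mem_filter -andb_orl; congr andb.
  case Tx: (T x) => [w|] //; rewrite fed_here Te orbC.
  by rewrite [Some w == _]eq_sym.
Qed.

(** The outputs of [v] come before all other pending edges: if [p] lies between
    [e] and an output [o] of [v], then either [p] is reached from [e], and its
    source has not fired yet, or [o] is reached from [p], through an input of [v]
    that comes after [e], although [e] is the last one. *)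
Lemma pending_close v : T e = Some v -> wlast e ->
  pending suf suf = wouts v ++ pending (e :: suf) suf.
Proof.
move=> Te la; have nf := last_nfed Te la.
have outs_suf x : S x = Some v -> x \in suf.
  by move=> Sx; rewrite mem_suf (wstep_lt' Te Sx).
have pp := pairwise_suf.
apply: sorted_uniq_eq.
- exact: pairwise_filter.
- rewrite pairwise_cat !pairwise_filter ?wedges_sorted //= !andbT.
  apply/allrelP => o p.
  rewrite !mem_filter => /andP[/eqP So _].
  case Sp: (S p) => [u|] //= /andP[nfu ps].
  case: (boolP (lt o p)) => // /wnlt[op|lpo].
    by move: Sp; rewrite -op So => -[vu]; rewrite -vu fed_here Te eqxx in nfu.
  have lep : lt e p by rewrite -mem_suf.
  case: (wbetween PX (wstep_reach Te So) lep lpo) => r.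
    have [|v' [o' [Te' So' r']]] := wreach_from r.
      by move=> ep; rewrite ep irr in lep.
    move: Te'; rewrite Te => -[?]; subst v'.
    have [|u' [i [Ti Sp' r2]]] := wreach_to r'.
      move=> po; move: So'; rewrite po Sp => -[uv].
      by rewrite uv fed_here Te eqxx in nfu.
    move: Sp'; rewrite Sp => -[?]; subst u'.
    case/negP: nfu; rewrite fed_here; apply/orP; right; apply/fedP; exists i => //.
    have leo := wstep_lt' Te So'.
    by rewrite mem_suf; case: (wreach_lt r2) => [<-|/(trans leo)].
  have [|v' [i [Ti So' r']]] := wreach_to r.
    by move=> po; rewrite po irr in lpo.
  move: So'; rewrite So => -[?]; subst v'.
  have lei : lt e i by case: (wreach_lt r') => [<-|/(trans lep)].
  by case: (nfed_suf nf Ti) lei => [->|/wlt_asym ->] //; rewrite irr.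
- move=> x; rewrite mem_cat !mem_filter mem_wedges andbT.
  case Sx: (S x) => [u|] //; rewrite fed_here Te [Some u == _]eq_sym.
  case: (eqVneq (Some v) (Some u)) => [[uv]|_] //=; subst u.
  by rewrite nf outs_suf.
Qed.

End Reading.
End Wiring.
Arguments fed : simpl never.
Arguments waiting : simpl never.
Arguments pending : simpl never.

Section CodeOfWiring.
Variables (D : tscheme) (X : wiring D).
Notation S := (@wS D X).
Notation T := (@wT D X).
Hypothesis PD : planar X.

(** The invariant of the machine: after [pre] has been read, its three words are
    those of the waiting, the pending and the unread input edges. *)
Lemma wcode_valid_suffix suf pre : wedges X = pre ++ suf ->
  valid [seq wentry e | e <- suf] [seq wcol e | e <- waiting suf pre]
    [seq wcol e | e <- pending suf suf] [seq wcol e | e <- suf & S e == None]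
    [seq wcol e | e <- suf & T e == None].
Proof.
elim: suf pre => [|e suf IH] pre edgesE.
  rewrite /waiting (_ : [seq x <- pre | _] = [::]); first by constructor.
  by apply/eqP; rewrite -[_ == _]negbK -has_filter; apply/hasP=> -[x _]; case: (T x).
have {}IH := IH (rcons pre e); rewrite cat_rcons in IH; have {}IH := IH edgesE.
have rd : reads (S e == None) (wcol e)
   [seq wcol e | e <- pending (e :: suf) (e :: suf)]
   [seq wcol e | e <- e :: suf & S e == None]
   [seq wcol e | e <- pending (e :: suf) suf]
   [seq wcol e | e <- suf & S e == None].
  case Se: (S e) => [u|].
    by rewrite (pending_output PD edgesE Se) /= Se.
  have pE : pending (e :: suf) (e :: suf) = pending (e :: suf) suf.
    by rewrite /pending /= Se.
  by rewrite -pE (pending_input PD edgesE Se) /= Se.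
rewrite map_cons {1}/wentry.
case Te: (T e) => [v|].
  case: (boolP (wlast e)) => la.
    have w := waiting_close PD edgesE Te la.
    apply: ValidClose rd _ _.
      by rewrite -map_rcons w map_cat (wdec_src PD).
    by rewrite (wdec_tgt PD v) -map_cat -(pending_close PD edgesE Te la) /= Te.
  apply: ValidWait rd _; rewrite -map_rcons -(waiting_wait PD edgesE Te la) /= Te /=.
  by rewrite -(pending_not_last PD edgesE) ?la.
rewrite (waiting_out PD edgesE Te) /= Te /=; apply: ValidOut rd _.
rewrite -(pending_not_last PD edgesE) ?Te ?orbT //.
by have := IH; rewrite (waiting_out' PD edgesE Te).
Qed.

Theorem wcode_valid : valid (wcode X) [::] [::]
  (map wcol (winputs X)) (map wcol (woutputs X)).
Proof.
have := @wcode_valid_suffix (wedges X) [::] erefl.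
rewrite /pending (_ : [seq x <- wedges X | _] = [::]) //.
apply/eqP; rewrite -[_ == _]negbK -has_filter; apply/hasP=> -[x _].
case: (S x) => // v /negP[]; have [i Ti] := win_ex PD v.
by apply/fedP; exists i; rewrite ?mem_wedges.
Qed.

End CodeOfWiring.

(** * A planar wiring is determined by its code *)

Section Rigidity.
Variables (D : tscheme) (X Y : wiring D).
Hypotheses (PX : planar X) (PY : planar Y) (codeE : wcode X = wcode Y).
Implicit Types (v : wV X) (w : wV Y).

Definition edge_pairs := zip (wedges X) (wedges Y).
Notation z := edge_pairs.

(** The codes pair the edges. As the code shows which edges are last inputs, and
    of vertices with which decoration, the pairs of last inputs pair the
    vertices. It remains to see that the other ends of paired edges are paired
    vertices; for this the code has to be run. *)
Definition vertex_pair v w := exists p, [/\ p \in z, wlast p.1, wlast p.2,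
  wT p.1 = Some v & wT p.2 = Some w].

Lemma size_edges : size (wedges X) = size (wedges Y).
Proof. by have := congr1 size codeE; rewrite !size_map. Qed.

Lemma unzip1_pairs : unzip1 z = wedges X.
Proof. by rewrite unzip1_zip ?size_edges. Qed.

Lemma unzip2_pairs : unzip2 z = wedges Y.
Proof. by rewrite unzip2_zip ?size_edges. Qed.

Lemma uniq_wedges (Z : wiring D) : uniq (wedges Z).
Proof. by rewrite sort_uniq enum_uniq. Qed.

Lemma pairs_fun p q : p \in z -> q \in z -> p.1 = q.1 -> p = q.
Proof.
have := uniq_wedges X; rewrite -unzip1_pairs => u pz qz e.
have [i il pE] := nthP p pz; have [j jl qE] := nthP p qz.
have : nth p.1 (unzip1 z) i = nth p.1 (unzip1 z) j.
  by rewrite !(nth_map p) // pE qE e.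
by move/eqP; rewrite nth_uniq ?size_map // -pE -qE => /eqP ->.
Qed.

Lemma pairs_inj p q : p \in z -> q \in z -> p.2 = q.2 -> p = q.
Proof.
have := uniq_wedges Y; rewrite -unzip2_pairs => u pz qz e.
have [i il pE] := nthP p pz; have [j jl qE] := nthP p qz.
have : nth p.2 (unzip2 z) i = nth p.2 (unzip2 z) j.
  by rewrite !(nth_map p) // pE qE e.
by move/eqP; rewrite nth_uniq ?size_map // -pE -qE => /eqP ->.
Qed.

Lemma pairs_entry p : p \in z -> wentry p.1 = wentry p.2.
Proof.
move=> pz; have [i il pE] := nthP p pz.
have s : size z = size (wedges X) by rewrite size_zip size_edges minnn.
have := congr1 (fun l => nth (wentry p.1) l i) codeE.
rewrite /wcode (nth_map p.1) -?s // (nth_map p.2) -?size_edges -?s //.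
have pE' : p = (nth p.1 (wedges X) i, nth p.2 (wedges Y) i).
  by rewrite -nth_zip ?size_edges // -surjective_pairing.
have e1 : nth p.1 (wedges X) i = p.1 by rewrite [in RHS]pE'.
have e2 : nth p.2 (wedges Y) i = p.2 by rewrite [in RHS]pE'.
by rewrite e1 e2.
Qed.

Lemma pairs_lastE p v : p \in z -> wT p.1 = Some v -> exists w,
  [/\ wT p.2 = Some w, wlast p.1 = wlast p.2 & wlast p.1 -> wdec v = wdec w].
Proof.
move=> /pairs_entry; rewrite /wentry => -[_ _] eT Tv; move: eT; rewrite Tv.
case: (wT p.2) => [w|]; last by case: ifP.
case: ifP => l1; case: ifP => // l2 eT; exists w => //.
by case: eT => ->.
Qed.

Lemma pairs_T0 p : p \in z -> (wT p.1 == None) = (wT p.2 == None).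
Proof.
move=> /pairs_entry; rewrite /wentry => -[_ _].
case: (wT p.1) => [v|]; case: (wT p.2) => [w|] //; by case: ifP.
Qed.

Lemma pairs_S0 p : p \in z -> (wS p.1 == None) = (wS p.2 == None).
Proof. by move=> /pairs_entry; rewrite /wentry => -[_]. Qed.

Lemma wlast_uniq (Z : wiring D) (PZ : planar Z) (e e' : wE Z) :
  wlast e -> wlast e' -> wT e = wT e' -> e = e'.
Proof.
move=> /forallP l /forallP l' eT.
have := l e'; rewrite eT eqxx => /(wnlt PZ)[//|le'].
by have := l' e; rewrite -eT eqxx le'.
Qed.

Lemma vertex_pair_fun v w w' : vertex_pair v w -> vertex_pair v w' -> w = w'.
Proof.
move=> [p [pz l1 _ T1 T2]] [q [qz m1 _ U1 U2]].
have pq : p = q by apply: pairs_fun => //; apply: wlast_uniq; rewrite // T1 U1.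
by move: U2; rewrite -pq T2 => -[].
Qed.

Lemma vertex_pair_inj v v' w : vertex_pair v w -> vertex_pair v' w -> v = v'.
Proof.
move=> [p [pz _ l1 T1 T2]] [q [qz _ m1 U1 U2]].
have pq : p = q by apply: pairs_inj => //; apply: wlast_uniq; rewrite // T2 U2.
by move: U1; rewrite -pq T1 => -[].
Qed.

Lemma vertex_pair_dec v w : vertex_pair v w -> wdec v = wdec w.
Proof.
move=> [p [pz l1 _ T1 T2]]; have [w' [T2' _]] := pairs_lastE pz T1.
by move: T2'; rewrite T2 => -[->]; apply.
Qed.

Lemma size_wins v w : wdec v = wdec w -> size (wins v) = size (wins w).
Proof.
move=> e; rewrite -(size_map wcol) -(wdec_src PX v) e (wdec_src PY w).
by rewrite size_map.
Qed.

Lemma size_wouts v w : wdec v = wdec w -> size (wouts v) = size (wouts w).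
Proof.
move=> e; rewrite -(size_map wcol) -(wdec_tgt PX v) e (wdec_tgt PY w).
by rewrite size_map.
Qed.

Lemma split_pairs zp p zs : z = zp ++ p :: zs ->
  wedges X = unzip1 zp ++ p.1 :: unzip1 zs /\
  wedges Y = unzip2 zp ++ p.2 :: unzip2 zs.
Proof.
move=> zE; rewrite -unzip1_pairs -unzip2_pairs zE.
by rewrite /unzip1 /unzip2 !map_cat.
Qed.

Lemma pairs_mem (zL : seq (wE X * wE Y)) (s : seq (wE X)) (s' : seq (wE Y)) p :
  {subset zL <= z} -> unzip1 zL = s -> unzip2 zL = s' -> p \in z -> p.1 \in s ->
  p.2 \in s'.
Proof.
move=> sub <- <- pz /mapP[q qL e].
by rewrite (pairs_fun pz (sub _ qL) e) map_f.
Qed.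

(** The targets are found by running both machines forward: they shift and pop in
    the same way, so the stacks of waiting edges consist of paired edges ([zL]),
    and a firing vertex takes paired inputs on both sides. *)
Lemma rigid_T p v : p \in z -> wT p.1 = Some v ->
  exists2 w, wT p.2 = Some w & vertex_pair v w.
Proof.
suff gen zs zp : z = zp ++ zs -> exists zL, [/\ {subset zL <= z},
   unzip1 zL = waiting (unzip1 zs) (unzip1 zp),
   unzip2 zL = waiting (unzip2 zs) (unzip2 zp) &
   forall p v, p \in zp -> wT p.1 = Some v -> ~~ fed (unzip1 zs) v ->
     exists2 w, wT p.2 = Some w & vertex_pair v w].
  have := gen [::] z; rewrite cats0 => /(_ erefl)[zL [_ _ _ h]] pz Tp.
  exact: h pz Tp _.
elim/last_ind: zp zs => [|zp p' IH] zs.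
  by move=> zE; exists [::].
rewrite cat_rcons => zE; have [zL [sub L1 L2 h]] := IH _ zE.
have [eX eY] := split_pairs zE.
have pz : p' \in z by rewrite zE mem_cat inE eqxx orbT.
have subr : {subset rcons zL p' <= z}.
  by move=> q; rewrite mem_rcons inE => /orP[/eqP ->|/sub].
have r1 : unzip1 (rcons zL p') = rcons (unzip1 zL) p'.1 by rewrite /unzip1 map_rcons.
have r2 : unzip2 (rcons zL p') = rcons (unzip2 zL) p'.2 by rewrite /unzip2 map_rcons.
have q1 : unzip1 (rcons zp p') = rcons (unzip1 zp) p'.1 by rewrite /unzip1 map_rcons.
have q2 : unzip2 (rcons zp p') = rcons (unzip2 zp) p'.2 by rewrite /unzip2 map_rcons.
case Tp: (wT p'.1) => [u|].
  have [w [Tw la dE]] := pairs_lastE pz Tp.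
  case: (boolP (wlast p'.1)) => l1; last first.
    have l2 := l1; rewrite la in l2.
    exists (rcons zL p'); split=> //.
    - by rewrite r1 q1 (waiting_wait PX eX Tp l1) L1.
    - by rewrite r2 q2 (waiting_wait PY eY Tw l2) L2.
    move=> q v'; rewrite mem_rcons inE.
    have fu : fed (unzip1 zs) u.
      case/forallPn: l1 => j; rewrite negb_imply negbK => /andP[/eqP Tj lej].
      by apply/fedP; exists j; rewrite ?(mem_suf PX eX) // Tj.
    case/orP=> [/eqP ->|qz Tq nf]; first by rewrite Tp => -[<-]; rewrite fu.
    apply: h qz Tq _; rewrite fed_here Tp negb_or nf andbT.
    by apply: contra nf => /eqP[<-].
  have l2 := l1; rewrite la in l2.
  have cX := waiting_close PX eX Tp l1; have cY := waiting_close PY eY Tw l2.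
  have sE := size_wins (dE l1).
  have szs : size (waiting (unzip1 zs) (unzip1 (rcons zp p')))
           = size (waiting (unzip2 zs) (unzip2 (rcons zp p'))).
    rewrite q1 q2; apply/eqP; rewrite -(eqn_add2r (size (wins u))) {2}sE.
    by rewrite -!size_cat -cX -cY !size_rcons -L1 -L2 !size_map.
  set n := size _ in szs.
  rewrite -q1 -L1 -r1 in cX; rewrite -q2 -L2 -r2 in cY.
  exists (take n (rcons zL p')); split.
  - by move=> q /mem_take /subr.
  - by rewrite /unzip1 map_take -/(unzip1 _) cX take_size_cat.
  - by rewrite /unzip2 map_take -/(unzip2 _) cY take_size_cat.
  move=> q v'; rewrite mem_rcons inE => qz Tq nf.
  have qz' : q \in z.
    by case/orP: qz => [/eqP ->//|qz]; rewrite zE mem_cat qz.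
  case: (eqVneq v' u) => [vu|nvu]; last first.
    case/orP: qz => [/eqP qp|qz].
      by move: Tq nvu; rewrite qp Tp => -[->]; rewrite eqxx.
    apply: h qz Tq _; rewrite fed_here Tp negb_or nf andbT.
    by apply: contra nvu => /eqP[->].
  subst v'; exists w; last by exists p'.
  suff: q.2 \in wins w by rewrite mem_filter => /andP[/eqP].
  apply: (@pairs_mem (drop n (rcons zL p')) (wins u)) => //.
  - by move=> r /mem_drop /subr.
  - by rewrite /unzip1 map_drop -/(unzip1 _) cX drop_size_cat.
  - by rewrite /unzip2 map_drop -/(unzip2 _) cY drop_size_cat.
  - by rewrite mem_filter Tq eqxx mem_wedges.
have Tp2 : wT p'.2 = None by apply/eqP; rewrite -pairs_T0 // Tp.
exists [::]; split=> //.
- by rewrite q1 (waiting_out' PX eX Tp).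
- by rewrite q2 (waiting_out' PY eY Tp2).
move=> q v'; rewrite mem_rcons inE => /orP[/eqP ->|qz Tq nf]; first by rewrite Tp.
by apply: h qz Tq _; rewrite fed_here Tp.
Qed.

(** The sources are found by running both machines backward: the unread outputs
    of fired vertices consist of paired edges ([zP]), because an output is read
    from the front of this list, and a firing vertex adds a segment whose length
    is known from the decoration. *)
Lemma rigid_S p v : p \in z -> wS p.1 = Some v ->
  exists2 w, wS p.2 = Some w & vertex_pair v w.
Proof.
suff gen zp zs : z = zp ++ zs -> exists zP, [/\ {subset zP <= z},
   unzip1 zP = pending (unzip1 zs) (unzip1 zs),
   unzip2 zP = pending (unzip2 zs) (unzip2 zs) &
   forall p v, p \in zs -> wS p.1 = Some v -> fed (unzip1 zs) v ->
     exists2 w, wS p.2 = Some w & vertex_pair v w].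
  have [zP [_ _ _ h]] := gen [::] z erefl => pz Sp.
  apply: h pz Sp _; rewrite unzip1_pairs; have [i Ti] := win_ex PX v.
  by apply/fedP; exists i; rewrite ?mem_wedges.
elim: zs zp => [|p' zs IH] zp; first by move=> zE; exists [::].
move=> zE; have := IH (rcons zp p'); rewrite cat_rcons.
move=> /(_ zE)[zP [sub P1 P2 h]].
have [eX eY] := split_pairs zE.
have pz : p' \in z by rewrite zE mem_cat inE eqxx orbT.
pose before zP0 := [/\ {subset zP0 <= z},
    unzip1 zP0 = pending (p'.1 :: unzip1 zs) (unzip1 zs),
    unzip2 zP0 = pending (p'.2 :: unzip2 zs) (unzip2 zs) &
    forall p v, p \in zs -> wS p.1 = Some v -> fed (p'.1 :: unzip1 zs) v ->
     exists2 w, wS p.2 = Some w & vertex_pair v w].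
have [zP0 [sub0 Q1 Q2 h0]] : exists zP0, before zP0.
  have simple : ~~ wlast p'.1 || (wT p'.1 == None) ->
      ~~ wlast p'.2 || (wT p'.2 == None) -> exists zP0, before zP0.
    move=> n1 n2; exists zP; rewrite /before.
    rewrite -(pending_not_last PX eX n1) -(pending_not_last PY eY n2); split=> //.
    move=> q v' qz Sq f; apply: h qz Sq _; move: f; rewrite fed_here.
    case/orP=> // /eqP Tp; rewrite Tp orbF in n1.
    case/forallPn: n1 => j; rewrite negb_imply negbK => /andP[/eqP Tj lej].
    by apply/fedP; exists j; rewrite ?(mem_suf PX eX) // Tj.
  case Tp: (wT p'.1) => [u|]; last first.
    by apply: simple; [rewrite Tp eqxx orbT | rewrite -pairs_T0 // Tp eqxx orbT].
  have [w [Tw la dE]] := pairs_lastE pz Tp.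
  case: (boolP (wlast p'.1)) => l1; last first.
    by apply: simple; rewrite -?la l1.
  have l2 := l1; rewrite la in l2.
  have cX := pending_close PX eX Tp l1; have cY := pending_close PY eY Tw l2.
  have sE := size_wouts (dE l1).
  rewrite -P1 in cX; rewrite -P2 in cY.
  set b := size _ in sE.
  exists (drop b zP); split.
  - by move=> q /mem_drop /sub.
  - by rewrite /unzip1 map_drop -/(unzip1 _) cX drop_size_cat.
  - by rewrite /unzip2 map_drop -/(unzip2 _) cY drop_size_cat.
  move=> q v' qz Sq; rewrite fed_here => f.
  case: (boolP (fed (unzip1 zs) v')) => [|nf]; first exact: h qz Sq.
  have qz' : q \in z by rewrite zE mem_cat inE qz !orbT.
  move: f; rewrite (negPf nf) orbF Tp => /eqP[?]; subst v'.
  exists w; last by exists p'.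
  suff: q.2 \in wouts w by rewrite mem_filter => /andP[/eqP].
  apply: (@pairs_mem (take b zP) (wouts u)) => //.
  - by move=> r /mem_take /sub.
  - by rewrite /unzip1 map_take -/(unzip1 _) cX take_size_cat.
  - by rewrite /unzip2 map_take -/(unzip2 _) cY take_size_cat.
  - by rewrite mem_filter Sq eqxx mem_wedges.
have new (q : wE X * wE Y) v' : q \in p' :: zs -> wS q.1 = Some v' ->
    fed (p'.1 :: unzip1 zs) v' -> exists2 w, wS q.2 = Some w & vertex_pair v' w.
  rewrite inE => /orP[/eqP ->|]; last exact: h0.
  by move=> Sp; rewrite (negPf (not_fed PX eX Sp _)) //; left.
case Sp: (wS p'.1) => [u|]; last first.
  have Sp2 : wS p'.2 = None by apply/eqP; rewrite -pairs_S0 // Sp.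
  exists [::]; split=> //.
  - by rewrite (pending_input PX eX Sp).
  - by rewrite (pending_input PY eY Sp2).
case Sp2: (wS p'.2) => [w|]; last by have := pairs_S0 pz; rewrite Sp Sp2.
exists (p' :: zP0); split=> //.
- by move=> q; rewrite inE => /orP[/eqP ->|/sub0].
- by rewrite (pending_output PX eX Sp) /= Q1.
- by rewrite (pending_output PY eY Sp2) /= Q2.
Qed.

End Rigidity.

(** * Diagrams presented by wirings *)

Section Presentation.
Variable D : tscheme.

(** Ends are indexed by the sign of the half-edge there: the positive half-edge
    of an edge lies in its target, the negative one in its source. *)
Definition wend (X : wiring D) (e : wE X) (b : bool) := if b then wT e else wS e.

(** The condition for an edge to have a half-edge of sign [b]. A real edge has
    one for each end at a real vertex. A virtual edge has no such end, but it has
    both half-edges. *)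
Definition whalf (X : wiring D) (e : wE X) (b : bool) :=
  wend e b || ~~ wend e (~~ b).

(** Half-edges lie in the same vertex if and only if they have the same key. The
    virtual vertices do not occur in [X] and are named by their edges. *)
Definition wkey (X : wiring D) (G : prediagram D) (phi : he G -> wE X) (h : he G)
  : wV X + wE X :=
  if wend (phi h) (sgn h) is Some v then inl v else inr (phi h).

(** A diagram is determined by a wiring up to isomorphism: its half-edges are
    pairs of an edge and a sign, and all structure is read off from the edge. *)
Record wired (G : prediagram D) (X : wiring D) (phi : he G -> wE X) : Prop := Wired {
  wired_inj : forall h k, phi h = phi k -> sgn h = sgn k -> h = k;
  wired_half : forall e b, whalf e b <-> exists h, phi h = e /\ sgn h = b;
  wired_sigma : forall h, phi (sigma h) = phi h;
  wired_mate : forall h k, phi h = phi k -> sgn h <> sgn k -> sigma h = k;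
  wired_vtx : vtx G = preim_partition (wkey phi) [set: he G];
  wired_prec : forall h k, prec h k = wlt (phi h) (phi k);
  wired_color : forall h, color h = wcol (phi h);
  wired_deco : forall h,
    deco h = if wend (phi h) (sgn h) is Some v then Some (wdec v) else None }.

Section Wired.
Variables (G : prediagram D) (X : wiring D) (phi : he G -> wE X).
Hypotheses (W : wired phi) (PX : planar_order X).
Implicit Types (h k : he G) (e : wE X) (v : wV X).
Notation key := (wkey phi).

Lemma wired_half_he h : whalf (phi h) (sgn h).
Proof. by apply/(wired_half W); exists h. Qed.

Lemma wired_ex e : exists h, phi h = e.
Proof.
have : whalf e true \/ whalf e false.
  by rewrite /whalf /=; case: (wT e); case: (wS e); auto.
by case=> /(wired_half W)[h []]; exists h.
Qed.

Lemma sigma_other h k : phi k = phi h -> sgn k = ~~ sgn h -> sigma h = k.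
Proof. by move=> e s; apply: (wired_mate W) => //; rewrite s; case: (sgn h). Qed.

Lemma sigma_self h : ~~ whalf (phi h) (~~ sgn h) -> sigma h = h.
Proof.
move=> nh; apply: (wired_inj W); first exact: wired_sigma.
apply/eqP; rewrite -[_ == _]negbK; apply/negP=> ne.
case/negP: nh; apply/(wired_half W); exists (sigma h); split.
  exact: wired_sigma.
by move: ne; case: (sgn h); case: (sgn (sigma h)).
Qed.

Lemma sigma_neq h : (sigma h != h) = whalf (phi h) (~~ sgn h).
Proof.
apply/idP/idP=> [|/(wired_half W)[k [pk sk]]].
  by apply: contraNT => /sigma_self ->.
rewrite (sigma_other pk sk); apply/eqP=> kh.
by move: sk; rewrite kh; case: (sgn h).
Qed.

Lemma sgn_sigma_wired h : sigma h != h -> sgn (sigma h) = ~~ sgn h.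
Proof.
by rewrite sigma_neq => /(wired_half W)[k [pk sk]]; rewrite (sigma_other pk sk).
Qed.

Lemma sigmaK_wired : involutive (@sigma G).
Proof.
move=> h; case: (eqVneq (sigma h) h) => [e|n]; first by rewrite !e.
by apply: sigma_other; rewrite ?(wired_sigma W) ?sgn_sigma_wired ?negbK.
Qed.

Lemma edge_wired h k : (k \in edge h) = (phi k == phi h).
Proof.
rewrite !inE; apply/orP/eqP=> [[/eqP->|/eqP->]|e] //; first exact: wired_sigma.
case: (eqVneq (sgn k) (sgn h)) => s; [left|right].
  by apply/eqP/(wired_inj W).
by apply/eqP/esym/sigma_other => //; case: (sgn k) (sgn h) s => -[].
Qed.

Lemma same_block h k : (k \in pblock (vtx G) h) = (key h == key k).
Proof.
rewrite (wired_vtx W) pblock_equivalence_partition ?inE //.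
by split=> // /eqP->.
Qed.

Lemma vtx_wired (A : {set he G}) :
  reflect (exists h, A = [set k | key h == key k]) (A \in vtx G).
Proof.
have cov h : h \in cover (vtx G).
  rewrite (wired_vtx W) (cover_partition (preim_partitionP _ _)) inE //.
have tr : trivIset (vtx G).
  by rewrite (wired_vtx W); case/and3P: (preim_partitionP (wkey phi) [set: he G]).
apply: (iffP idP) => [vA|[h ->]].
  have nz : A != set0.
    apply: contraTneq vA => ->; rewrite (wired_vtx W).
    by case/and3P: (preim_partitionP (wkey phi) [set: he G]).
  have [h hA] := set0Pn _ nz; exists h; apply/setP=> k.
  by rewrite inE -same_block (def_pblock tr vA hA).
have -> : [set k | key h == key k] = pblock (vtx G) h.
  by apply/setP=> k; rewrite inE same_block.
exact: pblock_mem.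
Qed.

Lemma step_irr e : wT e = wS e -> wT e = None.
Proof.
case Te: (wT e) => [v|] // Se; have := wlt_irr PX e.
by rewrite (wstep_lt' PX Te (esym Se)).
Qed.

Lemma same_key h k : phi h = phi k -> sgn h != sgn k -> key h = key k ->
  wT (phi h) = None /\ wS (phi h) = None.
Proof.
move=> e s; rewrite /wkey -e => K.
have eTS : wT (phi h) = wS (phi h).
  move: s K; rewrite /wend; case: (sgn h); case: (sgn k) => // _;
  by case: (wT _) => [?|]; case: (wS _) => [?|] // [->].
by have t0 := step_irr eTS; rewrite -eTS.
Qed.

Lemma key_free h : wT (phi h) = None -> wS (phi h) = None -> key h = inr (phi h).
Proof. by rewrite /wkey /wend => t0 s0; case: (sgn h); rewrite ?t0 ?s0. Qed.

Lemma virtual_wired h :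
  virtual h = (wT (phi h) == None) && (wS (phi h) == None).
Proof.
apply/andP/andP=> [[n /vtx_wired[x eA]]|[/eqP t0 /eqP s0]].
  have hx := set21 h (sigma h); have sx := set22 h (sigma h).
  rewrite -/(edge h) eA !inE in hx sx.
  have [] := @same_key h (sigma h); rewrite ?(wired_sigma W) //.
  - by rewrite (sgn_sigma_wired n); case: (sgn h).
  - by rewrite -(eqP hx) (eqP sx).
  - by move=> -> ->.
split; first by rewrite sigma_neq /whalf /wend; case: (sgn h); rewrite /= ?t0 ?s0.
apply/vtx_wired; exists h; apply/setP=> k; rewrite inE edge_wired (key_free t0 s0).
apply/eqP/eqP=> [e|]; first by rewrite key_free e.
by rewrite /wkey; case: (wend _ _) => // -[].
Qed.

Lemma leg_wired h : leg h = ~~ wend (phi h) (~~ sgn h).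
Proof.
rewrite /leg -[sigma h == h]negbK sigma_neq virtual_wired /whalf /wend.
by case: (sgn h); case: (wT _) => [?|]; case: (wS _) => [?|].
Qed.

(** The linear orders on the legs and on the half-edges of a vertex are obtained
    from the list of all edges: a set of half-edges of one sign is ordered as
    the set of its edges. *)
Lemma ordered_wired (A : {set he G}) (p : pred (wE X)) b :
  {in A, forall h, sgn h = b} ->
  (forall e, reflect (exists2 h, h \in A & phi h = e) (p e)) ->
  map phi (ordered A) = filter p (wedges X).
Proof.
move=> sA pP.
have inj : {in A &, injective phi}.
  by move=> h k hA kA e; apply: (wired_inj W) => //; rewrite !sA.
apply: (sorted_uniq_eq PX).
- have: uniq (ordered A) by rewrite sort_uniq enum_uniq.
  have: {subset ordered A <= A} by move=> h; rewrite mem_sort mem_enum.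
  have: pairwise (fun h k => ~~ prec k h) (ordered A).
    rewrite -sorted_pairwise; last first.
      move=> y x z; rewrite !(wired_prec W) => /(wnlt PX)[->//|l].
      move=> /(wnlt PX)[->|l']; first by rewrite (wlt_asym PX l).
      by rewrite (wlt_asym PX (wlt_trans PX l l')).
    apply: sort_sorted => x y; rewrite !(wired_prec W).
    by case: (boolP (wlt (phi x) _)) => [/(wlt_asym PX) ->|]; rewrite ?orbT.
  elim: (ordered A) => //= h s IH /andP[al ps] sub /andP[hs us].
  rewrite IH // ?andbT; last by move=> k ks; apply: sub; rewrite inE ks orbT.
  apply/allP=> _ /mapP[k ks ->]; have := allP al _ ks; rewrite (wired_prec W).
  case/(wnlt PX) => // e; move: hs.
  by rewrite -(inj k h _ _ e) ?ks //; apply: sub; rewrite inE ?ks ?eqxx ?orbT.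
- exact/pairwise_filter/wedges_sorted.
- move=> e; rewrite mem_filter mem_wedges andbT.
  apply/mapP/pP=> -[h hA e']; exists h => //; move: hA; by rewrite mem_sort mem_enum.
Qed.

Lemma ins_wired : map phi (ins G) = winputs X.
Proof.
apply: (@ordered_wired _ _ true) => [h|e]; first by rewrite inE => /andP[].
apply: (iffP eqP) => [s0|[h]].
  have /(wired_half W)[h [he hs]] : whalf e true by rewrite /whalf /= s0 orbT.
  by exists h => //; rewrite inE leg_wired he hs /= s0.
by rewrite inE leg_wired => /andP[l s] <-; move: l; rewrite s /=; case: (wS _).
Qed.

Lemma outs_wired : map phi (outs G) = woutputs X.
Proof.
apply: (@ordered_wired _ _ false) => [h|e].
  by rewrite inE => /andP[_ /negPf].
apply: (iffP eqP) => [t0|[h]].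
  have /(wired_half W)[h [he hs]] : whalf e false by rewrite /whalf /= t0 orbT.
  by exists h => //; rewrite inE leg_wired he hs /= t0.
rewrite inE leg_wired => /andP[l /negPf s] <-; move: l; rewrite s /=.
by case: (wT _).
Qed.

Lemma map_color (s : seq (he G)) : map color s = map wcol (map phi s).
Proof. by rewrite -map_comp; apply: eq_map => h; rewrite (wired_color W). Qed.

Lemma ddom_wired : ddom G = map wcol (winputs X).
Proof. by rewrite /ddom map_color ins_wired. Qed.

Lemma dcod_wired : dcod G = map wcol (woutputs X).
Proof. by rewrite /dcod map_color outs_wired. Qed.

Lemma key_inl h v : key h = inl v <-> wend (phi h) (sgn h) = Some v.
Proof. by rewrite /wkey; case: (wend _ _) => [u|]; split=> // -[->]. Qed.

Lemma half_end e b v : wend e b = Some v ->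
  exists h, [/\ phi h = e, sgn h = b & key h = inl v].
Proof.
move=> ev; have /(wired_half W)[h [he hs]] : whalf e b by rewrite /whalf ev.
by exists h; split=> //; apply/key_inl; rewrite he hs.
Qed.

Lemma ins_at_wired v h : key h = inl v ->
  map phi (ins_at [set k | key h == key k]) = wins v.
Proof.
move=> kh; apply: (@ordered_wired _ _ true) => [k|e].
  by rewrite inE => /andP[].
apply: (iffP eqP) => [te|[k]].
  have [k [pk sk kk]] := @half_end e true _ te.
  by exists k => //; rewrite !inE kh kk sk eqxx.
rewrite !inE => /andP[/eqP e1 e2] <-; rewrite e1 in kh.
by move/key_inl: kh; rewrite e2.
Qed.

Lemma outs_at_wired v h : key h = inl v ->
  map phi (outs_at [set k | key h == key k]) = wouts v.
Proof.
move=> kh; apply: (@ordered_wired _ _ false) => [k|e].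
  by rewrite inE => /andP[_ /negPf].
apply: (iffP eqP) => [te|[k]].
  have [k [pk sk kk]] := @half_end e false _ te.
  by exists k => //; rewrite !inE kh kk sk eqxx.
rewrite !inE => /andP[/eqP e1 /negPf e2] <-; rewrite e1 in kh.
by move/key_inl: kh; rewrite e2.
Qed.

Lemma same_vertex_wired h k : same_vertex h k = (key h == key k).
Proof.
apply/existsP/eqP=> [[A /andP[/vtx_wired[x ->]]]|e].
  by rewrite !inE => /andP[/eqP <- /eqP].
exists [set x | key h == key x]; rewrite !inE eqxx e eqxx !andbT.
by apply/vtx_wired; exists h; rewrite e.
Qed.

(** A step between half-edges may also stay on a virtual edge, whose two ends lie
    in the same vertex. *)
Lemma edge_step_wired h k : edge_step h k -> phi h = phi k \/ wstep (phi h) (phi k).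
Proof.
move=> /existsP[h' /andP[hh' /existsP[k' /and4P[kk' sh' sk']]]].
rewrite !edge_wired in hh' kk'; rewrite same_vertex_wired => /eqP.
rewrite -(eqP hh') -(eqP kk') {1}/wkey sh' /wkey (negPf sk') /=.
case Te: (wT _) => [v|]; case Se: (wS _) => [u|] // -[e]; last by left.
by right; apply/wstepP; exists v; rewrite // Se e.
Qed.

Lemma wstep_edge_step h k : wstep (phi h) (phi k) -> edge_step h k.
Proof.
move=> /wstepP[v Te Se].
have [h' [ph sh kh]] := @half_end (phi h) true _ Te.
have [k' [pk sk kk]] := @half_end (phi k) false _ Se.
apply/existsP; exists h'; rewrite edge_wired ph eqxx /=.
apply/existsP; exists k'; rewrite edge_wired pk eqxx /= sh sk /=.
by rewrite same_vertex_wired kh kk.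
Qed.

Lemma reach_wired h k : reach h k -> wreach (phi h) (phi k).
Proof.
move=> /connectP[p]; elim: p h => [|x p IH] h /=; first by move=> _ ->; apply: connect0.
move=> /andP[/edge_step_wired s pp] e; have r := IH _ pp e.
by case: s => [->//|/connect1 s]; apply: connect_trans s r.
Qed.

Lemma wreach_reach h k : wreach (phi h) (phi k) -> phi h != phi k -> reach h k.
Proof.
move=> /connectP[p]; elim: p h => [|x p IH] h /=; first by move=> _ ->; rewrite eqxx.
move=> /andP[s pp] e _; have [y yx] := wired_ex x.
rewrite -yx in s pp e; case: (eqVneq (phi y) (phi k)) => [yk|n].
  by apply/connect1/wstep_edge_step; rewrite -yk.
apply: connect_trans (IH _ pp e n); exact/connect1/wstep_edge_step.
Qed.

Lemma half_free e b : wT e = None -> wS e = None ->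
  exists h, [/\ phi h = e, sgn h = b & key h = inr e].
Proof.
move=> t0 s0; have /(wired_half W)[h [he hs]] : whalf e b.
  by rewrite /whalf /wend; case: b; rewrite /= ?t0 ?s0.
by exists h; split=> //; rewrite key_free he.
Qed.

Lemma key_inr h e : key h = inr e -> [/\ e = phi h, wT e = None & wS e = None].
Proof.
rewrite /wkey; have := wired_half_he h; rewrite /whalf /wend.
by case: (sgn h); case Te: (wT (phi h)) => [?|] //=;
   case Se: (wS (phi h)) => [?|] //= _ [<-].
Qed.

Lemma directed_wired (A : {set he G}) b : A \in vtx G -> exists2 h, h \in A & sgn h = b.
Proof.
move=> /vtx_wired[x ->]; case kx: (key x) => [v|e].
  have [e Ev] : exists e, wend e b = Some v.
    by case: b; [apply: (win_ex PX)|apply: (wout_ex PX)].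
  by have [h [_ hs hk]] := half_end Ev; exists h; rewrite // inE hk.
have [_ t0 s0] := key_inr kx; have [h [_ hs hk]] := half_free b t0 s0.
by exists h; rewrite // inE hk.
Qed.

Lemma wired_planar : is_planar_graph G.
Proof.
split.
- by rewrite (wired_vtx W); apply: preim_partitionP.
- exact: sigmaK_wired.
- move=> A h /vtx_wired[x ->] n /subsetP sub.
  have := sub _ (set21 _ _); have := sub _ (set22 _ _); rewrite !inE => /eqP e1 /eqP e2.
  have [|||t0 s0] := @same_key h (sigma h).
  + by rewrite (wired_sigma W).
  + by rewrite (sgn_sigma_wired n); case: (sgn h).
  + by rewrite -e1.
  apply/setP=> k; rewrite edge_wired inE e2 (key_free t0 s0).
  apply/eqP/eqP=> [|e]; last by rewrite key_free e.
  by rewrite /wkey; case: (wend _ _) => // -[].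
- exact: sgn_sigma_wired.
- by move=> A /(directed_wired true)[h hA hs]; exists h; rewrite ?hs.
- by move=> A /(directed_wired false)[h hA hs]; exists h; rewrite ?hs.
- by move=> h k; rewrite !(wired_prec W) (wired_sigma W).
- by move=> h k; rewrite !(wired_prec W) (wired_sigma W).
- by move=> h; rewrite (wired_prec W) (wlt_irr PX).
- by move=> y x z; rewrite !(wired_prec W); apply: (wlt_trans PX).
- move=> h k; rewrite edge_wired !(wired_prec W) => n.
  by apply: (wlt_total PX); rewrite eq_sym.
- move=> h k; rewrite edge_wired (wired_prec W) => n /reach_wired r.
  by case: (wreach_lt PX r) => // e; rewrite e eqxx in n.
- move=> h k l /reach_wired r; rewrite !(wired_prec W) => l1 l2.
  case: (wbetween PX r l1 l2) => r'; [left|right]; apply: wreach_reach => //;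
  exact: wlt_neq.
Qed.

Lemma wired_diagram : planar X -> is_diagram G.
Proof.
move=> PD; split; first exact: wired_planar.
- by move=> h; rewrite !(wired_color W) (wired_sigma W).
- move=> A h /vtx_wired[x ->] /existsP[y /and3P[xy vy /eqP eA]] hA.
  rewrite eA edge_wired in hA; rewrite (wired_deco W).
  move: vy; rewrite virtual_wired -(eqP hA) /wend.
  by case: (sgn h) => /andP[/eqP t0 /eqP s0]; rewrite ?t0 ?s0.
- move=> A /vtx_wired[x ->] nv; case kx: (key x) => [v|e]; last first.
    case/existsP: nv; have [ex t0 s0] := key_inr kx.
    exists x; rewrite inE kx eqxx virtual_wired -ex t0 s0 !eqxx /=.
    apply/eqP/setP=> k; rewrite inE edge_wired -ex.
    apply/eqP/eqP=> [ek|ek]; first by case: (key_inr (esym ek)).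
    by rewrite key_free ek.
  exists (wdec v); rewrite -kx; split.
  + by move=> h; rewrite inE kx => /eqP/esym/key_inl hv; rewrite (wired_deco W) hv.
  + by rewrite map_color (ins_at_wired kx) (wdec_src PD).
  + by rewrite map_color (outs_at_wired kx) (wdec_tgt PD).
Qed.

End Wired.
End Presentation.

(** * Every diagram is presented by a wiring *)

Section WiringOfDiagram.
Variables (D : tscheme) (G : prediagram D).
Hypothesis HG : is_diagram G.
Implicit Types h k : he G.
Let PG : is_planar_graph G := diagram_planar HG.
Let sK : involutive (@sigma G) := sigmaK PG.

(** The edges of the wiring are represented by half-edges. Preferring the
    positive half-edge makes [rep] constant on edges. *)
Definition rep h := if sgn h then h else if sgn (sigma h) then sigma h else h.

Lemma sgn_sigmaE h : sgn (sigma h) = if sigma h == h then sgn h else ~~ sgn h.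
Proof. by case: eqVneq => [->|/(sgn_sigma PG)]. Qed.

Lemma rep_sigma h : rep (sigma h) = rep h.
Proof.
rewrite /rep sK; case: (eqVneq (sigma h) h) => [->//|/(sgn_sigma PG) ->].
by case: (sgn h).
Qed.

Lemma rep_edge h : rep h = h \/ rep h = sigma h.
Proof. by rewrite /rep; case: (sgn h); case: (sgn (sigma h)); auto. Qed.

Lemma rep_rep h : rep (rep h) = rep h.
Proof. by case: (rep_edge h) => e; rewrite {1}e // rep_sigma. Qed.

Lemma rep_eq h k : (rep k == rep h) = (k \in edge h).
Proof.
rewrite !inE; apply/eqP/orP=> [e|[/eqP->|/eqP->]]; rewrite ?rep_sigma //.
case: (rep_edge h) (rep_edge k) => e1 [] e2; rewrite e1 e2 in e.
- by left; rewrite e.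
- by right; rewrite -e sK.
- by right; rewrite e.
- by left; rewrite -[k]sK e sK.
Qed.

Definition gE : finType := {h : he G | rep h == h}.
Definition gphi h : gE := exist _ (rep h) (introT eqP (rep_rep h)).
Definition gV : finType := {A : {set he G} | (A \in vtx G) && ~~ virtual_vertex A}.
Definition gvertex h : option gV := insub (pblock (vtx G) h).
Definition gT (e : gE) := let h := val e in if sgn h then gvertex h else None.
Definition gS (e : gE) := let h := val e in
  if sgn h then if sigma h == h then None else gvertex (sigma h) else gvertex h.

Lemma gdec_ex (v : gV) : exists m : Mor D,
  [/\ forall h, h \in val v -> deco h = Some m,
      src m = map color (ins_at (val v)) :> seq (sOb D) &
      tgt m = map color (outs_at (val v)) :> seq (sOb D)].
Proof. by case/andP: (valP v); apply: (deco_real HG). Qed.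

Definition gdec v : Mor D := sval (boolp.cid (gdec_ex v)).

Definition diagram_wiring : wiring D :=
  @Wiring D gE (fun e e' => prec (val e) (val e')) gV gS gT
    (fun e => color (val e)) gdec.

Notation X := diagram_wiring.

Lemma gphi_eq h k : (gphi k == gphi h) = (k \in edge h).
Proof. by rewrite -rep_eq -val_eqE. Qed.

Lemma gphi_sigma h : gphi (sigma h) = gphi h.
Proof. by apply/val_inj/rep_sigma. Qed.

Lemma gphi_val (e : gE) : gphi (val e) = e.
Proof. by apply/val_inj/eqP/(valP e). Qed.

Lemma gend h : wend (X := X) (gphi h) (sgn h) = gvertex h.
Proof.
rewrite /wend /= /gT /gS /= /rep.
case s: (sgn h) => /=; first by rewrite s.
case: (boolP (sgn (sigma h))) => s' /=; last by rewrite s.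
rewrite s' sK; case: eqP => // e.
by rewrite -e s in s'.
Qed.

Lemma gend' h : wend (X := X) (gphi h) (~~ sgn h)
  = if sigma h == h then None else gvertex (sigma h).
Proof.
case: (eqVneq (sigma h) h) => [e|n].
  rewrite /wend /= /gT /gS /= /rep e.
  by case s: (sgn h); rewrite /= s ?e ?eqxx.
by rewrite -(sgn_sigma PG n) -(gphi_sigma h) gend.
Qed.

Lemma cover_vtx h : h \in cover (vtx G).
Proof. by rewrite (cover_partition (vtx_partition PG)) inE. Qed.

Lemma triv_vtx : trivIset (vtx G).
Proof. by case/and3P: (vtx_partition PG). Qed.

Lemma edge_sigma h : edge (sigma h) = edge h.
Proof. by rewrite /edge sK setUC. Qed.

Lemma virtual_sigma h : virtual (sigma h) = virtual h.
Proof. by rewrite /virtual edge_sigma sK eq_sym. Qed.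

Lemma virtual_pblock h : virtual h -> pblock (vtx G) h = edge h.
Proof. by case/andP=> _ vh; apply: (def_pblock triv_vtx vh); apply: set21. Qed.

Lemma gvertex_None h : (gvertex h == None) = virtual h.
Proof.
rewrite /gvertex; case: insubP => [v /andP[_ nv] ev|] /=; last first.
  rewrite pblock_mem ?cover_vtx // negbK => /existsP[x /and3P[xh vx /eqP eA]].
  have : h \in edge x by rewrite -eA mem_pblock cover_vtx.
  by rewrite eqxx !inE => /orP[/eqP->|/eqP->]; rewrite ?virtual_sigma vx.
apply/esym/negP=> vh; case/negP: nv; apply/existsP; exists h.
by rewrite mem_pblock cover_vtx vh virtual_pblock ?eqxx.
Qed.

Lemma gvertex_val h v : gvertex h = Some v -> val v = pblock (vtx G) h.
Proof. by rewrite /gvertex; case: insubP => // u _ e [<-]. Qed.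

Lemma gvertex_in h (v : gV) : h \in val v -> gvertex h = Some v.
Proof.
case/andP: (valP v) => vA nv hv; rewrite /gvertex (def_pblock triv_vtx vA hv).
exact: valK.
Qed.

Lemma gkey h k : (wkey (X := X) gphi h == wkey (X := X) gphi k)
  = (k \in pblock (vtx G) h).
Proof.
rewrite /wkey !gend; case vh: (gvertex h) => [v|]; last first.
  have Vh : virtual h by rewrite -gvertex_None vh.
  rewrite virtual_pblock // -gphi_eq eq_sym; case vk: (gvertex k) => [u|] //.
  apply/esym/negP; rewrite gphi_eq => /[!inE] /orP[] /eqP kE; move: Vh.
    by rewrite -gvertex_None -kE vk.
  by rewrite -virtual_sigma -gvertex_None -kE vk.
case vk: (gvertex k) => [u|]; last first.
  apply/esym/negP=> kh; move: vk; rewrite (@gvertex_in _ v) //.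
  by rewrite (gvertex_val vh).
apply/eqP/idP=> [[e]|kh]; last first.
  congr inl; apply: Some_inj; rewrite -vk; apply/esym/gvertex_in.
  by rewrite (gvertex_val vh).
by rewrite -(gvertex_val vh) e (gvertex_val vk) mem_pblock cover_vtx.
Qed.

Lemma diagram_wired : wired (X := X) gphi.
Proof.
have half h : whalf (X := X) (gphi h) (sgn h).
  rewrite /whalf gend gend'; case vh: (gvertex h) => //=.
  have Vh : virtual h by rewrite -gvertex_None vh.
  have /andP[/negPf -> _] := Vh.
  have := gvertex_None (sigma h); rewrite virtual_sigma Vh.
  by case: (gvertex _).
have prec_edge h k h' k' : h' \in edge h -> k' \in edge k -> prec h' k' = prec h k.
  by rewrite !inE => /orP[]/eqP-> /orP[]/eqP->;
     rewrite ?(prec_sigmal PG) ?(prec_sigmar PG).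
have repE h : rep h \in edge h by rewrite -rep_eq rep_rep.
split.
- move=> h k /eqP; rewrite gphi_eq !inE => /orP[/eqP //|/eqP ->].
  by rewrite sgn_sigmaE; case: eqP => [->//|_]; case: (sgn k).
- move=> e b; split=> [|[h [<- <-]] //].
  case: (eqVneq b (sgn (val e))) => [->|n]; first by exists (val e); rewrite gphi_val.
  have -> : b = ~~ sgn (val e) by case: b (sgn _) n => -[].
  rewrite -{1}[e]gphi_val /whalf negbK gend gend'.
  case: (eqVneq (sigma (val e)) (val e)) => [E|n']; last first.
    by exists (sigma (val e)); rewrite gphi_sigma gphi_val (sgn_sigma PG).
  rewrite /= => nv; have : virtual (val e).
    by rewrite -gvertex_None; case: (gvertex _) nv.
  by rewrite /virtual E eqxx.
- exact: gphi_sigma.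
- move=> h k /eqP; rewrite gphi_eq !inE => /orP[/eqP->//|/eqP -> _].
  by rewrite sK.
- rewrite -{1}(equivalence_partition_pblock (vtx_partition PG)).
  rewrite /preim_partition /equivalence_partition; apply: eq_imset => h.
  by apply/setP=> k; rewrite !inE /= gkey.
- by move=> h k /=; rewrite (prec_edge h k) ?repE.
- move=> h /=; case: (rep_edge h) => -> //.
  by rewrite (color_sigma HG).
- move=> h; rewrite gend; case vh: (gvertex h) => [v|].
    rewrite /= /gdec; case: boolp.cid => m /= [dm _ _]; apply: dm.
    by rewrite (gvertex_val vh) mem_pblock cover_vtx.
  have Vh : virtual h by rewrite -gvertex_None vh.
  apply: (deco_virtual HG (v := edge h)); last exact: set21.
    by case/andP: Vh.
  by apply/existsP; exists h; rewrite set21 Vh eqxx.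
Qed.

Lemma diagram_planar_order : planar_order X.
Proof.
have W := diagram_wired.
have steplt (e e' : wE X) : wstep e e' -> wlt e e'.
  (* An edge from a vertex to itself would make the vertex virtual. *)
  move=> s; have r : reach (val e) (val e').
    by apply/connect1/(wstep_edge_step W); rewrite !gphi_val.
  apply: (prec_reach PG _ r); rewrite -gphi_eq !gphi_val; apply/eqP=> ee.
  subst e'; case/wstepP: s => v Te Se.
  have [h [ph sh kh]] := half_end W (b := true) Te.
  have [k [pk sk kk]] := half_end W (b := false) Se.
  have kh' : k \in edge h by rewrite -gphi_eq ph pk.
  have nh : sigma h != h.
    by move: kh'; rewrite !inE => /orP[/eqP kE|/eqP kE]; rewrite ?kE in sk *;
      [rewrite sh in sk | apply: contra_eq_neq sk => ->; rewrite sh].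
  have kE : k = sigma h.
    by move: kh'; rewrite !inE => /orP[] /eqP // kE; rewrite kE sh in sk.
  have vA : pblock (vtx G) h \in vtx G by rewrite pblock_mem ?cover_vtx.
  have hA : h \in pblock (vtx G) h by rewrite mem_pblock cover_vtx.
  have kA : k \in pblock (vtx G) h by rewrite -gkey kh kk.
  have eA : pblock (vtx G) h = edge h.
    apply: (virtual_orbit PG vA nh); apply/subsetP=> x.
    by rewrite !inE => /orP[] /eqP -> //; rewrite -kE.
  have : virtual h by rewrite /virtual nh -eA.
  rewrite -gvertex_None -gend; have /(key_inl (X := X) gphi) -> // := kh.
split=> //.
- by move=> e; rewrite /= (prec_irr PG).
- by move=> y x z /=; apply: (prec_trans PG).
- move=> e e' n; apply: (prec_total PG); rewrite -gphi_eq !gphi_val eq_sym //.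
- move=> v; have /andP[vA _] := valP v; have [h hv sh] := directed_in PG vA.
  exists (gphi h); rewrite -[wT _]/(wend (X := X) (gphi h) true).
  by rewrite -sh gend (gvertex_in hv).
- move=> v; have /andP[vA _] := valP v; have [h hv sh] := directed_out PG vA.
  exists (gphi h); rewrite -[wS _]/(wend (X := X) (gphi h) false).
  by rewrite -(negPf sh) gend (gvertex_in hv).
- move=> e e' e'' r l1 l2.
  have ne (x y : wE X) : wlt x y -> x != y.
    by move=> l; apply: contraTneq l => ->; rewrite /= (prec_irr PG).
  have ltr : wlt e e'' by apply: (prec_trans PG) l1 l2.
  have := r; rewrite -[e]gphi_val -[e'']gphi_val => /(wreach_reach W).
  rewrite !gphi_val => /(_ (ne _ _ ltr)) r'.
  by case: (prec_between PG r' l1 l2) => /(reach_wired W); rewrite !gphi_val; auto.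
Qed.

Lemma diagram_wiring_planar : planar X.
Proof.
have W := diagram_wired; have PX := diagram_planar_order.
split=> // v; have [h hv] : exists h, h \in val v.
- by have /andP[vA _] := valP v; have [h hv _] := directed_in PG vA; exists h.
- have kh : wkey (X := X) gphi h = inl v by apply/key_inl; rewrite gend (gvertex_in hv).
  have vE : val v = [set k | wkey (X := X) gphi h == wkey (X := X) gphi k].
    by apply/setP=> k; rewrite inE gkey -(gvertex_val (gvertex_in hv)).
  rewrite -(ins_at_wired W PX kh) -(map_color W) -vE.
  by rewrite /= /gdec; case: boolp.cid => m /= [].
- by have /andP[vA _] := valP v; have [h hv _] := directed_in PG vA; exists h.
- have kh : wkey (X := X) gphi h = inl v by apply/key_inl; rewrite gend (gvertex_in hv).
  have vE : val v = [set k | wkey (X := X) gphi h == wkey (X := X) gphi k].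
    by apply/setP=> k; rewrite inE gkey -(gvertex_val (gvertex_in hv)).
  rewrite -(outs_at_wired W PX kh) -(map_color W) -vE.
  by rewrite /= /gdec; case: boolp.cid => m /= [].
Qed.

End WiringOfDiagram.

(** * The code is a complete invariant of diagrams *)

Section Coded.
Variable D : tscheme.

Definition coded (G : prediagram D) (l : seq (entry D)) :=
  exists (X : wiring D) (phi : he G -> wE X),
    [/\ wired phi, planar X & l = wcode X].

Lemma coded_diagram G l : coded G l -> is_diagram G.
Proof. by case=> X [phi [W PX _]]; apply: (wired_diagram W PX PX). Qed.

Lemma diagram_coded G : is_diagram G -> exists l, coded G l.
Proof.
move=> HG; exists (wcode (diagram_wiring HG)), (diagram_wiring HG), (gphi HG).
by split=> //; [apply: diagram_wired | apply: diagram_wiring_planar].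
Qed.

Lemma coded_valid G l : coded G l -> valid l [::] [::] (ddom G) (dcod G).
Proof.
case=> X [phi [W PX ->]]; rewrite (ddom_wired W PX) (dcod_wired W PX).
exact: wcode_valid.
Qed.

Lemma coded_diso G G' l : coded G l -> diso G G' -> coded G' l.
Proof.
case=> X [phi [W PX lE]] [f [g fK gK] [fs fsgn fv fp fc]].
exists X, (fun k => phi (g k)); split=> //.
have gs k : g (sigma k) = sigma (g k) by rewrite -{1}(gK k) -fs fK.
have gsgn k : sgn (g k) = sgn k by rewrite -{2}(gK k) fsgn.
split.
- move=> h k /(wired_inj W); rewrite !gsgn => /[apply].
  exact: (can_inj gK).
- move=> e b; split=> [/(wired_half W)[h [<- <-]]|[k [<- <-]]].
    by exists (f h); rewrite fK fsgn.
  by apply/(wired_half W); exists (g k).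
- by move=> h; rewrite gs (wired_sigma W).
- move=> h k e; rewrite -!gsgn => /(wired_mate W e) s.
  by rewrite -(gK k) -s -gs gK.
- have kE k : wkey (fun k => phi (g k)) k = wkey phi (g k) by rewrite /wkey gsgn.
  rewrite fv (wired_vtx W); apply/setP=> A; apply/imsetP/imsetP=> [[B]|[k _ ->]].
    case/imsetP=> h _ -> ->; exists (f h) => //.
    apply/setP=> k; rewrite !inE /= !kE fK; apply/imsetP/idP=> [[x]|e].
      by rewrite !inE /= => e ->; rewrite fK.
    by exists (g k); rewrite ?gK // !inE.
  exists [set x | wkey phi (g k) == wkey phi x].
    by apply/imsetP; exists (g k) => //; apply/setP=> x; rewrite !inE.
  apply/setP=> x; rewrite !inE /= !kE; apply/idP/imsetP=> [e|[y]].
    by exists (g x); rewrite ?gK // !inE.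
  by rewrite !inE => e ->; rewrite fK.
- by move=> h k; rewrite -{1}(gK h) -{1}(gK k) fp (wired_prec W).
- by move=> k; rewrite -{1}(gK k); have [-> _] := fc (g k); rewrite (wired_color W).
- move=> k; rewrite -{1}(gK k); have [_ ->] := fc (g k).
  by rewrite (wired_deco W) gsgn.
Qed.

(** Both wirings can be recovered from the half-edges, so they have the same
    edges [th] in the same order. It remains to compare the entries: whether an
    end of an edge lies in a real vertex is visible in [G], as is whether two
    edges have the same target. *)
Lemma coded_uniq G l l' : coded G l -> coded G l' -> l = l'.
Proof.
case=> X [phi [W PX ->]] [Y [psi [W' PY ->]]].
have same h k : (phi h == phi k) = (psi h == psi k).
  by rewrite eq_sym -(edge_wired W) (edge_wired W') eq_sym.
pose he_of e := sval (boolp.cid (wired_ex W e)).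
have he_ofP e : phi (he_of e) = e by rewrite /he_of; case: boolp.cid.
pose th e := psi (he_of e).
have thE h : th (phi h) = psi h by apply/eqP; rewrite -same he_ofP.
have real b e : wend e b = None <-> wend (th e) b = None.
  have sub (Z Z' : wiring D) (f : he G -> wE Z) (f' : he G -> wE Z') (PZ : planar Z)
      (PZ' : planar Z') (F : wired f) (F' : wired f') h :
      (forall k, (f h == f k) = (f' h == f' k)) ->
      wend (f h) b <> None -> wend (f' h) b <> None.
    move=> s; case E: (wend (f h) b) => [v|] // _.
    have [k [fk sk kk]] := half_end F E.
    have vk : virtual k = false.
      by rewrite (virtual_wired F PZ) fk; move: E => {sk}; rewrite /wend; case: b => ->;
         rewrite ?andbF.
    have f'k : f' k = f' h by apply/eqP; rewrite eq_sym -s fk.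
    move: vk (wired_half_he F' k); rewrite (virtual_wired F' PZ') f'k sk /whalf /wend.
    by case: b {E sk} => /=; case: (wT _) => [?|] //; case: (wS _).
  have := sub X Y phi psi PX PY W W' (he_of e) (same _).
  have := sub Y X psi phi PY PX W' W (he_of e) (fun k => esym (same _ k)).
  rewrite he_ofP /th; case: (wend e b) => [v|]; case: (wend _ b) => [u|] //.
    by move=> _ /(_ _)[].
  by move=> /(_ _)[].
have keys h k : (wkey phi h == wkey phi k) = (wkey psi h == wkey psi k).
  by rewrite -(same_block W) (same_block W').
have thlt e e' : wlt (th e) (th e') = wlt e e'.
  by have := wired_prec W (he_of e) (he_of e'); rewrite (wired_prec W') !he_ofP.
have wY : wedges Y = map th (wedges X).
  apply: (sorted_uniq_eq PY); first exact: (wedges_sorted PY).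
    rewrite pairwise_map; have := wedges_sorted PX.
    by apply: sub_pairwise => e e' /=; rewrite thlt.
  move=> e; rewrite mem_wedges; apply/esym/mapP.
  have [h <-] := wired_ex W' e; exists (phi h); rewrite ?thE ?mem_wedges //.
rewrite /wcode wY -map_comp; apply: eq_map => e /=; rewrite /wentry.
have col : wcol e = wcol (th e).
  by have := wired_color W (he_of e); rewrite (wired_color W') he_ofP.
have In : (wS e == None) = (wS (th e) == None).
  by apply/eqP/eqP => /(real false).
congr Entry => //; case Te: (wT e) => [v|]; last first.
  by have /(real true) := Te; rewrite /= => ->.
case Tt: (wT (th e)) => [u|]; last by have /(real true) := Tt; rewrite /= Te.
have ends h v' : wT (phi h) = Some v' -> exists2 k,
    phi k = phi h & sgn k /\ wkey phi k = inl v'.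
  by move=> Th; have [k [pk sk kk]] := @half_end _ _ _ _ W (phi h) true _ Th; exists k.
have [h [ph sh kh]] := @half_end _ _ _ _ W e true _ Te.
have pu : psi h = th e by rewrite -ph thE.
have ku : wkey psi h = inl u by apply/key_inl; rewrite pu sh.
have dE : wdec v = wdec u.
  have := wired_deco W h; rewrite (wired_deco W').
  by have /key_inl -> := ku; have /key_inl -> := kh; case.
have lE : wlast e = wlast (th e).
  apply/forallP/forallP=> la e'.
    have [k <-] := wired_ex W' e'; apply/implyP=> /eqP Tk; rewrite Tt in Tk.
    have [k' [pk' sk' kk']] := @half_end _ _ _ _ W' (psi k) true _ Tk.
    have /implyP := la (phi k'); rewrite -thlt !thE pk'; apply.
    apply/eqP; rewrite Te.
    have /eqP : wkey phi h == wkey phi k' by rewrite keys ku kk'.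
    by rewrite kh => /esym/key_inl; rewrite sk'.
  have [k <-] := wired_ex W e'; apply/implyP=> /eqP Tk; rewrite Te in Tk.
  have [k' [pk' sk' kk']] := @half_end _ _ _ _ W (phi k) true _ Tk.
  have /implyP := la (psi k'); rewrite -[psi k']thE thlt pk'; apply.
  apply/eqP; rewrite Tt -pk' thE.
  have /eqP : wkey psi h == wkey psi k' by rewrite -keys kh kk'.
  by rewrite ku => /esym/key_inl; rewrite sk'.
by rewrite dE lE.
Qed.

Lemma pairs_lt (X Y : wiring D) (PX : planar X) (PY : planar Y)
  (sE : size (wedges X) = size (wedges Y)) p q : p \in edge_pairs X Y ->
  q \in edge_pairs X Y -> wlt p.1 q.1 = wlt p.2 q.2.
Proof.
move=> pz qz; have [i il pE] := nthP p pz; have [j jl qE] := nthP p qz.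
have lt_nth (Z : wiring D) (PZ : planar Z) e i' j' : i' < size (wedges Z) ->
    j' < size (wedges Z) -> wlt (nth e (wedges Z) i') (nth e (wedges Z) j') = (i' < j').
  move=> li lj; have := pairwiseP e (wedges_sorted PZ) => H.
  case: (ltngtP i' j') => [l|l|->]; last exact: (wlt_irr PZ).
    by apply: H.
  by apply: (wlt_asym PZ); apply: H.
have nth1 k : k < size (edge_pairs X Y) -> nth p (edge_pairs X Y) k =
    (nth p.1 (wedges X) k, nth p.2 (wedges Y) k).
  by move=> _; rewrite -nth_zip // -surjective_pairing.
have sz : size (edge_pairs X Y) = size (wedges X) by rewrite size_zip sE minnn.
have pe := nth1 i il; have qe := nth1 j jl; rewrite pE in pe; rewrite qE in qe.
transitivity (i < j).
  by rewrite (congr1 fst qe) {1}(congr1 fst pe) lt_nth // -sz.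
by rewrite (congr1 snd qe) {1}(congr1 snd pe) lt_nth // -sE -sz.
Qed.

(** Equal codes pair the edges of the two wirings, and by rigidity also their
    vertices. Half-edges are determined by their edge and their sign, so the
    pairing of the edges lifts to the half-edges. *)
Lemma coded_eq_diso G G' l : coded G l -> coded G' l -> diso G G'.
Proof.
case=> X [phi [W PX ->]] [Y [psi [W' PY cE]]].
have sE := size_edges cE.
pose z := edge_pairs X Y.
pose R h k := (phi h, psi k) \in z /\ sgn h = sgn k.
have halfE p b : p \in z -> whalf p.1 b = whalf p.2 b.
  move=> pz; have t0 := pairs_T0 cE pz; have s0 := pairs_S0 cE pz.
  rewrite /whalf /wend; case: b; move: t0 s0; case: (wT p.1) => [?|];
  by case: (wT p.2) => [?|] //; case: (wS p.1) => [?|]; case: (wS p.2).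
have totl h : exists k, R h k.
  have : phi h \in unzip1 z by rewrite unzip1_pairs // mem_wedges.
  case/mapP=> [[e e'] pz /= eh]; have := wired_half_he W h.
  rewrite eh (halfE _ _ pz) => /(wired_half W')[k [pk sk]].
  by exists k; rewrite /R pk eh.
have totr k : exists h, R h k.
  have : psi k \in unzip2 z by rewrite unzip2_pairs // mem_wedges.
  case/mapP=> [[e e'] pz /= ek]; have := wired_half_he W' k.
  rewrite ek -(halfE _ _ pz) => /(wired_half W)[h [ph sh]].
  by exists h; rewrite /R ph ek.
have funr h k k' : R h k -> R h k' -> k = k'.
  move=> [p1 s1] [p2 s2]; apply: (wired_inj W'); last by rewrite -s1 -s2.
  exact: (congr1 snd (pairs_fun cE p1 p2 erefl)).
have funl h h' k : R h k -> R h' k -> h = h'.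
  move=> [p1 s1] [p2 s2]; apply: (wired_inj W); last by rewrite s1 s2.
  exact: (congr1 fst (pairs_inj cE p1 p2 erefl)).
pose f h := sval (boolp.cid (totl h)); pose g k := sval (boolp.cid (totr k)).
have fP h : R h (f h) by rewrite /f; case: boolp.cid.
have gP k : R (g k) k by rewrite /g; case: boolp.cid.
have fK : cancel f g by move=> h; apply: funl (gP _) (fP _).
have gK : cancel g f by move=> k; apply: funr (fP _) (gP _).
have zc h : (phi h, psi (f h)) \in z by case: (fP h).
have fsgn h : sgn (f h) = sgn h by case: (fP h).
have ends h v : wkey phi h = inl v -> exists2 w, wkey psi (f h) = inl w &
    vertex_pair v w.
  move=> /key_inl; rewrite /wend; case s: (sgn h) => E.
    have [w Tw vw] := rigid_T PX PY cE (zc h) E; exists w => //.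
    by apply/key_inl; rewrite fsgn s.
  have [w Tw vw] := rigid_S PX PY cE (zc h) E; exists w => //.
  by apply/key_inl; rewrite fsgn s.
have free h e : wkey phi h = inr e -> wkey psi (f h) = inr (psi (f h)).
  move=> /(key_inr W)[eh t0 s0]; rewrite eh in t0 s0; apply: key_free; apply/eqP.
    by rewrite -(pairs_T0 cE (zc h)) /= t0.
  by rewrite -(pairs_S0 cE (zc h)) /= s0.
have keys h k : (wkey psi (f h) == wkey psi (f k)) = (wkey phi h == wkey phi k).
  case kh: (wkey phi h) => [v|e].
    have [w -> vw] := ends _ _ kh.
    case kk: (wkey phi k) => [v'|e']; last by rewrite (free _ _ kk).
    have [w' -> vw'] := ends _ _ kk; apply/eqP/eqP=> [[ww]|[vv]].
      by rewrite ww in vw; rewrite (vertex_pair_inj PY cE vw vw').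
    by rewrite vv in vw; rewrite (vertex_pair_fun PX cE vw vw').
  rewrite (free _ _ kh); case kk: (wkey phi k) => [v'|e'].
    by have [w' -> _] := ends _ _ kk.
  rewrite (free _ _ kk); have [-> _ _] := key_inr W kh.
  have [-> _ _] := key_inr W kk; apply/eqP/eqP=> [[ee]|[ee]].
    by rewrite (congr1 fst (pairs_inj cE (zc h) (zc k) ee) : phi h = phi k).
  by rewrite (congr1 snd (pairs_fun cE (zc h) (zc k) ee) : psi (f h) = psi (f k)).
exists f; first by exists g.
split=> //.
- move=> h; apply: funr (fP _) _; split; last first.
    have := sigma_neq W h; have := sigma_neq W' (f h).
    rewrite fsgn -(halfE _ _ (zc h)) => e1 e2; rewrite -e2 in e1.
    case: (eqVneq (sigma h) h) e1 => [->|n] /=.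
      by move/eqP=> ->; rewrite fsgn.
    by move=> n'; rewrite (sgn_sigma_wired W n) (sgn_sigma_wired W' n') fsgn.
  by rewrite (wired_sigma W) (wired_sigma W').
- apply/setP=> A; apply/(vtx_wired W')/imsetP=> [[k ->]|[B]].
    exists [set h | wkey phi (g k) == wkey phi h].
      by apply/(vtx_wired W); exists (g k).
    apply/setP=> x; rewrite inE; apply/idP/imsetP=> [e|[y]].
      by exists (g x); rewrite ?gK // inE -keys !gK.
    by rewrite inE -keys gK => e ->.
  move=> /(vtx_wired W)[h ->] ->; exists (f h).
  apply/setP=> x; rewrite inE; apply/imsetP/idP=> [[y]|e].
    by rewrite inE -keys => e ->.
  by exists (g x); rewrite ?gK // inE -keys gK.
- move=> h k; rewrite (wired_prec W) (wired_prec W').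
  by rewrite -(pairs_lt PX PY sE (zc h) (zc k)).
- move=> h; have := pairs_entry cE (zc h); rewrite /wentry => -[ce _ _].
  rewrite (wired_color W) (wired_color W') ce; split=> //.
  rewrite (wired_deco W) (wired_deco W').
  case kh: (wkey phi h) => [v|e].
    have [w kw vw] := ends _ _ kh; have /key_inl -> := kh.
    by have /key_inl -> := kw; rewrite (vertex_pair_dec cE vw).
  have := free _ _ kh; move: kh; rewrite /wkey.
  by case: (wend _ _) => [//|]; case: (wend _ _).
Qed.

End Coded.

(** * Codes of relabelled, unitary, prime and juxtaposed diagrams *)

Section Relabel.
Variables (D E : tscheme) (p : tscheme_hom D E).

Definition map_status (s : status D) : status E :=
  match s with Out => Out | Wait => Wait | Close m => Close (hmor p m) end.

Definition map_entry (e : entry D) : entry E :=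
  Entry (hob p (ecolor e)) (is_in e) (map_status (stat e)).

Lemma coded_relabel G l : coded G l -> coded (relabel p G) (map map_entry l).
Proof.
case=> X [phi [W PX ->]].
pose Y := @Wiring E (wE X) (@wlt _ X) (wV X) (@wS _ X) (@wT _ X)
  (fun e => hob p (wcol e)) (fun v => hmor p (wdec v)).
have PY : planar_order Y by case: (PX : planar_order X) => *; split.
exists Y, phi; split.
- case: W => W1 W2 W3 W4 W5 W6 W7 W8; split=> //= h; first by rewrite W7.
  by rewrite W8 /wend /=; case: (sgn h); [case: (wT _)|case: (wS _)].
- split=> // v.
    have := congr1 (map (hob p)) (wdec_src PX v); rewrite -map_comp.
    by rewrite [wdec v]/(hmor p (wdec (X := X) v)) hmor_src.
  have := congr1 (map (hob p)) (wdec_tgt PX v); rewrite -map_comp.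
  by rewrite [wdec v]/(hmor p (wdec (X := X) v)) hmor_tgt.
rewrite /wcode -map_comp; apply: eq_map => e; rewrite /wentry /map_entry /=.
congr Entry; case: (wT e) => //= v.
by rewrite -[wlast (X := Y) e]/(wlast (X := X) e); case: ifP.
Qed.

End Relabel.

Section SmallDiagrams.
Variable D : tscheme.

Definition empty_wiring : wiring D :=
  @Wiring D void (fun _ _ => false) void (fun _ => None) (fun _ => None)
    (of_void _) (of_void _).

Lemma coded_empty : coded (@empty_diagram D) [::].
Proof.
exists empty_wiring, (of_void _); split.
- split=> [[]|[]|[]|[]||[]|[]|[]] //.
  by apply/setP=> A; rewrite inE; apply/esym/imsetP=> -[[]].
- by split; [split=> [[]|[]|[]|[]|[]|[]|[]]|case|case].
- by rewrite /wcode /wedges; case: (sort _ _) => // -[].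
Qed.

Definition unitary_wiring (x : sOb D) : wiring D :=
  @Wiring D Datatypes.unit (fun _ _ => false) void (fun _ => None) (fun _ => None)
    (fun _ => x) (of_void _).

Lemma coded_unitary x : coded (unitary_diagram x) [:: @Entry D x true Out].
Proof.
have PX : planar_order (unitary_wiring x).
  split=> //.
  by move=> e e' /existsP[[]].
exists (unitary_wiring x), (fun _ => tt); split.
- split=> //.
  + by move=> [] b; split=> _; [exists b|case: b].
  + by move=> [] [].
  + apply/setP=> A; rewrite inE; apply/eqP/imsetP=> [->|[b _ ->]].
      by exists true => //; apply/setP=> b; rewrite !inE; case: b.
    by apply/setP=> c; rewrite !inE; case: b {A}; case: c.
  + by move=> h; rewrite /wend; case: (sgn h).
- by split=> // -[].
- rewrite /wcode (_ : wedges (unitary_wiring x) = [:: tt]) //.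
  by apply: (sorted_uniq_eq PX) => [|//|[]]; [exact: (wedges_sorted PX)|rewrite mem_wedges].
Qed.

Lemma connect_homo (A B : finType) (r : rel A) (r' : rel B) (f : A -> B) :
  (forall x y, r x y -> r' (f x) (f y)) ->
  forall x y, connect r x y -> connect r' (f x) (f y).
Proof.
move=> H x y /connectP[p]; elim: p x => [|z p IH] x /=; first by move=> _ ->.
move=> /andP[rx pp] e; apply: connect_trans (connect1 (H _ _ rx)) (IH _ pp e).
Qed.

Lemma filter_all (A : Type) (p : pred A) s : (forall x, p x) -> filter p s = s.
Proof. by move=> pT; apply/all_filterP/allT. Qed.

Lemma filter_none (A : Type) (p : pred A) s : (forall x, p x = false) -> filter p s = [::].
Proof. by move=> p0; rewrite (eq_filter p0) filter_pred0. Qed.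

Section Prime.
Variable m : Mor D.
Notation a := (size (src m)).
Notation b := (size (tgt m)).

Definition prime_wiring : wiring D :=
  @Wiring D ('I_a + 'I_b)%type (@prec (prime_diagram m)) Datatypes.unit
    (fun e => if e is inl _ then None else Some tt)
    (fun e => if e is inl _ then Some tt else None)
    (@color D (prime_diagram m)) (fun _ => m).
Notation X := prime_wiring.

Lemma prime_planar_order : planar_order X.
Proof.
have st (e e' : wE X) : wstep e e' -> exists i j, e = inl i /\ e' = inr j.
  by case/wstepP=> -[]; case: e => // i; case: e' => // j; exists i, j.
split.
- by case=> i /=; apply: ltnn.
- by move=> [y|y] [x|x] [z|z] //=; apply: ltn_trans.
- by move=> [i|i] [j|j] //=; rewrite (inj_eq inl_inj, inj_eq inr_inj) -val_eqE neq_ltn.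
- by move=> v; exists (inl ord0); case: v.
- by move=> v; exists (inr ord0); case: v.
- by move=> e e' /st[i [j [-> ->]]].
- move=> e e' e'' /connectP[[|f p] /=].
    by move=> _ -> l l'; case: e e' l l' => [i|i] [j|j] //= l; rewrite ltnNge ltnW.
  move=> /andP[/st[i [j [-> ->]]]]; case: p => [|g p]; last first.
    by move=> /andP[/st[? [? []]]].
  move=> _ -> /=; case: e' => k l l'; [right|left];
  by apply/connect1/existsP; exists tt; rewrite !eqxx.
Qed.

Lemma coded_prime : coded (prime_diagram m) (prime_code m).
Proof.
have PX := prime_planar_order.
have edgesE : wedges X = map inl (enum 'I_a) ++ map inr (enum 'I_b).
  apply: (sorted_uniq_eq PX); first exact: (wedges_sorted PX).
    have en n : pairwise (fun i j : 'I_n => i < j) (enum 'I_n).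
      rewrite -(pairwise_map val ltn) val_enum_ord.
      by rewrite -sorted_pairwise ?iota_ltn_sorted //; exact: ltn_trans.
    rewrite pairwise_cat; apply/and3P; split.
    - by apply/allrelP=> _ _ /mapP[i _ ->] /mapP[j _ ->].
    - by rewrite pairwise_map; apply: en.
    - by rewrite pairwise_map; apply: en.
  move=> [i|i]; rewrite mem_wedges mem_cat; apply/esym/orP; [left|right];
  by apply/map_f; rewrite mem_enum.
have tE (s : seq (sOb D)) : [seq tnth (in_tuple s) i | i <- enum 'I_(size s)] = s.
  exact: (map_tnth_enum (in_tuple s)).
exists X, id; split.
- split=> //.
  + by move=> [i|j] []; split=> //;
       [exists (inl i)|case=> h [->]|case=> h [->]|exists (inr j)].
  + apply/setP=> A; rewrite inE; apply/eqP/imsetP=> [->|[h _ ->]].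
      by exists (inl ord0) => //; apply/setP=> -[h|h]; rewrite !inE.
    by apply/setP=> c; rewrite !inE; case: h; case: c.
  + by case.
- have fE (p : pred (wE X)) : filter p (wedges X)
      = map inl (filter (p \o inl) (enum 'I_a)) ++ map inr (filter (p \o inr) (enum 'I_b)).
    by rewrite edgesE filter_cat (filter_map inl) (filter_map inr).
  split=> // -[]; rewrite /wins /wouts fE map_cat;
    rewrite -(map_comp (@wcol D X) inl) -(map_comp (@wcol D X) inr).
    by rewrite filter_all // filter_none // cats0 [RHS]tE.
  by rewrite filter_none // filter_all // [RHS]tE.
- rewrite /wcode edgesE map_cat -(map_comp (@wentry D X) inl).
  rewrite -(map_comp (@wentry D X) inr) /prime_code; congr cat; last first.
    by rewrite -[in LHS](tE (tgt m)) -map_comp; apply: eq_map.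
  have szE : size (next_letters (src m)) = a.-1 by [].
  apply/esym; apply: (@eq_from_nth _ (Entry (first_letter (src m)) true Out)).
    by rewrite size_map size_enum_ord size_rcons size_map size_belast.
  move=> i; rewrite size_map size_enum_ord => li.
  rewrite (nth_map ord0) ?size_enum_ord // nth_rcons size_map size_belast.
  rewrite /wentry [comp _ _ _]/=.
  have -> : tnth (in_tuple (src m)) (nth ord0 (enum 'I_a) i)
      = nth (first_letter (src m)) (src m) i.
    by rewrite (tnth_nth (first_letter (src m))) nth_enum_ord.
  have laE : wlast (X := X) (inl (nth ord0 (enum 'I_a) i)) = (i == a.-1).
    apply/forallP/eqP=> [la|iE].
      have /= := la (inl ord_max); rewrite nth_enum_ord //= -leqNgt => ai.
      by apply/eqP; rewrite eqn_leq -ltnS li.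
    case=> j //=; rewrite nth_enum_ord // -leqNgt iE -ltnS.
    exact: ltn_ord.
  rewrite laE szE; case: ltngtP => [l|l|e].
  - rewrite (nth_map (first_letter (src m))) ?size_belast //.
    congr Entry; rewrite [X in nth _ X](lastI (first_letter (src m))).
    by rewrite nth_rcons size_belast l.
  - by move: l; rewrite ltnNge -ltnS li.
  - congr Entry; rewrite [X in nth _ X](lastI (first_letter (src m))).
    by rewrite nth_rcons size_belast e ltnn eqxx.
Qed.

End Prime.
End SmallDiagrams.

Section Tensor.
Variables (D : tscheme) (X1 X2 : wiring D).

Definition tensor_wiring : wiring D :=
  @Wiring D (wE X1 + wE X2)%type
    (fun e e' => match e, e' with
      | inl e, inl e' => wlt e e' | inr e, inr e' => wlt e e'
      | inl _, inr _ => true | inr _, inl _ => false end)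
    (wV X1 + wV X2)%type
    (fun e => match e with inl e => omap inl (wS e) | inr e => omap inr (wS e) end)
    (fun e => match e with inl e => omap inl (wT e) | inr e => omap inr (wT e) end)
    (fun e => match e with inl e => wcol e | inr e => wcol e end)
    (fun v => match v with inl v => wdec v | inr v => wdec v end).
Notation X := tensor_wiring.

Hypotheses (P1 : planar X1) (P2 : planar X2).

Lemma tensor_step (e e' : wE X) : wstep e e' ->
  (exists a a', [/\ e = inl a, e' = inl a' & wstep a a']) \/
  (exists b b', [/\ e = inr b, e' = inr b' & wstep b b']).
Proof.
case/wstepP; case: e e' => [a|b] [a'|b'] v /=; case T: (wT _) => [u|] // [<-];
  case S: (wS _) => [w|] // [] wu; [left|right].
  by exists a, a'; split=> //; apply/wstepP; exists u; rewrite // S wu.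
by exists b, b'; split=> //; apply/wstepP; exists u; rewrite // S wu.
Qed.

Lemma tensor_reach (e e' : wE X) : wreach e e' ->
  (exists a a', [/\ e = inl a, e' = inl a' & wreach a a']) \/
  (exists b b', [/\ e = inr b, e' = inr b' & wreach b b']).
Proof.
move=> /connectP[p]; elim: p e => [|f p IH] e /=.
  by move=> _ ->; case: e => x; [left|right]; exists x, x; split=> //; apply: connect0.
move=> /andP[/tensor_step s pp] ee; have := IH _ pp ee.
case: s => -[x [y [-> -> /connect1 s]]] [] [z [t [//= [<-] -> r]]]; [left|right];
  by exists x, t; split=> //; apply: connect_trans s r.
Qed.

Lemma tensor_planar_order : planar_order X.
Proof.
split.
- by case=> e /=; [apply: (wlt_irr P1)|apply: (wlt_irr P2)].
- by move=> [y|y] [x|x] [z|z] //=; [apply: (wlt_trans P1)|apply: (wlt_trans P2)].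
- move=> [e|e] [e'|e'] //=; rewrite (inj_eq inl_inj, inj_eq inr_inj).
    exact: (wlt_total P1).
  exact: (wlt_total P2).
- case=> v; [have [e E] := win_ex P1 v|have [e E] := win_ex P2 v].
    by exists (inl e); rewrite /= E.
  by exists (inr e); rewrite /= E.
- case=> v; [have [e E] := wout_ex P1 v|have [e E] := wout_ex P2 v].
    by exists (inl e); rewrite /= E.
  by exists (inr e); rewrite /= E.
- move=> e e' /tensor_step[] [x [y [-> -> s]]]; first exact: (wstep_lt P1 s).
  exact: (wstep_lt P2 s).
- have s1 (x y : wE X1) : wreach x y -> wreach (X := X) (inl x) (inl y).
    apply: connect_homo => u v /wstepP[w Tu Sv]; apply/wstepP; exists (inl w).
      by rewrite /= Tu.
    by rewrite /= Sv.
  have s2 (x y : wE X2) : wreach x y -> wreach (X := X) (inr x) (inr y).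
    apply: connect_homo => u v /wstepP[w Tu Sv]; apply/wstepP; exists (inr w).
      by rewrite /= Tu.
    by rewrite /= Sv.
  move=> e e' e'' /tensor_reach[] [x [y [-> -> r]]]; case: e' => // z l1 l2.
    by case: (wbetween P1 r l1 l2) => /s1; auto.
  by case: (wbetween P2 r l1 l2) => /s2; auto.
Qed.

Lemma tensor_edges : wedges X = map inl (wedges X1) ++ map inr (wedges X2).
Proof.
have PX := tensor_planar_order.
apply: (sorted_uniq_eq PX); first exact: (wedges_sorted PX).
  rewrite pairwise_cat !pairwise_map /= (wedges_sorted P1) (wedges_sorted P2) !andbT.
  by apply/allrelP=> _ _ /mapP[i _ ->] /mapP[j _ ->].
move=> [i|i]; rewrite mem_wedges mem_cat; apply/esym/orP; [left|right];
by apply/map_f; rewrite mem_wedges.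
Qed.

Lemma filter_tensor (p : pred (wE X)) : filter p (wedges X) =
  map inl (filter (p \o inl) (wedges X1)) ++ map inr (filter (p \o inr) (wedges X2)).
Proof. by rewrite tensor_edges filter_cat !filter_map. Qed.

Lemma omap_eq (A B : eqType) (f : A -> B) (o : option A) x : injective f ->
  (omap f o == Some (f x)) = (o == Some x).
Proof. by move=> fi; case: o => //= y; rewrite !(inj_eq Some_inj) (inj_eq fi). Qed.

Lemma omap_neq (A C : eqType) (o : option A) (x : C) :
  (omap (@inl A C) o == Some (inr x)) = false.
Proof. by case: o. Qed.

Lemma omap_neq' (A C : eqType) (o : option C) (x : A) :
  (omap (@inr A C) o == Some (inl x)) = false.
Proof. by case: o. Qed.

Lemma tensor_planar : planar X.
Proof.
split; first exact: tensor_planar_order; case=> v /=; rewrite /wins /wouts filter_tensor /=.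
- rewrite (wdec_src P1) /wins map_cat -!map_comp [X in _ ++ X](_ : _ = [::]) ?cats0.
    by congr map; apply: eq_filter => e /=; rewrite omap_eq //; apply: inl_inj.
  by rewrite filter_none // => e /=; rewrite omap_neq'.
- rewrite (wdec_src P2) /wins map_cat -!map_comp [X in X ++ _](_ : _ = [::]) ?cat0s.
    by congr map; apply: eq_filter => e /=; rewrite omap_eq //; apply: inr_inj.
  by rewrite filter_none // => e /=; rewrite omap_neq.
- rewrite (wdec_tgt P1) /wouts map_cat -!map_comp [X in _ ++ X](_ : _ = [::]) ?cats0.
    by congr map; apply: eq_filter => e /=; rewrite omap_eq //; apply: inl_inj.
  by rewrite filter_none // => e /=; rewrite omap_neq'.
- rewrite (wdec_tgt P2) /wouts map_cat -!map_comp [X in X ++ _](_ : _ = [::]) ?cat0s.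
    by congr map; apply: eq_filter => e /=; rewrite omap_eq //; apply: inr_inj.
  by rewrite filter_none // => e /=; rewrite omap_neq.
Qed.

Lemma tensor_code : wcode X = wcode X1 ++ wcode X2.
Proof.
rewrite /wcode tensor_edges map_cat -!map_comp; congr cat; apply: eq_map => e /=.
  rewrite /wentry /=; congr Entry; first by case: (wS e).
  case Te: (wT e) => [v|] //=; congr (if _ then _ else _).
  apply/forallP/forallP=> la; last case=> // e'.
    by move=> e'; have := la (inl e'); rewrite /= Te omap_eq //; apply: inl_inj.
    by have := la e'; rewrite /= Te omap_eq //; apply: inl_inj.
  by rewrite /= Te omap_neq'.
rewrite /wentry /=; congr Entry; first by case: (wS e).
case Te: (wT e) => [v|] //=; congr (if _ then _ else _).
apply/forallP/forallP=> la; last case=> // e'.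
  by move=> e'; have := la (inr e'); rewrite /= Te omap_eq //; apply: inr_inj.
by rewrite /= Te omap_neq.
by have := la e'; rewrite /= Te omap_eq //; apply: inr_inj.
Qed.

End Tensor.

Section CodedTensor.
Variable D : tscheme.

Definition tensor_edge (G1 G2 : prediagram D) (X1 X2 : wiring D)
  (phi1 : he G1 -> wE X1) (phi2 : he G2 -> wE X2)
  (h : he (tensor_diagram G1 G2)) : wE (tensor_wiring X1 X2) :=
  match h with inl h => inl (phi1 h) | inr h => inr (phi2 h) end.

Lemma tensor_wired (G1 G2 : prediagram D) (X1 X2 : wiring D)
  (phi1 : he G1 -> wE X1) (phi2 : he G2 -> wE X2) :
  wired phi1 -> wired phi2 -> wired (tensor_edge phi1 phi2).
Proof.
move=> W1 W2; pose X := tensor_wiring X1 X2; pose phi := tensor_edge phi1 phi2.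
have key1 h k : (wkey phi (inl h) == wkey phi (inl k)) = (wkey phi1 h == wkey phi1 k).
  rewrite /wkey /wend /=; case: (sgn h); case: (sgn k);
  by do 2![case: (wT _) => [?|]|case: (wS _) => [?|]].
have key2 h k : (wkey phi (inr h) == wkey phi (inr k)) = (wkey phi2 h == wkey phi2 k).
  rewrite /wkey /wend /=; case: (sgn h); case: (sgn k);
  by do 2![case: (wT _) => [?|]|case: (wS _) => [?|]].
have key12 h k : wkey phi (inl h) == wkey phi (inr k) = false.
  rewrite /wkey /wend /=; case: (sgn h); case: (sgn k);
  by do 2![case: (wT _) => [?|]|case: (wS _) => [?|]].
have cls1 h : [set y | wkey phi (inl h) == wkey phi y]
    = inl @: [set k | wkey phi1 h == wkey phi1 k].
  apply/setP=> -[k|k]; rewrite inE.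
    by rewrite key1 mem_imset ?inE //; apply: inl_inj.
  by rewrite key12; apply/esym/imsetP=> -[].
have cls2 h : [set y | wkey phi (inr h) == wkey phi y]
    = inr @: [set k | wkey phi2 h == wkey phi2 k].
  apply/setP=> -[k|k]; rewrite inE.
    by rewrite eq_sym key12; apply/esym/imsetP=> -[].
  by rewrite key2 mem_imset ?inE //; apply: inr_inj.
split.
- move=> [h|h] [k|k] //= [] e s.
      by rewrite (wired_inj W1 e s).
    by rewrite (wired_inj W2 e s).
- have hE1 (e : wE X1) b : whalf (X := X) (inl e) b = whalf e b.
      by rewrite /whalf /wend; case: b => /=; case: (wT e); case: (wS e).
    have hE2 (e : wE X2) b : whalf (X := X) (inr e) b = whalf e b.
      by rewrite /whalf /wend; case: b => /=; case: (wT e); case: (wS e).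
    move=> [e|e] b; rewrite ?hE1 ?hE2; split.
  + by case/(wired_half W1) => h [<- <-]; exists (inl h).
  + by case=> -[h|h] [] //= [<-] <-; apply: (wired_half_he W1).
  + by case/(wired_half W2) => h [<- <-]; exists (inr h).
  + by case=> -[h|h] [] //= [<-] <-; apply: (wired_half_he W2).
- by move=> [h|h] /=; rewrite ?(wired_sigma W1) ?(wired_sigma W2).
- move=> [h|h] [k|k] //= [] e s.
      by rewrite (wired_mate W1 e s).
    by rewrite (wired_mate W2 e s).
- apply/setP=> A; rewrite inE; apply/orP/imsetP.
      case=> /imsetP[B]; [move/(vtx_wired W1)|move/(vtx_wired W2)] => -[h ->] ->.
        by exists (inl h) => //; rewrite -cls1; apply/setP=> k; rewrite !inE.
      by exists (inr h) => //; rewrite -cls2; apply/setP=> k; rewrite !inE.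
    case=> -[h|h] _ ->; [left|right].
      apply/imsetP; exists [set k | wkey phi1 h == wkey phi1 k].
        by apply/(vtx_wired W1); exists h.
      by rewrite -cls1; apply/setP=> k; rewrite !inE.
    apply/imsetP; exists [set k | wkey phi2 h == wkey phi2 k].
      by apply/(vtx_wired W2); exists h.
    by rewrite -cls2; apply/setP=> k; rewrite !inE.
- by move=> [h|h] [k|k] //=; rewrite ?(wired_prec W1) ?(wired_prec W2).
- by move=> [h|h] /=; rewrite ?(wired_color W1) ?(wired_color W2).
- move=> [h|h] /=; rewrite ?(wired_deco W1) ?(wired_deco W2) /wend /=;
      by case: (sgn h); [case: (wT _)|case: (wS _)].
Qed.

Lemma coded_tensor (G1 G2 : prediagram D) l1 l2 : coded G1 l1 -> coded G2 l2 ->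
  coded (tensor_diagram G1 G2) (l1 ++ l2).
Proof.
case=> X1 [phi1 [W1 P1 ->]] [X2 [phi2 [W2 P2 ->]]].
exists (tensor_wiring X1 X2), (tensor_edge phi1 phi2); split.
- exact: tensor_wired.
- exact: tensor_planar.
- by rewrite tensor_code.
Qed.

Lemma coded_identity w : coded (@identity_diagram D w) (id_code w).
Proof.
elim: w => [|x w IH]; first exact: coded_empty.
exact: coded_tensor (coded_unitary x) IH.
Qed.

End CodedTensor.

(** * Grafting of wirings *)

Section Partner.
Variables (A B : eqType) (s : seq A) (t : seq B).
(** Outputs are grafted to inputs by their positions in two lists of the same
    length. *)
Definition partner a : option B := onth t (index a s).

Hypotheses (st : size s = size t) (ut : uniq t).

Lemma partner_in a b : partner a = Some b ->
  [/\ a \in s, b \in t & index b t = index a s].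
Proof.
move=> e; have li : index a s < size t by rewrite -onthTE -/(partner a) e.
have nb : nth b t (index a s) = b := onth_nth b _ _ _ e.
split; [by rewrite -index_mem st | by rewrite -nb mem_nth|].
by rewrite -[X in index X _]nb index_uniq.
Qed.

Lemma partner_ex a : a \in s -> exists b, partner a = Some b.
Proof.
by rewrite -index_mem st -onthTE /partner; case: (onth _ _) => [b|] //; exists b.
Qed.
End Partner.

Lemma partner_sym (A B : eqType) (s : seq A) (t : seq B) a b : size s = size t ->
  uniq t -> partner s t a = Some b -> partner t s b = Some a.
Proof.
move=> st ut e; have [ia ib ie] := partner_in st ut e.
rewrite /partner ie; have := onthTE s (index a s); rewrite index_mem ia.
by case E: (onth _ _) => [c|] // _; have := onth_nth a _ _ _ E; rewrite nth_index // => ->.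
Qed.

Lemma count_index (A : eqType) (lt : rel A) (s : seq A) a : irreflexive lt ->
  (forall x y, lt x y -> lt y x = false) ->
  pairwise lt s -> a \in s -> count (fun x => lt x a) s = index a s.
Proof.
move=> irr asy; elim: s => //= x s IH /andP[al ps]; rewrite inE eq_sym.
case: eqVneq => [<- _|n /= ains].
  rewrite irr; apply/eqP; rewrite -leqn0 leqNgt -has_count; apply/hasP=> -[y ys].
  by rewrite asy //; apply: (allP al).
by rewrite (allP al) // add1n IH.
Qed.

Section Graft.
Variables (D : tscheme) (X1 X2 : wiring D).
Hypotheses (P1 : planar X1) (P2 : planar X2).
Hypothesis colE : map wcol (woutputs X1) = map wcol (winputs X2).
Implicit Types (a : wE X1) (b : wE X2).
Notation outs1 := (woutputs X1).
Notation ins2 := (winputs X2).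

Lemma size_graft : size outs1 = size ins2.
Proof. by have := congr1 size colE; rewrite !size_map. Qed.

Lemma uniq_outs1 : uniq outs1. Proof. exact/filter_uniq/uniq_wedges. Qed.
Lemma uniq_ins2 : uniq ins2. Proof. exact/filter_uniq/uniq_wedges. Qed.

Definition glued a b := partner outs1 ins2 a = Some b.

Lemma gluedC a b : glued a b <-> partner ins2 outs1 b = Some a.
Proof.
split; apply: partner_sym; rewrite ?size_graft //;
  by [exact: uniq_outs1 | exact: uniq_ins2].
Qed.

Lemma mem_outs1 a : (a \in outs1) = (wT a == None).
Proof. by rewrite mem_filter mem_wedges andbT. Qed.

Lemma mem_ins2 b : (b \in ins2) = (wS b == None).
Proof. by rewrite mem_filter mem_wedges andbT. Qed.

Lemma glued_free a b : glued a b ->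
  [/\ wT a = None, wS b = None, wcol a = wcol b & index a outs1 = index b ins2].
Proof.
move=> e; have [ia ib ie] := partner_in size_graft uniq_ins2 e.
have := ia; have := ib; rewrite mem_outs1 mem_ins2 => /eqP S /eqP T; split=> //.
have := congr1 (fun s => nth (wcol a) s (index a outs1)) colE.
rewrite /= (nth_map a) ?index_mem // nth_index // -ie (nth_map b) ?index_mem //.
by rewrite nth_index.
Qed.

Lemma glued_l a : wT a = None -> exists b, glued a b.
Proof. by move/eqP; rewrite -mem_outs1 => /(partner_ex size_graft). Qed.

Lemma glued_r b : wS b = None -> exists a, glued a b.
Proof.
move/eqP; rewrite -mem_ins2 => /(partner_ex (esym size_graft))[a /gluedC].
by exists a.
Qed.

Lemma glued_fun a b b' : glued a b -> glued a b' -> b = b'.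
Proof. by rewrite /glued => -> []. Qed.

Lemma glued_inj a a' b : glued a b -> glued a' b -> a = a'.
Proof. by move=> /gluedC + /gluedC => -> []. Qed.

(** A grafted edge occurs in both graphs; it is represented in the composite by
    the edge of the first one. From the second graph only the edges that are not
    inputs remain. *)
Definition inner2 : finType := {b : wE X2 | wS b != None}.

(** In the order A_1, e_1, B_1, ..., A_n, e_n, B_n the three blocks of the [k]-th
    group have the ranks [3 * k], [3 * k + 1] and [3 * k + 2], counting groups from
    0. An edge of the second graph that is not an input belongs to the group of
    the last input before it, hence the predecessor. *)
Definition rank1 a := 3 * count (fun o => wlt o a) outs1 + (wT a == None).
Definition rank2 b := let k := count (fun i => wlt i b) ins2 in
  if wS b == None then 3 * k + 1 else 3 * k.-1 + 2.

Definition graft_rank (x : wE X1 + inner2) :=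
  match x with inl a => rank1 a | inr b => rank2 (val b) end.

Definition graft_lt (x y : wE X1 + inner2) :=
  (graft_rank x < graft_rank y) || (graft_rank x == graft_rank y) &&
  match x, y with
  | inl a, inl a' => wlt a a'
  | inr b, inr b' => wlt (val b) (val b')
  | _, _ => false
  end.

Definition graft_wiring : wiring D :=
  @Wiring D (wE X1 + inner2)%type graft_lt (wV X1 + wV X2)%type
    (fun x => match x with
      | inl a => omap inl (wS a)
      | inr b => omap inr (wS (val b)) end)
    (fun x => match x with
      | inl a => if wT a is Some v then Some (inl v)
                 else obind (fun b => omap inr (wT b)) (partner outs1 ins2 a)
      | inr b => omap inr (wT (val b)) end)
    (fun x => match x with inl a => wcol a | inr b => wcol (val b) end)
    (fun v => match v with inl v => wdec v | inr v => wdec v end).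
Notation X := graft_wiring.
Implicit Types x y z : wE X.

Definition edge1 a : wE X := inl a.

Definition proj2 x : option (wE X2) :=
  match x with inl a => partner outs1 ins2 a | inr b => Some (val b) end.

(** An input of the second graph is represented by the output glued to it; the
    edge of the composite that stands for [b] is characterized by [proj2]. *)
Lemma edge2_ex b : exists x, proj2 x = Some b.
Proof.
case: (boolP (wS b == None)) => [/eqP/glued_r[a e]|n]; first by exists (edge1 a).
by exists (inr (exist _ b n)).
Qed.

Definition edge2 b : wE X := sval (boolp.cid (edge2_ex b)).

Lemma proj2K b : proj2 (edge2 b) = Some b.
Proof. by rewrite /edge2; case: boolp.cid. Qed.

Lemma proj2_inj x y b : proj2 x = Some b -> proj2 y = Some b -> x = y.
Proof.
case: x y => [a|b1] [a'|b2] /= e e'.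
- by rewrite (glued_inj e e').
- have [_ s0 _ _] := glued_free e; case: e' => be.
  by case/eqP: (valP b2); have := s0; rewrite -be.
- have [_ s0 _ _] := glued_free e'; case: e => be.
  by case/eqP: (valP b1); have := s0; rewrite -be.
- by congr inr; apply/val_inj/Some_inj; exact: etrans e (esym e').
Qed.

Lemma proj2E x b : proj2 x = Some b -> x = edge2 b.
Proof. by move=> e; apply: proj2_inj e (proj2K b). Qed.

Lemma edge2_inj : injective edge2.
Proof. by move=> b b' e; apply: Some_inj; rewrite -!proj2K e. Qed.

Lemma edge12 a b : edge1 a = edge2 b <-> glued a b.
Proof. by split=> [e|/(@proj2E (edge1 a)) //]; rewrite /glued -(proj2K b) -e. Qed.

Lemma edgeP x : (exists a, x = edge1 a) \/ (exists2 b, wS b <> None & x = edge2 b).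
Proof.
case: x => [a|b]; [by left; exists a|right; exists (val b)]; last exact: proj2E.
by apply/eqP/(valP b).
Qed.

Lemma edge2_inner b : wS b <> None ->
  exists p : wS b != None, edge2 b = inr (exist _ b p).
Proof.
by move=> /eqP n; exists n; apply/esym/proj2E.
Qed.

Lemma wS_edge1 a : wS (edge1 a) = omap inl (wS a). Proof. by []. Qed.

Lemma wS_edge2 b : wS b <> None -> wS (edge2 b) = omap inr (wS b).
Proof. by case/edge2_inner=> p ->. Qed.

Lemma wT_edge1 a v : wT a = Some v -> wT (edge1 a) = Some (inl v).
Proof. by rewrite /= => ->. Qed.

Lemma wT_edge2 b : wT (edge2 b) = omap inr (wT b).
Proof.
case sb: (wS b) => [v|]; first by have [|p ->] := @edge2_inner b; rewrite ?sb.
have [a g] := glued_r sb; have [t0 _ _ _] := glued_free g.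
have /edge12 <- := g.
by rewrite /= t0 g.
Qed.

Lemma wcol_edge2 b : wcol (edge2 b) = wcol b.
Proof.
case sb: (wS b) => [v|]; first by have [|p ->] := @edge2_inner b; rewrite ?sb.
have [a g] := glued_r sb; have [_ _ ce _] := glued_free g.
by have /edge12 <- := g.
Qed.

Lemma wS_inl x v : wS x = Some (inl v) -> exists2 a, x = edge1 a & wS a = Some v.
Proof.
case: x => [a|b] /=; last by case: (wS _).
by case sa: (wS a) => [u|] // [<-]; exists a.
Qed.

Lemma wS_inr x v : wS x = Some (inr v) -> exists2 b, x = edge2 b & wS b = Some v.
Proof.
case: x => [a|b] /=; first by case: (wS _).
case sb: (wS (val b)) => [u|] // [<-]; exists (val b) => //; exact: proj2E.
Qed.

Lemma wT_inl x v : wT x = Some (inl v) -> exists2 a, x = edge1 a & wT a = Some v.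
Proof.
case: x => [a|b] /=; last by case: (wT _).
case ta: (wT a) => [u|]; first by move=> [<-]; exists a.
by case: (partner _ _ a) => //= b; case: (wT b).
Qed.

Lemma wT_inr x v : wT x = Some (inr v) -> exists2 b, x = edge2 b & wT b = Some v.
Proof.
case: x => [a|b] /=.
  case ta: (wT a) => [u|] //; case g: (partner _ _ a) => [b|] //=.
  case tb: (wT b) => [u|] // [<-]; exists b => //; exact: proj2E.
case tb: (wT (val b)) => [u|] // [<-]; exists (val b) => //; exact: proj2E.
Qed.

(** ** The grafting order *)

Let k1 a := count (fun o => wlt o a) outs1.
Let k2 b := count (fun i => wlt i b) ins2.

Lemma glued_count a b : glued a b -> k1 a = k2 b.
Proof.
move=> g; have [t0 s0 _ ie] := glued_free g.
rewrite /k1 /k2 !count_index ?mem_outs1 ?mem_ins2 ?t0 ?s0 //.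
- exact: (wlt_irr P2).
- exact: (wlt_asym P2).
- exact/pairwise_filter/(wedges_sorted P2).
- exact: (wlt_irr P1).
- exact: (wlt_asym P1).
- exact/pairwise_filter/(wedges_sorted P1).
Qed.

Lemma count_lt (Z : wiring D) (PZ : planar_order Z) (s : seq (wE Z)) e e' : wlt e e' ->
  count (fun o => wlt o e) s <= count (fun o => wlt o e') s /\
  (e \in s -> count (fun o => wlt o e) s < count (fun o => wlt o e') s).
Proof.
move=> l; have sub o : wlt o e -> wlt o e' by move=> l'; apply: (wlt_trans PZ) l' l.
split; first exact: sub_count.
elim: s => //= o s IH; rewrite inE; case/predU1P=> [<-|/IH].
  rewrite (wlt_irr PZ) l add1n ltnS; exact: sub_count.
by move=> ls; rewrite -addnS; apply: leq_add => //; case: (boolP (wlt o e)) => // /sub ->.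
Qed.

Lemma rank1_lt a a' : wlt a a' -> (rank1 a < rank1 a') || (rank1 a == rank1 a').
Proof.
move=> l; have [c1 c2] := count_lt P1 outs1 l; rewrite mem_outs1 in c2.
rewrite /rank1; case: eqP c2 => [_ /(_ isT)|_ _]; lia.
Qed.

Lemma edge1_lt' a a' : wlt a a' -> graft_lt (edge1 a) (edge1 a').
Proof. by rewrite /graft_lt /= => l; case/orP: (rank1_lt l) => -> //; rewrite l orbT. Qed.

Lemma source_ex b : exists2 d, wS d = None & wreach d b.
Proof.
have [n] := ubnP #|[pred x | wlt x b]|; elim: n b => // n IH b lb.
case sb: (wS b) => [v|]; last by exists b; rewrite ?sb //; apply: connect0.
have [i Ti] := win_ex P2 v; have li := wstep_lt' P2 Ti sb.
have [|d sd r] := IH i.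
  rewrite ltnS in lb; apply: leq_trans lb; apply: proper_card; apply/properP; split.
    by apply/subsetP=> x; rewrite !inE => l; apply: (wlt_trans P2) l li.
  by exists i; rewrite ?inE // (wlt_irr P2).
by exists d => //; apply: connect_trans r (wstep_reach Ti sb).
Qed.

Lemma sink_ex a : exists2 c, wT c = None & wreach a c.
Proof.
have [n] := ubnP #|[pred x | wlt a x]|; elim: n a => // n IH a la.
case ta: (wT a) => [v|]; last by exists a; rewrite ?ta //; apply: connect0.
have [o So] := wout_ex P1 v; have lo := wstep_lt' P1 ta So.
have [|c tc r] := IH o.
  rewrite ltnS in la; apply: leq_trans la; apply: proper_card; apply/properP; split.
    by apply/subsetP=> x; rewrite !inE => l; apply: (wlt_trans P1) lo l.
  by exists o; rewrite ?inE // (wlt_irr P1).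
by exists c => //; apply: connect_trans (wstep_reach ta So) r.
Qed.

Lemma k2_gt0 b : wS b <> None -> 0 < k2 b.
Proof.
move=> sb; have [d sd r] := source_ex b.
rewrite -has_count; apply/hasP; exists d; first by rewrite mem_ins2 sd.
by case: (wreach_lt P2 r) => // db; case: sb; rewrite -db.
Qed.

Lemma rank_edge2 b : graft_rank (edge2 b) = rank2 b.
Proof.
case sb: (wS b) => [v|]; first by have [|p ->] := @edge2_inner b; rewrite ?sb.
have [a g] := glued_r sb; have [t0 _ _ _] := glued_free g.
have /edge12 <- := g; rewrite /= /rank1 /rank2 t0 sb /=.
by rewrite -/(k1 a) (glued_count g).
Qed.

Lemma edge2_lt' b b' : wlt b b' -> graft_lt (edge2 b) (edge2 b').
Proof.
move=> l; have [c1 c2] := count_lt P2 ins2 l; rewrite mem_ins2 in c2.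
rewrite /graft_lt !rank_edge2 /rank2 -/(k2 b) -/(k2 b') in c1 c2 *.
case: eqP c2 => [_ /(_ isT) c2|sb _].
  by apply/orP; left; case: ifP; lia.
have pb := k2_gt0 sb.
have [p ->] := edge2_inner sb.
case: eqP => [_|sb']; first by apply/orP; left; lia.
have [p' ->] := edge2_inner sb'; rewrite /= l andbT orbC -leq_eqVlt; lia.
Qed.

Lemma graft_lt_irr : irreflexive graft_lt.
Proof.
by move=> [a|b]; rewrite /graft_lt ltnn eqxx /= ?(wlt_irr P1) ?(wlt_irr P2).
Qed.

Lemma graft_lt_trans : transitive graft_lt.
Proof.
move=> y x z; rewrite /graft_lt => /orP[l|/andP[/eqP e l]] /orP[l'|/andP[/eqP e' l']].
- by rewrite (ltn_trans l l').
- by rewrite -e' l.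
- by rewrite e l'.
rewrite e e' eqxx /=; apply/orP; right.
case: x y z l l' {e e'} => [x|x] [y|y] [z|z] //; [exact: (wlt_trans P1)|exact: (wlt_trans P2)].
Qed.

Lemma graft_lt_total x y : x != y -> graft_lt x y || graft_lt y x.
Proof.
rewrite /graft_lt; case: (ltngtP (graft_rank x) (graft_rank y)) => //= e.
case: x y e => [a|b] [a'|b'] /=.
- by rewrite (inj_eq inl_inj) => _; apply: (wlt_total P1).
- by rewrite /rank1 /rank2 (negPf (valP b')); case: eqP => _ /=; lia.
- by rewrite /rank1 /rank2 (negPf (valP b)); case: eqP => _ /=; lia.
- by rewrite (inj_eq inr_inj) -val_eqE => _; apply: (wlt_total P2).
Qed.

Lemma graft_lt_asym x y : graft_lt x y -> graft_lt y x = false.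
Proof. by move=> l; apply/negP=> l'; have := graft_lt_trans l l'; rewrite graft_lt_irr. Qed.

Lemma edge1_lt a a' : graft_lt (edge1 a) (edge1 a') = wlt a a'.
Proof.
apply/idP/idP=> [l|]; last exact: edge1_lt'.
apply/negPn/negP=> /(wnlt P1)[e|/edge1_lt' l']; first by rewrite e graft_lt_irr in l.
by rewrite (graft_lt_asym l') in l.
Qed.

Lemma edge2_lt b b' : graft_lt (edge2 b) (edge2 b') = wlt b b'.
Proof.
apply/idP/idP=> [l|]; last exact: edge2_lt'.
apply/negPn/negP=> /(wnlt P2)[e|/edge2_lt' l']; first by rewrite e graft_lt_irr in l.
by rewrite (graft_lt_asym l') in l.
Qed.

Definition wle (Z : wiring D) (e e' : wE Z) := e = e' \/ wlt e e'.

Lemma wle_lt_trans (Z : wiring D) (PZ : planar_order Z) (e f g : wE Z) :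
  wle e f -> wlt f g -> wlt e g.
Proof. by case=> [->//|]; apply: (wlt_trans PZ). Qed.

Lemma wlt_le_trans (Z : wiring D) (PZ : planar_order Z) (e f g : wE Z) :
  wlt e f -> wle f g -> wlt e g.
Proof. by move=> l [<-//|]; apply: (wlt_trans PZ). Qed.

(** If an edge of the first graph precedes one of the second, then there is a
    grafted edge between them: blocks of the two graphs alternate with grafted
    edges in the order A_1, e_1, B_1, ..., A_n, e_n, B_n. The witness is [a] or [b]
    if it is grafted, and otherwise the grafted edge of the group of [a]. *)
Lemma graft_between a b : graft_lt (edge1 a) (edge2 b) ->
  exists c d, [/\ glued c d, wle a c & wle d b].
Proof.
move=> l; case ta: (wT a) => [v|]; last first.
  have [d g] := glued_l ta; exists a, d; split=> //; first by left.
  by right; rewrite -edge2_lt; have /edge12 <- := g.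
case sb: (wS b) => [u|]; last first.
  have [c g] := glued_r sb; exists c, b; split=> //; last by left.
  by right; rewrite -edge1_lt; have /edge12 -> := g.
have pb : 0 < k2 b by apply: k2_gt0; rewrite sb.
have lk : k1 a < k2 b.
  move: l; rewrite /graft_lt rank_edge2 /= /rank1 /rank2 ta sb /= -/(k1 a) -/(k2 b).
  case/orP; first by lia.
  by have [|p ->] := @edge2_inner b; rewrite ?sb // andbF.
have li : k1 a < size ins2 by apply: leq_trans lk (count_size _ _).
have lo : k1 a < size outs1 by rewrite size_graft.
set c := nth a outs1 (k1 a); set d := nth b ins2 (k1 a).
have ic : index c outs1 = k1 a by rewrite index_uniq ?uniq_outs1.
have g : glued c d.
  rewrite /glued /partner ic; have := onthTE ins2 (k1 a); rewrite li.
  by case E: (onth _ _) => [d'|] // _; rewrite /d (onth_nth b _ _ _ E).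
have ck : k1 c = k1 a.
  rewrite -ic /k1 count_index //; first exact: (wlt_irr P1).
  - exact: (wlt_asym P1).
  - exact/pairwise_filter/(wedges_sorted P1).
  - by rewrite mem_nth.
exists c, d; split=> //.
  case: (boolP (wlt c a)) => [lca|/(wnlt P1)[->|]]; [|by left|by right].
  have [_] := count_lt P1 outs1 lca; rewrite mem_nth // -/(k1 c) -/(k1 a) ck ltnn.
  by move/(_ isT).
case: (boolP (wlt d b)) => [|/(wnlt P2)[->|lbd]]; [by right|by left|].
have [] := count_lt P2 ins2 lbd; rewrite -/(k2 b) -/(k2 d) -(glued_count g) ck.
by rewrite leqNgt lk.
Qed.

(** The grafted edge can be chosen such that [b] is reached from it. A source-free
    edge [d0] from which [b] is reached does if it comes late enough; otherwise
    the given edge lies between [d0] and [b], cannot be reached from [d0], and so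
    reaches [b]. *)
Lemma graft_between_r a b : graft_lt (edge1 a) (edge2 b) ->
  exists c d, [/\ glued c d, wle a c & wreach d b].
Proof.
move=> /graft_between[c [d [g ac db]]]; have [d0 s0 r0] := source_ex b.
have [_ sd _ _] := glued_free g.
case: (boolP (wlt d0 d)) => [l|/(wnlt P2)].
  exists c, d; split=> //; case: db => [->|db]; first exact: connect0.
  case: (wbetween P2 r0 l db) => // r.
  have [|u [i [_]]] := wreach_to r; last by rewrite sd.
  by move=> e; rewrite e (wlt_irr P2) in l.
have [c0 g0] := glued_r s0; case=> [e|l]; exists c0, d0; split=> //.
  by rewrite e in g0; rewrite (glued_inj g0 g).
have lc : wlt c c0.
  by rewrite -edge1_lt; have /edge12 -> := g; have /edge12 -> := g0; rewrite edge2_lt.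
by right; apply: (wle_lt_trans P1 ac lc).
Qed.

(** The dual of [graft_between_r], for an edge reached from [a]. *)
Lemma graft_between_l a b : graft_lt (edge1 a) (edge2 b) ->
  exists c d, [/\ glued c d, wreach a c & wle d b].
Proof.
move=> /graft_between[c [d [g ac db]]]; have [c0 t0 r0] := sink_ex a.
have [tc _ _ _] := glued_free g.
case: (boolP (wlt c c0)) => [l|/(wnlt P1)].
  exists c, d; split=> //; case: ac => [->|ac]; first exact: connect0.
  case: (wbetween P1 r0 ac l) => // r.
  have [|u [i []]] := wreach_from r; last by rewrite tc.
  by move=> e; rewrite e (wlt_irr P1) in l.
have [d0 g0] := glued_l t0; case=> [e|l]; exists c0, d0; split=> //.
  by rewrite -e in g0; rewrite (glued_fun g0 g).
have ld : wlt d0 d.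
  by rewrite -edge2_lt; have /edge12 <- := g; have /edge12 <- := g0; rewrite edge1_lt.
by right; apply: (wlt_le_trans P2 ld db).
Qed.

End Graft.

(** * The grafted wiring is planar, and its code is the blend of the codes *)

Lemma pairwise_pmap (A B : Type) (f : A -> option B) (r : rel A) (r' : rel B) s :
  (forall x y u v, f x = Some u -> f y = Some v -> r x y -> r' u v) ->
  pairwise r s -> pairwise r' (pmap f s).
Proof.
move=> H; elim: s => //= x s IH /andP[al ps].
case fx: (f x) => [u|] /=; last exact: IH.
rewrite IH // andbT; elim: s al {IH ps} => //= y s IH /andP[rxy al].
case fy: (f y) => [v|] /=; last exact: IH.
by rewrite (H _ _ _ _ fx fy rxy) IH.
Qed.

Section GraftPlanar.
Variables (D : tscheme) (X1 X2 : wiring D).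
Hypotheses (P1 : planar X1) (P2 : planar X2).
Hypothesis colE : map wcol (woutputs X1) = map wcol (winputs X2).
Implicit Types (a : wE X1) (b : wE X2).
Notation X := (graft_wiring X1 X2).
Notation edge1 := (@edge1 D X1 X2).
Notation edge2 := (edge2 colE).
Notation glued := (@glued D X1 X2).
Implicit Types x y z : wE X.
Let e12 a b := @edge12 D X1 X2 colE a b.
Let l1 a a' : wlt (edge1 a) (edge1 a') = wlt a a' := edge1_lt P1 P2 a a'.
Let l2 b b' : wlt (edge2 b) (edge2 b') = wlt b b' := edge2_lt P1 P2 colE b b'.

Lemma graft_step x y : wstep x y ->
  (exists a a', [/\ x = edge1 a, y = edge1 a' & wstep a a']) \/
  (exists b b', [/\ x = edge2 b, y = edge2 b' & wstep b b']).
Proof.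
case/wstepP=> -[v|v] T S; [left|right].
  have [a -> Ta] := wT_inl T; have [a' -> Sa] := wS_inl S.
  by exists a, a'; split=> //; apply/wstepP; exists v.
have [b -> Tb] := wT_inr colE T; have [b' -> Sb] := wS_inr colE S.
by exists b, b'; split=> //; apply/wstepP; exists v.
Qed.

Lemma graft_reach1 a a' : wreach a a' -> wreach (edge1 a) (edge1 a').
Proof.
apply: connect_homo => x y /wstepP[v T S]; apply/wstepP; exists (inl v).
  by rewrite /= T.
by rewrite /= S.
Qed.

Lemma graft_reach2 b b' : wreach b b' -> wreach (edge2 b) (edge2 b').
Proof.
apply: connect_homo => x y /wstepP[v T S]; apply/wstepP; exists (inr v).
  by rewrite wT_edge2 T.
by rewrite wS_edge2 S.
Qed.

Lemma graft_reach12 a c d b : wreach a c -> glued c d -> wreach d b ->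
  wreach (edge1 a) (edge2 b).
Proof.
move=> /graft_reach1 r /e12 g /graft_reach2 r'; rewrite g in r.
exact: connect_trans r r'.
Qed.

Lemma graft_reach x y : wreach x y ->
  [\/ exists a a', [/\ x = edge1 a, y = edge1 a' & wreach a a'],
      exists b b', [/\ x = edge2 b, y = edge2 b' & wreach b b'] |
      exists a c d b, [/\ x = edge1 a, y = edge2 b, wreach a c, glued c d & wreach d b]].
Proof.
move=> /connectP[p]; elim: p x => [|f p IH] x /=.
  move=> _ ->; case: (edgeP colE x) => [[a ->]|[b _ ->]]; [constructor 1|constructor 2].
    by exists a, a; split=> //; apply: connect0.
  by exists b, b; split=> //; apply: connect0.
move=> /andP[/graft_step s pp] ee; have := IH _ pp ee => {IH pp ee p} r.
case: s => [[a [a' [xa fa /connect1 s]]]|[b [b' [xb fb s]]]].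
  case: r => [[c [c' [fc ec r]]]|[b [b' [fb eb r]]]|[c [c' [d [b [fc eb r g r']]]]]].
  - constructor 1; exists a, c'; split=> //; move: fc; rewrite fa => -[?]; subst c.
    exact: connect_trans s r.
  - have g : glued a' b by apply/e12; rewrite -fa fb.
    by constructor 3; exists a, a', b, b'.
  - constructor 3; exists a, c', d, b; split=> //; move: fc; rewrite fa => -[?]; subst c.
    exact: connect_trans s r.
have no c : f = edge1 c -> False.
  rewrite fb => /esym/e12/(glued_free colE)[_ sb' _ _].
  by case/wstepP: s => v _; rewrite sb'.
case: r => [[c [c' [fc _ _]]]|[d [d' [fd eb r]]]|[c [c' [d [b0 [fc _ _ _ _]]]]]];
  [by case: (no c)| |by case: (no c)].
constructor 2; exists b, d'; split=> //; move: fd; rewrite fb => /edge2_inj ?; subst d.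
exact: connect_trans (connect1 s) r.
Qed.

(** Betweenness for the composite. If the three edges lie in the same graph, it is
    betweenness there. Otherwise a path or a comparison crosses from the first
    graph to the second; it does so at a grafted edge, which is an output of the
    first graph and an input of the second, and betweenness is applied in one of
    the graphs with this edge as an end. *)
Lemma graft_between_reach x y z : wreach x z -> wlt x y -> wlt y z ->
  wreach x y \/ wreach y z.
Proof.
move=> /graft_reach[[a [a' [-> -> r]]]|[b [b' [-> -> r]]]|[a [c [d [b [-> -> r g r']]]]]];
  case: (edgeP colE y) => [[e ->]|[e _ ->]] lxy lyz.
- rewrite !l1 in lxy lyz.
  by case: (wbetween P1 r lxy lyz) => /graft_reach1; auto.
- left; have [c [d [g ac rd]]] := graft_between_r P1 P2 lxy.
  apply: (graft_reach12 _ g rd); have [tc _ _ _] := glued_free colE g.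
  have lca : wlt c a'.
    rewrite -l1; have /e12 -> := g; case: (wreach_lt P2 rd) => [->//|].
    by rewrite -l2 => l; apply: (graft_lt_trans P1 P2) l lyz.
  case: ac => [->|ac]; first exact: connect0.
  case: (wbetween P1 r ac lca) => // r2.
  have [|u [i [Tc _ _]]] := wreach_from r2; last by rewrite tc in Tc.
  by move=> e'; rewrite e' (wlt_irr P1) in lca.
- right; have [c [d [g rc db]]] := graft_between_l P1 P2 lyz.
  apply: (graft_reach12 rc g); have [_ sd _ _] := glued_free colE g.
  have lbd : wlt b d.
    rewrite -l2; have /e12 <- := g; case: (wreach_lt P1 rc) => [<-//|].
    by rewrite -l1 => l; apply: (graft_lt_trans P1 P2) lxy l.
  case: db => [->|db]; first exact: connect0.
  case: (wbetween P2 r lbd db) => // r2.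
  have [|u [i [_ Sd _]]] := wreach_to r2; last by rewrite sd in Sd.
  by move=> e'; rewrite e' (wlt_irr P2) in lbd.
- rewrite !l2 in lxy lyz.
  by case: (wbetween P2 r lxy lyz) => /graft_reach2; auto.
- rewrite l1 in lxy; have [tc sd _ _] := glued_free colE g.
  case: (boolP (wlt e c)) => [lec|/(wnlt P1)].
    case: (wbetween P1 r lxy lec) => [/graft_reach1|r2]; first by left.
    by right; exact: (graft_reach12 r2 g r').
  case=> [->|lce]; first by left; apply: graft_reach1.
  right; have [c' [d' [g' rc' db]]] := graft_between_l P1 P2 lyz.
  apply: (graft_reach12 rc' g'); have [_ sd' _ _] := glued_free colE g'.
  have ldd : wlt d d'.
    rewrite -l2; have /e12 <- := g; have /e12 <- := g'; rewrite l1.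
    by case: (wreach_lt P1 rc') => [<-//|]; apply: (wlt_trans P1).
  case: db => [->|db]; first exact: connect0.
  case: (wbetween P2 r' ldd db) => // r2.
  have [|u [i [_ Sd _]]] := wreach_to r2; last by rewrite sd' in Sd.
  by move=> e'; rewrite e' (wlt_irr P2) in ldd.
- rewrite l2 in lyz; have [tc sd _ _] := glued_free colE g.
  case: (boolP (wlt d e)) => [lde|/(wnlt P2)].
    case: (wbetween P2 r' lde lyz) => [r2|/graft_reach2]; last by right.
    by left; exact: (graft_reach12 r g r2).
  case=> [<-|led]; first by right; apply: graft_reach2.
  left; have [c' [d' [g' ac' rd']]] := graft_between_r P1 P2 lxy.
  apply: (graft_reach12 _ g' rd'); have [tc' _ _ _] := glued_free colE g'.
  have lcc : wlt c' c.
    rewrite -l1; have /e12 -> := g; have /e12 -> := g'; rewrite l2.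
    by case: (wreach_lt P2 rd') => [->//|l]; apply: (wlt_trans P2) l led.
  case: ac' => [->|ac']; first exact: connect0.
  case: (wbetween P1 r ac' lcc) => // r2.
  have [|u [i [Tc _ _]]] := wreach_from r2; last by rewrite tc' in Tc.
  by move=> e'; rewrite e' (wlt_irr P1) in lcc.
Qed.

Lemma graft_planar_order : planar_order X.
Proof.
split.
- exact: graft_lt_irr.
- exact: graft_lt_trans.
- exact: graft_lt_total.
- case=> v; [have [e E] := win_ex P1 v|have [e E] := win_ex P2 v].
    by exists (edge1 e); rewrite /= E.
  by exists (edge2 e); rewrite wT_edge2 E.
- case=> v; [have [e E] := wout_ex P1 v|have [e E] := wout_ex P2 v].
    by exists (edge1 e); rewrite /= E.
  by exists (edge2 e); rewrite wS_edge2 E.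
- move=> x y /graft_step[[a [a' [-> -> s]]]|[b [b' [-> -> s]]]].
    by rewrite l1 (wstep_lt P1).
  by rewrite l2 (wstep_lt P2).
- by move=> x y z; apply: graft_between_reach.
Qed.

Let PX := graft_planar_order.

Lemma pairwise_edge1 (s : seq (wE X1)) : pairwise wlt s -> pairwise (@wlt D X) (map edge1 s).
Proof. by rewrite pairwise_map; apply: sub_pairwise => a a'; rewrite -l1. Qed.

Lemma pairwise_edge2 (s : seq (wE X2)) : pairwise wlt s -> pairwise (@wlt D X) (map edge2 s).
Proof. by rewrite pairwise_map; apply: sub_pairwise => b b'; rewrite -l2. Qed.

Lemma filter_edge1 (p : pred (wE X)) (q : pred (wE X1)) :
  (forall x, p x -> exists a, x = edge1 a) -> (forall a, p (edge1 a) = q a) ->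
  filter p (wedges X) = map edge1 (filter q (wedges X1)).
Proof.
move=> pe pq; apply: (sorted_uniq_eq PX).
- exact/pairwise_filter/(wedges_sorted PX).
- exact/pairwise_edge1/pairwise_filter/(wedges_sorted P1).
- move=> x; rewrite mem_filter mem_wedges andbT; apply/idP/mapP=> [px|[a]].
    have [a xa] := pe _ px; exists a => //.
    by rewrite mem_filter mem_wedges andbT -pq -xa.
  by rewrite mem_filter => /andP[qa _] ->; rewrite pq.
Qed.

Lemma filter_edge2 (p : pred (wE X)) (q : pred (wE X2)) :
  (forall x, p x -> exists b, x = edge2 b) -> (forall b, p (edge2 b) = q b) ->
  filter p (wedges X) = map edge2 (filter q (wedges X2)).
Proof.
move=> pe pq; apply: (sorted_uniq_eq PX).
- exact/pairwise_filter/(wedges_sorted PX).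
- exact/pairwise_edge2/pairwise_filter/(wedges_sorted P2).
- move=> x; rewrite mem_filter mem_wedges andbT; apply/idP/mapP=> [px|[b]].
    have [b xb] := pe _ px; exists b => //.
    by rewrite mem_filter mem_wedges andbT -pq -xb.
  by rewrite mem_filter => /andP[qb _] ->; rewrite pq.
Qed.

Lemma wT_edge1E a v : (wT (edge1 a) == Some (inl v)) = (wT a == Some v).
Proof.
apply/eqP/eqP=> [/wT_inl[a' [->]]|/wT_edge1 ->] //.
Qed.

Lemma wT_edge2E b v : (wT (edge2 b) == Some (inr v)) = (wT b == Some v).
Proof. by rewrite wT_edge2 omap_eq //; apply: inr_inj. Qed.

Lemma wS_edge1E a v : (wS (edge1 a) == Some (inl v)) = (wS a == Some v).
Proof. by rewrite wS_edge1 omap_eq //; apply: inl_inj. Qed.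

Lemma wS_edge2E b v : (wS (edge2 b) == Some (inr v)) = (wS b == Some v).
Proof.
apply/eqP/eqP=> [/(wS_inr colE)[b' /edge2_inj ->]|sb] //.
by rewrite wS_edge2 sb.
Qed.

Lemma graft_planar : planar X.
Proof.
have colP (s : seq (wE X2)) : map wcol (map edge2 s) = map wcol s.
  by rewrite -map_comp; apply: eq_map => b /=; apply: (wcol_edge2 colE).
split; first exact: PX; case=> v /=.
- rewrite /wins (filter_edge1 (q := fun a => wT a == Some v)) => [|x|a].
  + by rewrite -map_comp (wdec_src P1).
  + by move/eqP/wT_inl => [a -> _]; exists a.
  + exact: wT_edge1E.
- rewrite /wins (filter_edge2 (q := fun b => wT b == Some v)) => [|x|b].
  + by rewrite colP (wdec_src P2).
  + by move/eqP/(wT_inr colE) => [b -> _]; exists b.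
  + exact: wT_edge2E.
- rewrite /wouts (filter_edge1 (q := fun a => wS a == Some v)) => [|x|a].
  + by rewrite -map_comp (wdec_tgt P1).
  + by move/eqP/wS_inl => [a -> _]; exists a.
  + exact: wS_edge1E.
- rewrite /wouts (filter_edge2 (q := fun b => wS b == Some v)) => [|x|b].
  + by rewrite colP (wdec_tgt P2).
  + by move/eqP/(wS_inr colE) => [b -> _]; exists b.
  + exact: wS_edge2E.
Qed.

Lemma wlast_edge1 a v : wT a = Some v -> wlast (edge1 a) = wlast a.
Proof.
move=> Ta; have Te := wT_edge1 X2 Ta.
apply/forallP/forallP=> la.
  by move=> a'; have := la (edge1 a'); rewrite Te wT_edge1E l1 Ta.
move=> x; apply/implyP; rewrite Te => /eqP/wT_inl[a' -> Ta'].
by have := la a'; rewrite l1 Ta' Ta eqxx.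
Qed.

Lemma wlast_edge2 b v : wT b = Some v -> wlast (edge2 b) = wlast b.
Proof.
move=> Tb; have Te : wT (edge2 b) = Some (inr v) by rewrite wT_edge2 Tb.
apply/forallP/forallP=> la.
  by move=> b'; have := la (edge2 b'); rewrite Te wT_edge2E l2 Tb.
move=> x; apply/implyP; rewrite Te => /eqP/(wT_inr colE)[b' -> Tb'].
by have := la b'; rewrite l2 Tb' Tb eqxx.
Qed.

Lemma wentry_edge1 a : wT a <> None -> wentry (edge1 a) = wentry a.
Proof.
case Ta: (wT a) => [v|] // _; rewrite /wentry (wT_edge1 X2 Ta) (wlast_edge1 Ta) Ta.
by congr Entry; rewrite wS_edge1; case: (wS a).
Qed.

Lemma stat_edge2 b : stat (wentry (edge2 b)) = stat (wentry b).
Proof.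
by rewrite /wentry wT_edge2; case Tb: (wT b) => [v|] //; rewrite -(wlast_edge2 Tb).
Qed.

Lemma wentry_edge2 b : wS b <> None -> wentry (edge2 b) = wentry b.
Proof.
move=> sb; rewrite [LHS]/wentry -[X in Entry _ _ X]/(stat (wentry (edge2 b))).
by rewrite stat_edge2 (wcol_edge2 colE) wS_edge2 //; congr Entry; case: (wS b).
Qed.

Lemma wentry_glued a b : glued a b -> [/\ wentry a = Entry (wcol a) (wS a == None) Out,
  wentry b = Entry (wcol a) true (stat (wentry b)) &
  wentry (edge1 a) = Entry (wcol a) (wS a == None) (stat (wentry b))].
Proof.
move=> g; have [t0 s0 ce _] := glued_free colE g; have /e12 gE := g; split.
- by rewrite /wentry t0.
- by rewrite {1}/wentry s0 -ce.
- rewrite -stat_edge2 -gE [LHS]/wentry; congr Entry; rewrite wS_edge1; by case: (wS a).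
Qed.

Definition proj1 x : option (wE X1) := if x is inl a then Some a else None.
Notation proj2 := (@proj2 D X1 X2).

Lemma pairwise_proj2 s : pairwise (@wlt D X) s -> pairwise wlt (pmap proj2 s).
Proof.
apply: pairwise_pmap => x y u v /(proj2E colE) -> /(proj2E colE) ->.
by rewrite l2.
Qed.

Lemma wedges_proj1 : pmap proj1 (wedges X) = wedges X1.
Proof.
apply: (sorted_uniq_eq P1).
- have := wedges_sorted PX; apply: pairwise_pmap => -[a|?] [a'|?] // u v [<-] [<-].
  by rewrite -l1.
- exact: (wedges_sorted P1).
- move=> a; rewrite mem_wedges mem_pmap; apply/mapP; exists (edge1 a) => //.
  exact: mem_wedges.
Qed.

Lemma wedges_proj2 : pmap proj2 (wedges X) = wedges X2.
Proof.
apply: (sorted_uniq_eq P2).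
- exact/pairwise_proj2/(wedges_sorted PX).
- exact: (wedges_sorted P2).
- move=> b; rewrite mem_wedges mem_pmap; apply/mapP; exists (edge2 b).
    exact: mem_wedges.
  by rewrite proj2K.
Qed.

(** A suffix of the edges of the composite contains suffixes of the edges of both
    graphs, so the blend is built from its end. The one point to be checked is
    that the second graph is at an input when an edge of the first graph is read
    that is not grafted: by [graft_between] a grafted edge comes before every
    later edge of the second graph. *)
Lemma graft_code : blend (wcode X1) (wcode X2) (wcode X).
Proof.
rewrite /wcode -wedges_proj1 -wedges_proj2.
suff gen Z Y : wedges X = Y ++ Z -> blend (map (@wentry D X1) (pmap proj1 Z))
    (map (@wentry D X2) (pmap proj2 Z)) (map (@wentry D X) Z) by apply: (gen _ [::]).
elim: Z Y => [|z Z IH] Y; first by constructor.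
move=> edgesE; have {IH} B := IH (rcons Y z).
rewrite cat_rcons in B; have {}B := B edgesE.
case: (edgeP colE z) => [[a za]|[b sb zb]]; rewrite ?za ?zb; last first.
  have z1 : proj1 (edge2 b) = None by have [p ->] := edge2_inner colE sb.
  rewrite [pmap proj1 _]/= z1 [pmap proj2 _]/= proj2K /=.
  rewrite (wentry_edge2 sb); apply: BlendR B.
  by rewrite /=; apply/eqP.
case Ta: (wT a) => [v|]; last first.
  have [b g] := glued_l colE Ta; have [ea eb e] := wentry_glued g.
  rewrite [pmap proj2 _]/= [partner _ _ a]g !map_cons e ea eb.
  exact: BlendJ.
have z2 : partner (woutputs X1) (winputs X2) a = None.
  case g: (partner _ _ a) => [b|] //; have [] := glued_free colE g.
  by rewrite Ta.
rewrite [pmap proj2 _]/= z2 /= (wentry_edge1 (a := a)) ?Ta //.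
apply: BlendL B; first by rewrite /wentry Ta; case: ifP.
have ps : pairwise wlt (pmap proj2 Z).
  apply: pairwise_proj2; have := wedges_sorted PX.
  by rewrite edgesE pairwise_cat /= => /and3P[_ _ /andP[]].
case E: (pmap proj2 Z) ps => [|b s] //= /andP[al _].
apply/eqP; case sb: (wS b) => [u|] //; exfalso.
have bZ : edge2 b \in Z.
  have : b \in pmap proj2 Z by rewrite E mem_head.
  by rewrite mem_pmap => /mapP[x xZ /esym/(proj2E colE) <-].
rewrite (mem_suf PX edgesE) za in bZ.
have [c [d [g ac db]]] := graft_between P1 P2 bZ.
have [tc sd _ _] := glued_free colE g.
have lac : wlt a c by case: ac => // ac; rewrite -ac Ta in tc.
have ldb : wlt d b by case: db => // db; rewrite -db sd in sb.
have : d \in pmap proj2 Z.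
  rewrite mem_pmap; apply/mapP; exists (edge1 c); last by rewrite -g.
  by rewrite (mem_suf PX edgesE) za l1.
rewrite E inE => /orP[/eqP e|ds]; first by rewrite e (wlt_irr P2) in ldb.
by have := allP al _ ds; rewrite (wlt_asym P2 ldb).
Qed.

End GraftPlanar.

(** * The composite of diagrams is presented by the grafted wiring *)

Lemma index_map_in (A B : eqType) (f : A -> B) (s : seq A) x :
  {in s &, injective f} -> x \in s -> index (f x) (map f s) = index x s.
Proof.
elim: s => //= y s IH fi; rewrite inE => xs.
have -> : (f y == f x) = (y == x).
  apply/eqP/eqP=> [|-> //]; apply: fi; rewrite inE ?eqxx //.
case: eqVneq => // n; rewrite eq_sym (negPf n) /= in xs; congr S.
by apply: IH => // u v us vs; apply: fi; rewrite inE ?us ?vs orbT.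
Qed.

Section CompWired.
Variables (D : tscheme) (G1 G2 : prediagram D) (X1 X2 : wiring D).
Variables (phi1 : he G1 -> wE X1) (phi2 : he G2 -> wE X2).
Hypotheses (W1 : wired phi1) (W2 : wired phi2) (P1 : planar X1) (P2 : planar X2).
Hypothesis colE : map wcol (woutputs X1) = map wcol (winputs X2).
Implicit Types (h : he G1) (k : he G2).
Notation G := (tensor_diagram G1 G2).
Notation X := (graft_wiring X1 X2).
Notation edge1 := (@edge1 D X1 X2).
Notation edge2 := (edge2 colE).
Notation glued := (@glued D X1 X2).
Notation mate := (@mate G1 G2).
Notation kept := (@kept G1 G2).
Notation graft_sigma := (@graft_sigma G1 G2).
Notation inL := (inl : he G1 -> he G).
Notation inR := (inr : he G2 -> he G).

Let WT := tensor_wired W1 W2.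
Let PT : planar_order _ := tensor_planar_order P1 P2.

(** Deleted half-edges are included, so that [mate] and [sigma], which may lead to
    them, can be seen to preserve the edge of the composite. *)
Definition comp_edge0 (x : he G) : wE X :=
  match x with inl h => edge1 (phi1 h) | inr k => edge2 (phi2 k) end.

Lemma mem_outs h : (h \in outs G1) = ~~ sgn h && (wT (phi1 h) == None).
Proof.
rewrite mem_sort mem_enum inE (leg_wired W1 P1) andbC.
by case: (sgn h) => //=; case: (wT _).
Qed.

Lemma mem_ins k : (k \in ins G2) = sgn k && (wS (phi2 k) == None).
Proof.
rewrite mem_sort mem_enum inE (leg_wired W2 P2) andbC.
by case: (sgn k) => //=; case: (wS _).
Qed.

Lemma index_outs h : h \in outs G1 -> index h (outs G1) = index (phi1 h) (woutputs X1).
Proof.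
move=> ho; rewrite -(outs_wired W1 P1) index_map_in // => x y.
rewrite !mem_outs => /andP[/negPf sx _] /andP[/negPf sy _] e.
by apply: (wired_inj W1) => //; rewrite sx sy.
Qed.

Lemma index_ins k : k \in ins G2 -> index k (ins G2) = index (phi2 k) (winputs X2).
Proof.
move=> ho; rewrite -(ins_wired W2 P2) index_map_in // => x y.
rewrite !mem_ins => /andP[sx _] /andP[sy _] e.
by apply: (wired_inj W2) => //; rewrite sx sy.
Qed.

Lemma size_legs : size (outs G1) = size (ins G2).
Proof.
rewrite -(size_map phi1) (outs_wired W1 P1) (size_graft colE).
by rewrite -(ins_wired W2 P2) size_map.
Qed.

Lemma mate_inl h y : mate (inL h) = Some y ->
  exists k, [/\ y = inR k, sgn h = false, sgn k & glued (phi1 h) (phi2 k)].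
Proof.
rewrite /=; case E: (onth _ _) => [k|] // [<-]; exists k.
have li : index h (outs G1) < size (ins G2) by rewrite -onthTE E.
have ho : h \in outs G1 by rewrite -index_mem size_legs.
have kI : k \in ins G2 by rewrite -(onth_nth k _ _ _ E) mem_nth.
have := ho; have := kI; rewrite mem_ins mem_outs => /andP[sk _] /andP[/negPf sh _].
split=> //; rewrite /glued /partner -index_outs // -(ins_wired W2 P2).
by rewrite onth_map E.
Qed.

Lemma mate_inr k y : mate (inR k) = Some y ->
  exists h, [/\ y = inL h, sgn h = false, sgn k & glued (phi1 h) (phi2 k)].
Proof.
rewrite /=; case E: (onth _ _) => [h|] // [<-]; exists h.
have li : index k (ins G2) < size (outs G1) by rewrite -onthTE E.
have kI : k \in ins G2 by rewrite -index_mem -size_legs.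
have ho : h \in outs G1 by rewrite -(onth_nth h _ _ _ E) mem_nth.
have := ho; have := kI; rewrite mem_ins mem_outs => /andP[sk _] /andP[/negPf sh _].
split=> //; apply/(gluedC colE); rewrite /partner -index_ins // -(outs_wired W1 P1).
by rewrite onth_map E.
Qed.

Lemma mate_inl_ex h : sgn h = false -> wT (phi1 h) = None ->
  exists k, [/\ mate (inL h) = Some (inR k), sgn k & glued (phi1 h) (phi2 k)].
Proof.
move=> sh th; have ho : h \in outs G1 by rewrite mem_outs sh th.
case E: (mate (inL h)) => [y|].
  by have [k [-> _ sk g]] := mate_inl E; exists k.
move: E => /=; have := onthTE (ins G2) (index h (outs G1)).
by rewrite -size_legs index_mem ho; case: (onth _ _).
Qed.

Lemma mate_inr_ex k : sgn k -> wS (phi2 k) = None ->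
  exists h, [/\ mate (inR k) = Some (inL h), sgn h = false & glued (phi1 h) (phi2 k)].
Proof.
move=> sk sh; have kI : k \in ins G2 by rewrite mem_ins sk sh.
case E: (mate (inR k)) => [y|].
  by have [h [-> sh' _ g]] := mate_inr E; exists h.
move: E => /=; have := onthTE (outs G1) (index k (ins G2)).
by rewrite size_legs index_mem kI; case: (onth _ _).
Qed.

Lemma mate_inl_none h : sgn h || (wT (phi1 h) != None) -> mate (inL h) = None.
Proof.
case E: (mate _) => [y|] //; have [k [_ -> _ g]] := mate_inl E.
by have [-> _ _ _] := glued_free colE g.
Qed.

Lemma mate_inr_none k : ~~ sgn k || (wS (phi2 k) != None) -> mate (inR k) = None.
Proof.
case E: (mate _) => [y|] //; have [h [_ _ -> g]] := mate_inr E.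
by have [_ -> _ _] := glued_free colE g.
Qed.

Lemma virtual_inl h : virtual (inL h) = (wT (phi1 h) == None) && (wS (phi1 h) == None).
Proof.
by rewrite (virtual_wired WT PT) /=; case: (wT _); case: (wS _).
Qed.

Lemma virtual_inr k : virtual (inR k) = (wT (phi2 k) == None) && (wS (phi2 k) == None).
Proof.
by rewrite (virtual_wired WT PT) /=; case: (wT _); case: (wS _).
Qed.

Lemma half_inl h : if sgn h then wT (phi1 h) = None -> wS (phi1 h) = None
  else wS (phi1 h) = None -> wT (phi1 h) = None.
Proof.
have := wired_half_he W1 h; rewrite /whalf /wend.
by case: (sgn h); case: (wT _); case: (wS _).
Qed.

Lemma half_inr k : if sgn k then wT (phi2 k) = None -> wS (phi2 k) = None
  else wS (phi2 k) = None -> wT (phi2 k) = None.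
Proof.
have := wired_half_he W2 k; rewrite /whalf /wend.
by case: (sgn k); case: (wT _); case: (wS _).
Qed.

Lemma sgn_sigma_virtual1 h : virtual (inL h) -> sgn (sigma h) = ~~ sgn h.
Proof.
rewrite virtual_inl => /andP[/eqP t /eqP s]; apply: (sgn_sigma_wired W1).
by rewrite (sigma_neq W1) /whalf /wend; case: (sgn h); rewrite /= ?t ?s.
Qed.

Lemma sgn_sigma_virtual2 k : virtual (inR k) -> sgn (sigma k) = ~~ sgn k.
Proof.
rewrite virtual_inr => /andP[/eqP t /eqP s]; apply: (sgn_sigma_wired W2).
by rewrite (sigma_neq W2) /whalf /wend; case: (sgn k); rewrite /= ?t ?s.
Qed.

Lemma kept_inl h : kept (inL h) =
  ~~ virtual (inL h) || (sgn h && (wT (edge1 (phi1 h)) == None)).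
Proof.
rewrite /Defs.kept; case vh: (virtual (inL h)) => //=.
have := vh; rewrite virtual_inl => /andP[/eqP t /eqP s]; rewrite t.
case sh: (sgn h) => /=; last first.
  by have [k [/= -> _ _]] := mate_inl_ex sh t.
have /= -> := @mate_inl_none h _; rewrite ?sh //=.
have ss : sgn (sigma h) = false by rewrite sgn_sigma_virtual1 ?sh.
have ts : wT (phi1 (sigma h)) = None by rewrite (wired_sigma W1).
have [k [/= -> sk g]] := mate_inl_ex ss ts.
rewrite (wired_sigma W1) in g; rewrite g /= [virtual _]virtual_inr.
have [_ -> _ _] := glued_free colE g.
by rewrite andbT negbK; case: (wT _).
Qed.

Lemma kept_inr k : kept (inR k) =
  ~~ virtual (inR k) || (~~ sgn k && (wS (edge2 (phi2 k)) == None)).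
Proof.
rewrite /Defs.kept; case vh: (virtual (inR k)) => //=.
have := vh; rewrite virtual_inr => /andP[/eqP t /eqP s].
case sk: (sgn k) => /=.
  by have [h [/= -> _ _]] := mate_inr_ex sk s.
have /= -> := @mate_inr_none k _; rewrite ?sk //=.
have ss : sgn (sigma k) by rewrite sgn_sigma_virtual2 ?sk.
have ts : wS (phi2 (sigma k)) = None by rewrite (wired_sigma W2).
have [h [/= -> sh g]] := mate_inr_ex ss ts.
rewrite (wired_sigma W2) in g; rewrite [virtual _]virtual_inl.
have [-> _ _ _] := glued_free colE g; have /(edge12 colE) <- := g.
by rewrite /= negbK; case: (wS _).
Qed.

(** This fails for a deleted half-edge, which was virtual: by grafting, its edge
    may be attached to a real vertex. *)
Lemma kept_end (x : he G) : kept x -> wend (comp_edge0 x) (sgn x)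
  = wend (tensor_edge phi1 phi2 x) (sgn x).
Proof.
case: x => [h|k].
  rewrite kept_inl virtual_inl /wend /=.
  have := half_inl h; case: (sgn h) => //=.
  case T: (wT (phi1 h)) => [v|] //= => /(_ erefl) -> /=.
  by move/eqP.
rewrite kept_inr virtual_inr /wend [comp_edge0 _]/= wT_edge2.
have := half_inr k; rewrite [sgn (inR k)]/=; case: (sgn k) => // hk.
case S: (wS (phi2 k)) => [v|]; first by move=> _; rewrite wS_edge2 S /= ?S.
by rewrite hk // !eqxx orFb andTb => /eqP ->; rewrite /= S.
Qed.

Lemma mate_edge x y : mate x = Some y -> comp_edge0 y = comp_edge0 x.
Proof.
case: x => [h|k].
  by move/mate_inl=> [k [-> _ _ /(edge12 colE) /= ->]].
by move/mate_inr=> [h [-> _ _ /(edge12 colE) /= ->]].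
Qed.

Lemma sigma_edge (x : he G) : comp_edge0 (sigma x) = comp_edge0 x.
Proof. by case: x => x /=; rewrite ?(wired_sigma W1) ?(wired_sigma W2). Qed.

Lemma graft_sigma_edge x : comp_edge0 (graft_sigma x) = comp_edge0 x.
Proof.
rewrite /Defs.graft_sigma; case E: (mate x) => [y|].
  by case: ifP => // _; apply: mate_edge.
case E': (mate (sigma x)) => [y|]; rewrite sigma_edge //.
by rewrite (mate_edge E') sigma_edge.
Qed.

(** Two edges that are grafted may have four half-edges, but at most one of each
    sign is kept. If both edges are real legs, their half-edges have different
    signs. If exactly one is virtual, both its half-edges are deleted. If both
    are virtual, the grafted half-edges are deleted, and the two that remain have
    different signs. *)
Lemma comp_inj (x y : he G) : kept x -> kept y -> comp_edge0 x = comp_edge0 y ->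
  sgn x = sgn y -> x = y.
Proof.
have cross h k : kept (inL h) -> kept (inR k) -> glued (phi1 h) (phi2 k) ->
    sgn h = sgn k -> False.
  rewrite kept_inl kept_inr virtual_inl virtual_inr => kh kk g s.
  have [t0 s0 _ _] := glued_free colE g; have /(edge12 colE) e := g.
  rewrite e wT_edge2 t0 in kh; rewrite -e wS_edge1 s0 in kk.
  have := half_inl h; have := half_inr k; move: kh kk; rewrite s t0 s0.
  case: (sgn k) => /=; case: (wT (phi2 k)) => [?|] //=;
    case: (wS (phi1 h)) => [?|] //=; try by move=> _ _ _ /(_ erefl).
  by move=> _ _ /(_ erefl).
case: x y => [h|k] [h'|k'] kx ky /=.
- by move=> [e] s; rewrite (wired_inj W1 e s).
- by move=> /(edge12 colE) g s; case: (cross _ _ kx ky g).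
- by move=> /esym/(edge12 colE) g s; case: (cross _ _ ky kx g).
- by move=> /edge2_inj e s; rewrite (wired_inj W2 e s).
Qed.

(** The definition of [graft_sigma] by mates agrees with the presentation by edges
    and signs: the two half-edges of an edge of the composite are related by
    [sigma], or by grafting, or by [sigma] and grafting in the case of a virtual
    edge. *)
Lemma graft_sigma_other (x y : he G) : kept x -> kept y ->
  comp_edge0 x = comp_edge0 y -> sgn x <> sgn y -> graft_sigma x = y.
Proof.
have opp b c : b <> c -> b = ~~ c by case: b c => -[].
have vir1 h h' : phi1 h = phi1 h' -> sgn h = ~~ sgn h' -> wT (phi1 h) = None ->
    wS (phi1 h) = None.
  move=> e s t; have := half_inl h; have := half_inl h'.
  rewrite s -e t; case: (sgn h') => /=; by [move=> /(_ erefl)|move=> _ /(_ erefl)].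
have vir2 k k' : phi2 k = phi2 k' -> sgn k = ~~ sgn k' -> wS (phi2 k) = None ->
    wT (phi2 k) = None.
  move=> e s t; have := half_inr k; have := half_inr k'.
  rewrite s -e t; case: (sgn k') => /=; by [move=> /(_ erefl)|move=> _ /(_ erefl)].
case: x y => [h|k] [h'|k'] kx ky.
- move=> [e] /opp /= s; have sE : sigma h = h'.
    by apply: (sigma_other W1); rewrite ?s ?negbK.
  have no u u' : kept (inL u) -> phi1 u = phi1 u' -> sgn u = ~~ sgn u' ->
      mate (inL u) = None.
    rewrite kept_inl virtual_inl => ku eu su; apply: mate_inl_none.
    case T: (wT (phi1 u)) ku => [v|]; first by rewrite orbT.
    by rewrite (vir1 _ _ eu su T) /= => /andP[->].
  rewrite /Defs.graft_sigma (no h h') // [sigma _]/= sE (no h' h) //.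
  by rewrite s negbK.
- move=> /(edge12 colE) g /opp /= s; have [t0 s0 _ _] := glued_free colE g.
  rewrite /Defs.graft_sigma; case sh: (sgn h) in s *; last first.
    have [k [-> sk g']] := mate_inl_ex sh t0.
    have -> : k = k'.
      apply: (wired_inj W2); first exact: glued_fun g' g.
      by move: s; case: (sgn k') sk.
    move: ky; rewrite kept_inr; case: (virtual _) => //=.
    by rewrite -[sgn k']negbK -s.
  rewrite mate_inl_none ?sh // [sigma _]/=.
  have s1 := half_inl h; rewrite sh t0 in s1; have {}s1 := s1 erefl.
  have vh : virtual (inL h) by rewrite virtual_inl t0 s1.
  have ss : sgn (sigma h) = false by rewrite sgn_sigma_virtual1 ?sh.
  have ts : wT (phi1 (sigma h)) = None by rewrite (wired_sigma W1).
  have [k [-> sk g']] := mate_inl_ex ss ts.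
  rewrite (wired_sigma W1) in g'; have e := glued_fun g' g.
  rewrite /=; congr inr; apply: (sigma_other W2); rewrite ?e // sk.
  by rewrite -[sgn k']negbK -s.
- move=> /esym/(edge12 colE) g /opp /= s; have [t0 s0 _ _] := glued_free colE g.
  rewrite /Defs.graft_sigma; case sk: (sgn k) in s *.
    have [h [-> sh g']] := mate_inr_ex sk s0.
    have -> : h = h'.
      apply: (wired_inj W1); first exact: glued_inj g' g.
      by move: s; case: (sgn h') => //; rewrite sh.
    move: ky; rewrite kept_inl; case: (virtual _) => //=.
    by rewrite -[sgn h']negbK -s.
  rewrite mate_inr_none ?sk // [sigma _]/=.
  have s1 := half_inr k; rewrite sk s0 in s1; have {}s1 := s1 erefl.
  have vk : virtual (inR k) by rewrite virtual_inr s0 s1.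
  have ss : sgn (sigma k) by rewrite sgn_sigma_virtual2 ?sk.
  have ts : wS (phi2 (sigma k)) = None by rewrite (wired_sigma W2).
  have [h [-> sh g']] := mate_inr_ex ss ts.
  rewrite (wired_sigma W2) in g'; have e := glued_inj colE g' g.
  rewrite /=; congr inl; apply: (sigma_other W1); rewrite ?e // sh.
  by rewrite -[sgn h']negbK -s.
- move=> /edge2_inj e /opp /= s; have sE : sigma k = k'.
    by apply: (sigma_other W2); rewrite ?s ?negbK.
  have no u u' : kept (inR u) -> phi2 u = phi2 u' -> sgn u = ~~ sgn u' ->
      mate (inR u) = None.
    rewrite kept_inr virtual_inr => ku eu su; apply: mate_inr_none.
    case S: (wS (phi2 u)) ku => [v|]; first by rewrite orbT.
    by rewrite (vir2 _ _ eu su S) /= => /andP[->].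
  rewrite /Defs.graft_sigma (no k k') // [sigma _]/= sE (no k' k) //.
  by rewrite s negbK.
Qed.

Lemma kept_virtual_free (x : he G) : kept x -> virtual x ->
  wT (comp_edge0 x) = None /\ wS (comp_edge0 x) = None.
Proof.
case: x => [h|k].
  move=> + v; rewrite kept_inl v => /= /andP[_ /eqP T].
  by move: v; rewrite virtual_inl => /andP[_ /eqP S]; rewrite /= S.
move=> + v; rewrite kept_inr v [~~ true]/= orFb => /andP[_ /eqP S]; split=> //.
move: v; rewrite virtual_inr => /andP[/eqP T _].
by rewrite [comp_edge0 _]/= wT_edge2 T.
Qed.

Definition comp_edge (x : he (comp_diagram G2 G1)) : wE X := comp_edge0 (val x).

Lemma wend_free (Z : wiring D) (z : wE Z) c : wend z c = None ->
  ~~ wend z (~~ c) -> wT z = None /\ wS z = None.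
Proof. by case: c; rewrite /wend /= => ->; [case: (wS z)|case: (wT z)]. Qed.

Lemma whalf_free (Z : wiring D) (z : wE Z) c : whalf z c -> wend z c = None ->
  wT z = None /\ wS z = None.
Proof. by rewrite /whalf => + e; rewrite e => /(wend_free e). Qed.

Lemma comp_half e b : whalf e b -> exists x, comp_edge x = e /\ sgn x = b.
Proof.
have mk (x : he G) c : kept x -> comp_edge0 x = e -> sgn x = c ->
    exists x, comp_edge x = e /\ sgn x = c.
  by move=> kx ex sx; exists (exist _ x kx).
rewrite /whalf; case E: (wend e b) => [[v|v]|] /=.
- have [a ea Ta] : exists2 a, e = edge1 a & wend a b = Some v.
    by move: E; rewrite /wend; case: (b); [apply: wT_inl|apply: wS_inl].
  move=> _; have [h [ph sh kh]] := half_end W1 Ta.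
  apply: (mk (inL h)); rewrite ?ea /= ?ph // kept_inl virtual_inl ph.
  by move: Ta; rewrite /wend; case: (b) => ->; rewrite ?andbF.
- have [a ea Ta] : exists2 a, e = edge2 a & wend a b = Some v.
    by move: E; rewrite /wend; case: (b); [apply: wT_inr|apply: wS_inr].
  move=> _; have [k [pk sk kk]] := half_end W2 Ta.
  apply: (mk (inR k)); rewrite ?ea /= ?pk // kept_inr virtual_inr pk.
  by move: Ta; rewrite /wend; case: (b) => ->; rewrite ?andbF.
move=> E'.
have [Te Se] : wT e = None /\ wS e = None.
  exact: wend_free E E'.
case: (edgeP colE e) => [[a ea]|[d sd ed]]; last first.
  by move: Se; rewrite ed wS_edge2; case: (wS d) sd.
have Ta : wT a = None by move: Te; rewrite ea /=; case: (wT a).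
have [d g] := glued_l colE Ta; have [_ Sd _ _] := glued_free colE g.
have /(edge12 colE) ed := g.
have Sa : wS a = None by move: Se; rewrite ea /=; case: (wS a).
have Td : wT d = None by move: Te; rewrite ea ed wT_edge2; case: (wT d).
have [h [ph sh _]] := half_free W1 b Ta Sa.
have [k [pk sk _]] := half_free W2 b Td Sd.
case B: b sh sk => sh sk.
  apply: (mk (inL h)); rewrite ?B //= ?ph // kept_inl ph -ea Te sh.
  by rewrite eqxx orbT.
apply: (mk (inR k)); rewrite ?B //= ?pk -?ed // kept_inr pk -ed -ea Se sk.
by rewrite eqxx orbT.
Qed.

(** Since the second component of [graft_pos] is at most 2, comparing ranks is
    comparing positions lexicographically. *)
Lemma graft_pos_rank (x : he G) : graft_rank (comp_edge0 x)
  = 3 * (@graft_pos G1 G2 x).1 + (@graft_pos G1 G2 x).2 /\ (@graft_pos G1 G2 x).2 <= 2.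
Proof.
case: x => [h|k].
  have -> : graft_pos (inL h) = (count (fun o => wlt o (phi1 h)) (woutputs X1),
      nat_of_bool (wT (phi1 h) == None)).
    rewrite /graft_pos -(outs_wired W1 P1) count_map; congr pair.
      by apply: eq_count => o; rewrite /= (wired_prec W1).
    rewrite !mem_outs (wired_sigma W1); case T: (wT _) => [v|]; first by rewrite !andbF.
    rewrite !andbT; case sh: (sgn h) => //=.
    by have := half_inl h; rewrite sh T => /(_ erefl) S; rewrite sgn_sigma_virtual1
      ?sh // virtual_inl T S.
  by split=> //=; case: eqP.
have -> : graft_pos (inR k) = (let n := count (fun i => wlt i (phi2 k)) (winputs X2) in
    if wS (phi2 k) == None then (n, 1) else (n.-1, 2)).
  have cE : count (fun i => prec i k) (ins G2)
      = count (fun i => wlt i (phi2 k)) (winputs X2).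
    rewrite -(ins_wired W2 P2) count_map.
    by apply: eq_count => o; rewrite /= (wired_prec W2).
  rewrite /graft_pos cE !mem_ins (wired_sigma W2).
  case S: (wS _) => [v|]; first by rewrite !andbF.
  rewrite !andbT; case sk: (sgn k) => //=.
  by have := half_inr k; rewrite sk S => /(_ erefl) T; rewrite sgn_sigma_virtual2
    ?sk // virtual_inr T S.
by rewrite (rank_edge2 P1 P2 colE) /rank2; case: ifP.
Qed.

(** A tie between half-edges of different graphs only occurs on a grafted edge. *)
Lemma graft_prec_lt (x y : he G) :
  @graft_prec G1 G2 x y = graft_lt (comp_edge0 x) (comp_edge0 y).
Proof.
have [rx bx] := graft_pos_rank x; have [ry by'] := graft_pos_rank y.
pose side := match x, y with
  | inl h, inl h' => wlt (phi1 h) (phi1 h')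
  | inr h, inr h' => wlt (phi2 h) (phi2 h')
  | _, _ => false end.
have -> : @graft_prec G1 G2 x y =
    (graft_rank (comp_edge0 x) < graft_rank (comp_edge0 y)) ||
    (graft_rank (comp_edge0 x) == graft_rank (comp_edge0 y)) && side.
  rewrite /graft_prec rx ry /side.
  case: (graft_pos x) bx {rx} => i c /= bx; case: (graft_pos y) by' {ry} => j d /= by'.
  have -> : match x, y with
    | inl h, inl h' => prec h h' | inr h, inr h' => prec h h' | _, _ => false end = side.
    rewrite /side; case: x y {side} => [h|k] [h'|k'] //;
    by rewrite ?(wired_prec W1) ?(wired_prec W2).
  by rewrite -/side; case: side; rewrite ?andbT ?andbF; lia.
rewrite /graft_lt; case: ltngtP => //= e; rewrite {}/side.
have tie (a a' : wE X1) : wT a' = None -> rank1 a = rank1 a' -> wlt a a' = false.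
  move=> Ta' ra; apply/negP=> l; have [_] := count_lt P1 (woutputs X1) l.
  rewrite mem_outs1; move: ra; rewrite /rank1 Ta' eqxx; case: eqP => _ ra.
    by move/(_ isT); lia.
  lia.
have tie' (a a' : wE X1) : wT a = None -> rank1 a = rank1 a' -> wlt a a' = false.
  move=> Ta ra; apply/negP=> l; have [_] := count_lt P1 (woutputs X1) l.
  rewrite mem_outs1; move: ra; rewrite /rank1 Ta eqxx; case: eqP => _ ra.
    by move/(_ isT); lia.
  by move/(_ isT); lia.
case: x y rx ry e {bx by'} => [h|k] [h'|k'] _ _ e //.
- case: (edgeP colE (edge2 (phi2 k'))) => [[a ea]|[d sd ed]].
    have /(edge12 colE)/(glued_free colE)[Ta _ _ _] := esym ea.
    by move: e; rewrite [comp_edge0 (inr _)]/= ea /= => /(tie _ _ Ta) ->.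
  by rewrite [comp_edge0 (inr _)]/= ed; have [p ->] := edge2_inner colE sd.
- case: (edgeP colE (edge2 (phi2 k))) => [[a ea]|[d sd ed]].
    have /(edge12 colE)/(glued_free colE)[Ta _ _ _] := esym ea.
    by move: e; rewrite [comp_edge0 (inr _)]/= ea /= => /(tie' _ _ Ta) ->.
  by rewrite [comp_edge0 (inr _)]/= ed; have [p ->] := edge2_inner colE sd.
- have := edge2_lt P1 P2 colE (phi2 k) (phi2 k'); rewrite /graft_lt.
  by move: e => /= ->; rewrite ltnn eqxx /= => ->.
Qed.

Lemma comp_wired : wired comp_edge.
Proof.
have kx (x : he (comp_diagram G2 G1)) : kept (val x) := valP x.
have vsig x : val (sigma x : he (comp_diagram G2 G1)) =
    if kept (graft_sigma (val x)) then graft_sigma (val x) else val x.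
  by rewrite /= val_insubd.
have kend x : wend (comp_edge x) (sgn x)
    = wend (tensor_edge phi1 phi2 (val x)) (sgn (val x : he G)) by exact: kept_end.
split.
- move=> x y e s; apply: val_inj; exact: comp_inj.
- move=> e b; split; first exact: comp_half.
  case=> x [<- <-]; rewrite /whalf kend.
  case E: (wend _ _) => [v|] //=; apply/negP.
  case V: (virtual (val x : he G)).
    have [T S] := kept_virtual_free (kx x) V.
    by rewrite /wend; case: (~~ _); rewrite /comp_edge ?T ?S.
  have [T S] := whalf_free (wired_half_he WT (val x)) E.
  by move: V; rewrite (virtual_wired WT PT) T S.
- move=> x; rewrite /comp_edge vsig; case: ifP => // _; exact: graft_sigma_edge.
- move=> x y e s; apply: val_inj; rewrite vsig.
  by rewrite (graft_sigma_other (kx x) (kx y) e s) kx.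
- rewrite /=; apply/setP=> A.
  have cls (x : he (comp_diagram G2 G1)) :
      [set y : he (comp_diagram G2 G1) | val y \in @graft_vertex G1 G2 (val x)]
      = [set y in [set: _] | wkey comp_edge x == wkey comp_edge y].
    apply/setP=> y; rewrite !inE /graft_vertex.
    case: ifP => V; last first.
      rewrite (same_block WT) /wkey !kend.
      case E: (wend (tensor_edge _ _ (val x)) _) => [v|].
        by case: (wend _ _).
      exfalso; move/negP: V; apply; rewrite (virtual_wired WT PT).
      by have [-> ->] := whalf_free (wired_half_he WT (val x)) E.
    have [T S] := kept_virtual_free (kx x) V.
    have kf z : comp_edge z = comp_edge x -> wkey comp_edge z = inr (comp_edge x).
      by move=> e; rewrite /wkey e /wend; case: (sgn z); rewrite /comp_edge ?T ?S.
    rewrite (kf x erefl) !inE; apply/orP/eqP=> [[/eqP/val_inj ->|/eqP e]|].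
    - by rewrite kf.
    - by rewrite kf // /comp_edge e graft_sigma_edge.
    rewrite /wkey; case: (wend _ _) => // -[e].
    case: (eqVneq (sgn y) (sgn x)) => [s|/eqP s]; [left|right].
      by apply/eqP/comp_inj.
    by apply/eqP/esym/graft_sigma_other => //; apply: nesym.
  by apply/imsetP/imsetP=> -[x _ ->]; exists x => //; rewrite cls.
- move=> x y; exact: graft_prec_lt.
- move=> x; apply: etrans (wired_color WT (val x)) _; rewrite /comp_edge.
  by case: (val x) => [h|k] //; rewrite [comp_edge0 _]/= (wcol_edge2 colE).
- by move=> x; rewrite /= [LHS](wired_deco WT) kend.
Qed.

End CompWired.

Lemma coded_comp D (G1 G2 : prediagram D) l1 l2 : coded G1 l1 -> coded G2 l2 ->
  dcod G1 = ddom G2 -> exists2 l, blend l1 l2 l & coded (comp_diagram G2 G1) l.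
Proof.
case=> X1 [phi1 [W1 P1 ->]] [X2 [phi2 [W2 P2 ->]]].
rewrite (dcod_wired W1 P1) (ddom_wired W2 P2) => colE.
exists (wcode (graft_wiring X1 X2)); first exact: graft_code.
exists (graft_wiring X1 X2), (comp_edge phi1 phi2 colE); split=> //.
  exact: comp_wired.
exact: graft_planar.
Qed.

(** * The strict tensor category of diagrams *)

Section Classes.
Variable D : tscheme.
Notation class := (@diagram_class D).

Lemma valid_dom l (v w v' w' : seq (sOb D)) : valid l [::] [::] v w ->
  valid l [::] [::] v' w' -> v = v' /\ w = w'.
Proof.
move=> V V'; rewrite (valid_inputs V) (valid_inputs V').
by rewrite (valid_outputs V) (valid_outputs V').
Qed.

Lemma coded_diso_eq (G G' : prediagram D) l : coded G l -> coded G' l ->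
  diso G = diso G'.
Proof.
move=> c c'; apply: funext => H; apply: propext.
by split=> /(coded_diso _) d; apply: coded_eq_diso; [exact: c'|exact: d|exact: c|exact: d].
Qed.

Lemma rep_ex v w (f : class v w) : exists G, [/\ is_diagram G, ddom G = v, dcod G = w &
  members f = diso G].
Proof. exact: membersP. Qed.

Definition rep_of v w (f : class v w) : prediagram D := sval (boolp.cid (rep_ex f)).

Lemma rep_ofP v w (f : class v w) :
  [/\ is_diagram (rep_of f), ddom (rep_of f) = v, dcod (rep_of f) = w &
   members f = diso (rep_of f)].
Proof. by rewrite /rep_of; case: boolp.cid. Qed.

Lemma class_code_ex v w (f : class v w) : exists l, coded (rep_of f) l.
Proof. by case: (rep_ofP f) => /diagram_coded. Qed.

Definition class_code v w (f : class v w) := sval (boolp.cid (class_code_ex f)).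

Lemma class_codeP v w (f : class v w) : coded (rep_of f) (class_code f).
Proof. by rewrite /class_code; case: boolp.cid. Qed.

Lemma member_coded v w (f : class v w) G : f G <-> coded G (class_code f).
Proof.
have [_ _ _ ->] := rep_ofP f; split.
  exact: coded_diso (class_codeP f).
exact: coded_eq_diso (class_codeP f).
Qed.

Lemma members_coded v w (f : class v w) G : coded G (class_code f) -> members f = diso G.
Proof.
by move=> c; have [_ _ _ ->] := rep_ofP f; apply: coded_diso_eq (class_codeP f) c.
Qed.

Lemma class_code_eq v w (f : class v w) G l : members f = diso G -> coded G l ->
  class_code f = l.
Proof.
move=> fG c; have /member_coded c' : f G by rewrite fG; apply: diso_refl.
exact: coded_uniq c' c.
Qed.

Lemma class_valid v w (f : class v w) : valid (class_code f) [::] [::] v w.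
Proof.
have [_ e1 e2 _] := rep_ofP f.
by have := coded_valid (class_codeP f); rewrite e1 e2.
Qed.

Lemma class_arr_eq v w v' w' (f : class v w) (g : class v' w') :
  class_code f = class_code g -> Arr f = Arr g.
Proof.
move=> e; have V := class_valid g; rewrite -e in V.
have [ev ew] := valid_dom (class_valid f) V.
apply: diagram_class_arr_eq => //; have [_ _ _ ->] := rep_ofP g.
by apply: members_coded; rewrite e; apply: class_codeP.
Qed.

Lemma class_eq v w (f g : class v w) : class_code f = class_code g -> f = g.
Proof. by move=> e; apply/arr_inj/class_arr_eq. Qed.

Lemma class_proof G l v w : coded G l -> valid l [::] [::] v w ->
  exists G', [/\ is_diagram G', ddom G' = v, dcod G' = w & @diso D G = diso G'].
Proof.
move=> c V; exists G; have [-> ->] := valid_dom V (coded_valid c).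
by split=> //; apply: coded_diagram c.
Qed.

Definition class_of G l v w (c : coded G l) (V : valid l [::] [::] v w) : class v w :=
  @DiagramClass D v w (@diso D G) (class_proof c V).

Lemma class_ofK G l v w (c : coded G l) (V : valid l [::] [::] v w) :
  class_code (class_of c V) = l.
Proof. exact: (@class_code_eq _ _ (class_of c V) G l erefl c). Qed.

Lemma blend_inputs l1 l2 (l : seq (entry D)) : blend l1 l2 l ->
  [seq ecolor e | e <- l & is_in e] = [seq ecolor e | e <- l1 & is_in e].
Proof.
elim=> {l1 l2 l} //= [x l1 l2 l _ _ _ IH|y l1 l2 l /negPf -> //|c b s l1 l2 l _ IH].
  by case: ifP; rewrite /= IH.
by case: b; rewrite /= IH.
Qed.

Lemma blend_outputs l1 l2 (l : seq (entry D)) : blend l1 l2 l ->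
  [seq ecolor e | e <- l & is_out e] = [seq ecolor e | e <- l2 & is_out e].
Proof.
elim=> {l1 l2 l} //= [x l1 l2 l /negPf -> //|y l1 l2 l _ _ IH|c b s l1 l2 l _ IH].
  by case: ifP; rewrite /= IH.
by rewrite [is_out _]/= [is_out (Entry c true s)]/=; case: s; rewrite /= IH.
Qed.

Lemma comp_coded u v w (g : class v w) (f : class u v) G1 G2 : f G1 -> g G2 ->
  exists2 l, blend (class_code f) (class_code g) l & coded (comp_diagram G2 G1) l.
Proof.
move=> /member_coded c1 /member_coded c2; apply: (coded_comp c1 c2).
have [_ ->] := valid_dom (coded_valid c1) (class_valid f).
by have [-> _] := valid_dom (coded_valid c2) (class_valid g).
Qed.

Lemma comp_class_proof u v w (g : class v w) (f : class u v) :
  exists G', [/\ is_diagram G', ddom G' = u, dcod G' = w &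
    diso (comp_diagram (rep_of g) (rep_of f)) = diso G'].
Proof.
have fr : f (rep_of f) by apply/member_coded/class_codeP.
have gr : g (rep_of g) by apply/member_coded/class_codeP.
have [l B c] := comp_coded fr gr; apply: (class_proof c).
have V := coded_valid c; have [Vf Vg] := (class_valid f, class_valid g).
have eu := etrans (valid_inputs V) (etrans (blend_inputs B) (esym (valid_inputs Vf))).
have ew := etrans (valid_outputs V) (etrans (blend_outputs B) (esym (valid_outputs Vg))).
by rewrite eu ew in V.
Qed.

Definition class_comp u v w (g : class v w) (f : class u v) : class u w :=
  DiagramClass (comp_class_proof g f).

Lemma class_code_comp u v w (g : class v w) (f : class u v) :
  blend (class_code f) (class_code g) (class_code (class_comp g f)).
Proof.
have fr : f (rep_of f) by apply/member_coded/class_codeP.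
have gr : g (rep_of g) by apply/member_coded/class_codeP.
have [l B c] := comp_coded fr gr.
by rewrite (@class_code_eq _ _ (class_comp g f) _ _ erefl c).
Qed.

Definition class_ten v w v' w' (f : class v w) (g : class v' w') :
  class (v ++ v') (w ++ w') :=
  class_of (coded_tensor (class_codeP f) (class_codeP g))
    (valid_cat (class_valid f) (class_valid g)).

Lemma class_code_ten v w v' w' (f : class v w) (g : class v' w') :
  class_code (class_ten f g) = class_code f ++ class_code g.
Proof. exact: class_ofK. Qed.

Definition class_id w : class w w := class_of (coded_identity w) (valid_id w).

Lemma class_code_id w : class_code (class_id w) = id_code w.
Proof. exact: class_ofK. Qed.

(** A class is determined by its code, so the axioms are statements about [blend]
    and concatenation. *)
Definition free_tensor_struct : tensor_struct class.
Proof.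
refine (@TensorStruct (seq (sOb D)) class class_id class_comp cat [::] class_ten
  _ _ _ _ _ _ _ _ _ _ _).
- move=> x y z t h g f; apply: class_eq.
  have [l B B'] := blend_assoc (class_code_comp g f) (class_code_comp h (class_comp g f)).
  rewrite (blend_fun B (class_code_comp h g)) in B'.
  exact: blend_fun B' (class_code_comp _ _).
- move=> x y f; apply: class_eq; have := class_code_comp (class_id y) f.
  by rewrite class_code_id => B; apply: blend_fun B (blend_id_r (class_valid f)).
- move=> x y f; apply: class_eq; have := class_code_comp f (class_id x).
  by rewrite class_code_id => B; apply: blend_fun B (blend_id_l (class_valid f)).
- exact: catA.
- exact: cat0s.
- exact: cats0.
- move=> x y; apply: class_eq.
  by rewrite class_code_ten !class_code_id /id_code map_cat.
- move=> x y z x' y' z' g f g' f'; apply: class_eq.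
  apply: blend_fun (class_code_comp _ _); rewrite !class_code_ten.
  exact: blend_cat (class_code_comp _ _) (valid_starts (class_valid _)) (class_code_comp _ _).
- by move=> *; apply: class_arr_eq; rewrite !class_code_ten catA.
- by move=> *; apply: class_arr_eq; rewrite class_code_ten class_code_id.
- by move=> *; apply: class_arr_eq; rewrite class_code_ten class_code_id cats0.
Defined.

Lemma free_tensor_structP : is_free_struct free_tensor_struct.
Proof.
split=> //.
- move=> u v w g f G1 G2 fG1 gG2; have [l B c] := comp_coded fG1 gG2.
  by apply: members_coded; rewrite (blend_fun (class_code_comp g f) B).
- move=> v w v' w' f f' G1 G2 /member_coded c1 /member_coded c2.
  apply: members_coded; rewrite class_code_ten; exact: coded_tensor.
Qed.

End Classes.

Section FreeHom.
Variables (D E : tscheme) (p : tscheme_hom D E).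

Lemma blend_map l1 l2 l : blend l1 l2 l ->
  blend (map (map_entry p) l1) (map (map_entry p) l2) (map (map_entry p) l).
Proof.
elim=> {l1 l2 l} /= [|[c b s] l1 l2 l xo st _ IH|[c b s] l1 l2 l yi _ IH|
  c b s l1 l2 l _ IH]; constructor=> //; first by case: s xo.
by case: l2 st {IH}.
Qed.

Lemma map_valid l L P I W : valid l L P I W ->
  valid (map (map_entry p) l) (map (hob p) L) (map (hob p) P) (map (hob p) I)
    (map (hob p) W).
Proof.
have rd b c P' I' P2 I2 : reads b c P' I' P2 I2 -> reads b (hob p c) (map (hob p) P')
    (map (hob p) I') (map (hob p) P2) (map (hob p) I2).
  by case: b => [[-> -> ->]|[-> ->]].
elim=> {l L P I W} [|c b l P I P' I' W /rd r _|c b l L P I P' I' W /rd r _|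
  c b m l L P I L' P' I' W /rd r e _]; first by constructor.
- exact: ValidOut r.
- by rewrite map_rcons; apply: ValidWait r.
- rewrite map_cat => IH; apply: ValidClose r _ _.
    by rewrite -map_rcons e map_cat hmor_src.
  by rewrite hmor_tgt.
Qed.

Definition class_relabel v w (f : @diagram_class D v w) :
    @diagram_class E (map (hob p) v) (map (hob p) w) :=
  class_of (coded_relabel p (class_codeP f)) (map_valid (class_valid f)).

Lemma class_code_relabel v w (f : @diagram_class D v w) :
  class_code (class_relabel f) = map (map_entry p) (class_code f).
Proof. exact: class_ofK. Qed.

Definition free_map :
  strT_functor (StrT (free_tensor_struct D)) (StrT (free_tensor_struct E)).
Proof.
refine (@StrTFunctor (StrT (free_tensor_struct D)) (StrT (free_tensor_struct E))
  (map (hob p)) class_relabel _ _ _ _ _).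
- move=> x; apply: class_eq; rewrite class_code_relabel !class_code_id.
  by rewrite /id_code -!map_comp.
- move=> x y z g f; apply: class_eq; rewrite class_code_relabel.
  apply: blend_fun (blend_map (class_code_comp g f)) _.
  have := class_code_comp (class_relabel g) (class_relabel f).
  by rewrite !class_code_relabel.
- exact: map_cat.
- by [].
- move=> x y x' y' f f'; apply: class_arr_eq.
  by rewrite !(class_code_relabel, class_code_ten) map_cat.
Defined.

End FreeHom.

Definition free : free_functor.
Proof.
refine (@FreeFunctor free_tensor_struct free_tensor_structP free_map _ _) => //.
move=> D E p v w f G /member_coded c; apply: members_coded.
by rewrite class_code_relabel; apply: coded_relabel.
Defined.

(** * The adjunction *)

Section CastArr.
Variables (ob : Type) (hom : ob -> ob -> Type).
Definition cast_arr (a : arr hom) x y (ex : arr_dom a = x) (ey : arr_cod a = y) :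
  hom x y :=
  ecast c (hom x c) ey (ecast d (hom d (arr_cod a)) ex (arr_hom a)).

Lemma Arr_cast (a : arr hom) x y (ex : arr_dom a = x) (ey : arr_cod a = y) :
  Arr (cast_arr ex ey) = a.
Proof. by rewrite /cast_arr; case: _ / ey; case: _ / ex; case: a. Qed.
End CastArr.

Section Counit.
Variable V : strT.
Notation FU := (F_ob free (U_ob V)).

Definition counit_hom v w (f : @thom FU v w) : @thom V (tens V v) (tens V w) :=
  let t := ev_typed (class_valid f) in cast_arr t.1 t.2.

Lemma counit_homE v w (f : @thom FU v w) :
  Arr (counit_hom f) = ev (class_code f) [::] v.
Proof. exact: Arr_cast. Qed.

Definition free_counit : strT_functor FU V.
Proof.
refine (@StrTFunctor FU V (tens V) counit_hom _ _ _ _ _).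
- by move=> x; apply: arr_inj; rewrite counit_homE /= class_code_id ev_id.
- move=> x y z g f; apply: arr_inj; rewrite -acompE !counit_homE.
  by apply: ev_comp (class_code_comp g f) (class_valid f) (class_valid g).
- exact: tens_cat.
- by [].
- move=> x y x' y' f f'; rewrite counit_homE /= class_code_ten.
  rewrite -[RHS]/(aten (Arr (counit_hom f)) (Arr (counit_hom f'))) !counit_homE.
  exact: ev_cat (class_valid f) (class_valid f').
Defined.
End Counit.

Section Naturality.
Variables (V W : strT) (K : strT_functor V W).

Definition map_arr (a : arr (@thom V)) : arr (@thom W) := Arr (shom K (arr_hom a)).

Lemma map_aid x : map_arr (aid x) = aid (sob K x).
Proof. by rewrite /map_arr /= shom_id. Qed.

Lemma map_acomp g f : arr_cod f = arr_dom g ->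
  map_arr (acomp g f) = acomp (map_arr g) (map_arr f).
Proof.
case: g f => y z g [x y' f] /= e; subst y'.
by rewrite acompE /map_arr /= shom_comp acompE.
Qed.

Lemma map_aten f g : map_arr (aten f g) = aten (map_arr f) (map_arr g).
Proof. exact: shom_ten. Qed.

Lemma map_tens w : sob K (tens V w) = tens W (map (sob K) w).
Proof. exact: sob_tens. Qed.

Lemma map_vertex_arr m : map_arr (vertex_arr m) = vertex_arr (U_mor K m).
Proof. exact/esym/(@Arr_ecast W). Qed.

(** Evaluation only uses the operations of the strict tensor category; hence the
    counit is natural. *)
Lemma map_ev l L P I Z : valid l L P I Z ->
  map_arr (ev l L (P ++ I)) =
  ev (map (map_entry (U_hom K)) l) (map (sob K) L) (map (sob K) (P ++ I)).
Proof.
elim=> {l L P I Z} [|c b l P I P' I' W' /reads_cat -> _ IH|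
   c b l L P I P' I' W' /reads_cat -> _|
   c b m l L P I L' P' I' W' /reads_cat -> e Vl].
- by rewrite /= map_aid sob_unit.
- by rewrite /= map_aten map_aid IH.
- by rewrite map_rcons.
- rewrite -catA => IH; have T := ev_typed Vl; rewrite -catA in T.
  have t := layer_typed L' m (P' ++ I').
  rewrite (ev_close _ _ _ e) map_acomp; last by rewrite t.2 T.1.
  rewrite IH.
  have e' : rcons (map (sob K) L) (sob K c) = map (sob K) L' ++ src (U_mor K m).
    by rewrite -map_rcons e map_cat.
  apply/esym/(etrans (ev_close _ _ _ e'))/esym; rewrite map_cat; congr acomp.
  by rewrite /layer !map_aten !map_aid !map_tens map_vertex_arr.
Qed.

End Naturality.

Section Unit.
Variable D : tscheme.
Notation FD := (F_ob free D).
Notation sing := (fun x : sOb D => [:: x]).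

Lemma tens_letters w : tens FD (map sing w) = w.
Proof. by elim: w => // x w IH; rewrite map_cons tens_cons IH. Qed.

Lemma unit_valid (m : Mor D) : valid (prime_code m) [::] [::]
  (tens FD (nemap sing (src m))) (tens FD (nemap sing (tgt m))).
Proof. by rewrite !(tens_letters (_ :: _)); apply: valid_prime. Qed.

Definition unit_mor (m : Mor D) : Mor (U_ob FD) :=
  @MkMor (U_ob FD) (nemap sing (src m)) (nemap sing (tgt m))
    (class_of (coded_prime m) (unit_valid m)).

Definition free_unit_hom : tscheme_hom D (U_ob FD).
Proof. by refine (@TSchemeHom D (U_ob FD) sing unit_mor _ _). Defined.

Notation eta := free_unit_hom.

Definition arr_code (a : arr (@thom FD)) := class_code (arr_hom a).

Lemma arr_code_comp g f : arr_cod f = arr_dom g ->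
  blend (arr_code f) (arr_code g) (arr_code (acomp g f)).
Proof.
case: g f => y z g [x y' f] /= e; subst y'.
by rewrite acompE; apply: class_code_comp.
Qed.

Lemma arr_code_ten f g : arr_code (aten f g) = arr_code f ++ arr_code g.
Proof. exact: class_code_ten. Qed.

Lemma arr_code_id w : arr_code (aid w) = id_code w.
Proof. exact: class_code_id. Qed.

Lemma arr_code_vertex m : arr_code (vertex_arr (unit_mor m)) = prime_code m.
Proof. exact: class_ofK. Qed.

(** The part of a code that remains to be read, as the code of a diagram by
    itself: an edge that was pending when the reading of this part began is an
    input; [q] is the number of the pending edges that arose since then. *)
Fixpoint reopen q (l : seq (entry D)) : seq (entry D) :=
  match l with
  | [::] => [::]
  | Entry c b s :: l' => Entry c (b || (q == 0)) s ::
      reopen (q.-1 + (if s is Close m then size (tgt m) else 0)) l'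
  end.

Lemma reopen_starts l : starts_in (reopen 0 l).
Proof. by case: l => [|[c b s] l] //=; rewrite orbT. Qed.

Lemma reopen_pending l L P I W : valid l L P I W -> reopen (size P) l = l.
Proof.
have rd b c P' I' P2 I2 : reads b c P' I' P2 I2 ->
    b || (size P' == 0) = b /\ (size P').-1 = size P2.
  by case: b => [[-> ->]|[->]].
elim=> {l L P I W} [//|c b l P I P' I' W /rd[e1 e2] _ IH|
    c b l L P I P' I' W /rd[e1 e2] _ IH|c b m l L P I L' P' I' W /rd[e1 e2] _ _ IH];
  rewrite /reopen -/reopen e1 e2 ?addn0 ?IH //.
by rewrite size_cat addnC in IH; rewrite IH.
Qed.

Definition fresh_code (w : seq (sOb D)) := [seq Entry c false Out | c <- w].

(** The outputs [N] of a vertex that has just fired are inputs of the rest of the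
    code; composing with these outputs turns them into pending edges. The edges [Q],
    in front of them, are those that arose later, during the reading of the rest. *)
Lemma blend_reopen l L P I W : valid l L P I W -> forall Q N P0, P = Q ++ N ++ P0 ->
  blend (fresh_code N ++ id_code (P0 ++ I)) (reopen (size Q) l)
    (reopen (size Q + size N) l).
Proof.
have step c b s l' P' I' P2 I2 (T : seq (sOb D)) : reads b c P' I' P2 I2 ->
    (forall Q N P0, P2 = Q ++ N ++ P0 -> blend (fresh_code N ++ id_code (P0 ++ I2))
      (reopen (size T + size Q) l') (reopen (size T + size Q + size N) l')) ->
    (if s is Close m then size (tgt m) else 0) = size T ->
    forall Q N P0, P' = Q ++ N ++ P0 ->
    blend (fresh_code N ++ id_code (P0 ++ I'))
      (reopen (size Q) (Entry c b s :: l'))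
      (reopen (size Q + size N) (Entry c b s :: l')).
  move=> + H sT; case: b => -[eP e2].
    move=> eI Q N P0; rewrite eP eI; case: Q => // ; case: N => // ; case: P0 => // _.
    rewrite /= sT; apply: BlendJ.
    by have := H [::] [::] [::]; rewrite e2 /= addn0 addn0; apply.
  move=> [|d Q] [|d' N] P0; rewrite eP e2 /= sT.
  - case: P0 => // d P0 [<- eP2]; apply: BlendJ.
    by have := H [::] [::] P0 eP2; rewrite /= addn0 addn0.
  - move=> [<- eP2]; apply: BlendJ.
    by have := H [::] N P0 eP2; rewrite /= addn0 addnC.
  - move=> [_ eP2]; rewrite addn0; apply: BlendR => //.
    by have := H Q [::] P0 eP2; rewrite /= !addn0 addnC.
  - move=> [_ eP2]; apply: BlendR => //.
    have := H Q (d' :: N) P0 eP2; rewrite /= [size T + _]addnC.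
    by rewrite addnAC.
elim=> {l L P I W} [|c b l P I P' I' W rd _ IH|c b l L P I P' I' W rd _ IH|
    c b m l L P I L' P' I' W rd _ _ IH].
- by case=> // -[] // [] // _; apply: BlendNil.
- exact: (step _ _ Out _ _ _ _ _ [::] rd IH erefl).
- exact: (step _ _ Wait _ _ _ _ _ [::] rd IH erefl).
- apply: (step _ _ (Close m) _ _ _ _ _ (tgt m) rd) => // Q N P0 e.
  by rewrite -size_cat; apply: IH; rewrite e catA.
Qed.

Definition wait_code (w : seq (sOb D)) := [seq Entry c true Wait | c <- w].

(** The triangle identity for the free category: evaluating in F(D) the part of a
    code that remains to be read gives back this part, preceded by the edges that
    wait, as inputs. *)
Lemma ev_unit l L P I W : valid l L P I W ->
  arr_code (ev (map (map_entry eta) l) (map sing L) (map sing (P ++ I)))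
  = wait_code L ++ reopen 0 l.
Proof.
elim=> {l L P I W} [|c b l P I P' I' W /reads_cat e _ IH|
   c b l L P I P' I' W /reads_cat e _|
   c b m l L P I L' P' I' W /reads_cat e eL Vl].
- by rewrite arr_code_id.
- by rewrite e /= arr_code_ten arr_code_id IH /= orbT.
- by rewrite e /= map_rcons => ->; rewrite /wait_code map_rcons cat_rcons orbT.
- rewrite -catA => IH; rewrite e map_cons.
  have e' : rcons (map sing L) [:: c] = map sing L' ++ src (unit_mor m).
    by rewrite -map_rcons eL map_cat.
  have E := @ev_close FD [:: c] b (unit_mor m) (map (map_entry eta) l) (map sing L)
    (map sing L') (map sing (P' ++ I')) e'.
  apply: etrans (congr1 arr_code E) _ => {E}.
  have T : typed (ev (map (map_entry eta) l) (map sing L')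
      (tgt (unit_mor m) ++ map sing (P' ++ I')))
      (map sing L' ++ tgt (unit_mor m) ++ map sing (P' ++ I')) (map sing W).
    by have := ev_typed (map_valid eta Vl); rewrite -map_cat -catA map_cat.
  have t := @layer_typed FD (map sing L') (unit_mor m) (map sing (P' ++ I')).
  apply: blend_fun (arr_code_comp (etrans t.2 (esym T.1))) _.
  have -> : arr_code (ev (map (map_entry eta) l) (map sing L')
      (tgt (unit_mor m) ++ map sing (P' ++ I'))) = wait_code L' ++ reopen 0 l.
    by rewrite -IH (map_cat _ (tgt m)).
  have -> : arr_code (@layer FD (map sing L') (unit_mor m) (map sing (P' ++ I')))
      = id_code L' ++ prime_code m ++ id_code (P' ++ I').
    by rewrite !arr_code_ten arr_code_vertex !arr_code_id !tens_letters.
  have [eLc ec] : L = L' ++ belast (first_letter (src m)) (next_letters (src m)) /\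
      c = last (first_letter (src m)) (next_letters (src m)).
    by apply/pair_equal_spec/rcons_inj; rewrite eL rcons_cat -lastI.
  rewrite eLc /wait_code map_cat -catA -/(wait_code _).
  apply: blend_cat; [|exact: reopen_starts|].
    by elim: (L') => [|d w Bw]; [apply: BlendNil | apply: BlendJ].
  rewrite /= orbT add0n /prime_code -ec -catA -cat_rcons.
  have Bn := blend_reopen Vl (Q := [::]) (erefl : tgt m ++ P' = [::] ++ tgt m ++ P').
  have nout k : all (fun x => ~~ is_out x) k -> blend k [::] k.
    elim: k => [_|x k IHk /= /andP[xo /IHk]]; [exact: BlendNil | exact: BlendL].
  apply: (blend_cat (l2 := [::])); first last.
  - exact: Bn.
  - exact: reopen_starts.
  apply: nout; rewrite all_rcons all_map /=; by elim: (belast _ _).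
Qed.

End Unit.

Lemma map_prime_code D E (f : tscheme_hom D E) m :
  map (map_entry f) (prime_code m) = prime_code (hmor f m).
Proof.
rewrite /prime_code hmor_src hmor_tgt map_cat map_rcons /= belast_map last_map.
by rewrite -!map_comp.
Qed.

Definition free_adj : adjunction (F free) U.
Proof.
refine (@Adjunction T_Sch Str_T (F free) U free_unit_hom free_counit _ _ _ _).
- move=> D E f; apply: tscheme_hom_eq => // m.
  apply: U_Mor_eq.
  + by rewrite /= -!nemap_comp hmor_src -nemap_comp.
  + by rewrite /= -!nemap_comp hmor_tgt -nemap_comp.
  apply: etrans (@Arr_ecast (F_ob free E) _ _ _ _ _ _ _) _.
  apply: class_arr_eq; rewrite class_code_relabel.
  apply: etrans (congr1 _ (class_ofK _ _)) _.
  exact: etrans (map_prime_code f m) (esym (class_ofK _ _)).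
- move=> V W K; apply: strT_functor_eq => [w|v w f]; first exact: sob_tens.
  rewrite [RHS]counit_homE class_code_relabel.
  rewrite -[LHS]/(map_arr K (Arr (counit_hom f))) counit_homE.
  exact: (map_ev K (class_valid f)).
- move=> D; apply: strT_functor_eq => [w|v w f]; first exact: tens_letters.
  have arr_code_inj (a a' : arr (@thom (F_ob free D))) :
      arr_code a = arr_code a' -> a = a'.
    by case: a a' => ? ? a [? ? a']; apply: class_arr_eq.
  apply: arr_code_inj; rewrite [X in arr_code X = _]counit_homE class_code_relabel.
  have V := class_valid f; apply: etrans (ev_unit V) _.
  exact: (reopen_pending V).
- move=> V; apply: tscheme_hom_eq => // m; apply: U_Mor_eq.
  + by rewrite /= -nemap_comp; apply: nemap_id.
  + by rewrite /= -nemap_comp; apply: nemap_id.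
  apply: etrans (@Arr_ecast V _ _ _ _ _ _ _) _.
  apply: etrans (counit_homE _) _; rewrite class_ofK.
  apply: etrans (ev_prime m); congr ev; exact: (tens_letters (src m)).
Defined.

Definition free_adjunction_ex : free_adjunction.
Proof.
refine (@FreeAdjunction free free_adj _ _ _ _) => // V m p mp.
apply: etrans (counit_homE _) _.
by rewrite (class_code_eq mp (coded_prime m)); apply: ev_prime.
Defined.

(** * The comparison functor *)

Section Letters.
Variable V : strT.

Definition letter_mor x y (f : @thom V x y) : Mor (U_ob V) :=
  @MkMor (U_ob V) (NeWord x [::]) (NeWord y [::]) f.

Lemma U_mor_arr W (K : strT_functor V W) m :
  vertex_arr (U_mor K m) = map_arr K (vertex_arr m).
Proof. exact: (@Arr_ecast W). Qed.

End Letters.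

Section Comparison.
Variable A : free_adjunction.
Notation F := (F_ob A).

Lemma comparison_faithful : faithful (Phi A).
Proof.
move=> V W K L /(congr1 (fun g : alg_hom _ _ => alg_map g)) /= e.
have eo x : sob K x = sob L x :=
  congr1 (fun g : tscheme_hom (U_ob V) (U_ob W) => hob g x) e.
apply: strT_functor_eq => // x y f.
have := congr1 (fun g : tscheme_hom (U_ob V) (U_ob W) =>
  vertex_arr (hmor g (letter_mor f))) e.
by rewrite /= !U_mor_arr.
Qed.

Section Algebra.
Variables V W : strT.
Variable g : alg_hom (comparison_ob A V) (comparison_ob A W).
Let gm : tscheme_hom (U_ob V) (U_ob W) := alg_map g.
Let epsV : strT_functor (F (U_ob V)) V := counit A V.
Let epsW : strT_functor (F (U_ob W)) W := counit A W.
Let Fg : strT_functor (F (U_ob V)) (F (U_ob W)) := free_hom A gm.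

Lemma alg_square : tscheme_comp gm (U_hom epsV) = tscheme_comp (U_hom epsW) (U_hom Fg).
Proof. exact: (alg_mapP g). Qed.

Lemma alg_tens w : hob gm (tens V w) = tens W (map (hob gm) w).
Proof.
have := congr1 (fun h : tscheme_hom (U_ob (F (U_ob V))) (U_ob W) => hob h w) alg_square.
by rewrite /= !fa_counit_ob free_hom_ob.
Qed.

(** A morphism of algebras acts on arrows because an arrow is a morphism of the
    scheme between one-letter words. *)
Definition alg_arr (a : arr (@thom V)) : arr (@thom W) :=
  vertex_arr (hmor gm (letter_mor (arr_hom a))).

Lemma alg_arr_dom a : arr_dom (alg_arr a) = hob gm (arr_dom a).
Proof. by rewrite /= hmor_src. Qed.

Lemma alg_arr_cod a : arr_cod (alg_arr a) = hob gm (arr_cod a).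
Proof. by rewrite /= hmor_tgt. Qed.

(** This is the square that defines morphisms of algebras, read off at the
    morphisms between one-letter words. *)
Lemma alg_arr_eval a : alg_arr (map_arr epsV a) = map_arr epsW (map_arr Fg a).
Proof.
case: a => v w p; have := congr1 (fun h : tscheme_hom (U_ob (F (U_ob V))) (U_ob W) =>
  vertex_arr (hmor h (letter_mor p))) alg_square.
rewrite /= !U_mor_arr => <-; congr (vertex_arr (hmor gm _)).
apply: U_Mor_eq => //; exact/esym/(@Arr_ecast V).
Qed.

Definition prime_class D (m : Mor D) : @diagram_class D (src m) (tgt m) :=
  class_of (coded_prime m) (valid_prime m).

Lemma eval_prime (V' : strT) (m : Mor (U_ob V')) :
  map_arr (counit A V') (@Arr _ (@thom (F (U_ob V'))) _ _ (prime_class m)) = vertex_arr m.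
Proof. exact: fa_counit_mor. Qed.

(** Every arrow is a value of the counit, at a diagram between one-letter words. So
    composable arrows are values of composable diagrams. *)
Lemma letter_prime (V' : strT) x y (f : @thom V' x y) : exists2 p,
  p = @Arr _ (@thom (F (U_ob V'))) [:: x] [:: y] (prime_class (letter_mor f)) &
  map_arr (counit A V') p = Arr f.
Proof.
exists (@Arr _ (@thom (F (U_ob V'))) [:: x] [:: y] (prime_class (letter_mor f))) => //.
exact: (eval_prime (letter_mor f)).
Qed.

Definition alg_hom_fun x y (f : @thom V x y) : @thom W (hob gm x) (hob gm y) :=
  cast_arr (alg_arr_dom (Arr f)) (alg_arr_cod (Arr f)).

Lemma alg_hom_funE x y (f : @thom V x y) : Arr (alg_hom_fun f) = alg_arr (Arr f).
Proof. exact: Arr_cast. Qed.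

Definition alg_functor : strT_functor V W.
Proof.
refine (@StrTFunctor V W (hob gm) alg_hom_fun _ _ _ _ _).
- move=> x; apply: arr_inj; rewrite alg_hom_funE.
  have -> : Arr (tid (tstr V) x) = map_arr epsV (@aid (F (U_ob V)) [:: x]).
    by rewrite map_aid fa_counit_ob.
  by rewrite alg_arr_eval !map_aid free_hom_ob fa_counit_ob.
- move=> x y z h f; apply: arr_inj; rewrite alg_hom_funE -!acompE !alg_hom_funE.
  have [p pE <-] := letter_prime f; have [q qE <-] := letter_prime h.
  have pq : arr_cod p = arr_dom q by rewrite pE qE.
  rewrite -map_acomp // !alg_arr_eval !map_acomp //.
  by rewrite /= pq.
- by move=> x y; apply: (alg_tens [:: x; y]).
- exact: (alg_tens [::]).
- move=> x y x' y' f h; rewrite alg_hom_funE.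
  rewrite -[RHS]/(aten (Arr (alg_hom_fun f)) (Arr (alg_hom_fun h))) !alg_hom_funE.
  rewrite -[X in alg_arr X]/(aten (Arr f) (Arr h)).
  have [p pE <-] := letter_prime f; have [q qE <-] := letter_prime h.
  by rewrite -map_aten !alg_arr_eval !map_aten.
Defined.

(** So far only the images of the morphisms between one-letter words were used.
    The image of a general [m] is determined by them because the arrow of [m] is
    the value of the prime diagram of [m], which is relabelled to that of its
    image. *)
Lemma alg_arr_prime m : alg_arr (vertex_arr m) = vertex_arr (hmor gm m).
Proof.
rewrite -eval_prime alg_arr_eval -[RHS]eval_prime; congr map_arr.
apply: diagram_class_arr_eq; rewrite ?free_hom_ob ?hmor_src ?hmor_tgt //.
have pm : prime_class m (prime_diagram m) by apply: diso_refl.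
rewrite (@free_hom_mor A _ _ gm _ _ _ _ pm).
apply: (@coded_diso_eq _ _ _ (prime_code (hmor gm m))); last exact: coded_prime.
by rewrite -map_prime_code; apply: coded_relabel (coded_prime m).
Qed.

Lemma alg_functorE : comparison_hom A alg_functor = g.
Proof.
apply: alg_hom_eq; apply: tscheme_hom_eq => // m; apply: U_Mor_eq.
- exact/esym/hmor_src.
- exact/esym/hmor_tgt.
apply: etrans (U_mor_arr _ _) _; apply: etrans (alg_hom_funE _) _.
exact: alg_arr_prime.
Qed.

End Algebra.

Lemma comparison_full : full (Phi A).
Proof. by move=> V W g; exists (alg_functor g); apply: alg_functorE. Qed.

(** This shows what an identity transported along an equation of schemes does, from
    which [scheme_id_eq] reads off the action of [K]. *)
Lemma cast_scheme_id ob (f f' : neword ob -> neword ob -> Type) (ef : f = f')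
    (e : TScheme f = TScheme f') :
  let T := ecast E (tscheme_hom (TScheme f) E) e (tscheme_id (TScheme f)) in
  (forall x, hob T x = x) /\
  forall v w (l : f v w), hmor T (@MkMor (TScheme f) v w l) =
    @MkMor (TScheme f') v w (ecast h (h v w) ef l).
Proof. by subst f'; rewrite (Prop_irrelevance e erefl). Qed.

Lemma ecast_fibre ob (f f' : neword ob -> neword ob -> Type) (ef : f = f') v w
  (X : Type) (e : X = f v w) (e' : X = f' v w) (x : X) :
  ecast h (h v w) ef (ecast T T e x) = ecast T T e' x.
Proof.
by subst f'; rewrite (Prop_irrelevance e e').
Qed.

(** The fibres are a dependent component; the transport between them is trivial by
    proof irrelevance of equations. *)
Lemma TScheme_inj ob (f f' : neword ob -> neword ob -> Type) :
  TScheme f = TScheme f' -> f = f'.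
Proof.
have gen D E (e : D = E) :
    ecast o (neword o -> neword o -> Type) (congr1 sOb e) (@sfib D) = @sfib E.
  by case: _ / e.
by move=> e; have := gen _ _ e; rewrite (Prop_irrelevance (congr1 sOb e) erefl).
Qed.

Lemma tensor_struct_eq ob (hom : ob -> ob -> Type) (s s' : tensor_struct hom) :
  (forall x, tid s x = tid s' x) ->
  (forall x y z (g : hom y z) (f : hom x y), tcomp s g f = tcomp s' g f) ->
  (forall x y, ten s x y = ten s' x y) -> tunit s = tunit s' ->
  (forall x y x' y' (f : hom x y) (g : hom x' y'), Arr (tenm s f g) = Arr (tenm s' f g)) ->
  s = s'.
Proof.
case: s s' => i c t u m p1 p2 p3 p4 p5 p6 p7 p8 p9 p10 p11.
case=> i' c' t' u' m' q1 q2 q3 q4 q5 q6 q7 q8 q9 q10 q11 /= ei ec et eu em.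
have {}ei : i = i' by apply: functional_extensionality_dep.
have {}ec : c = c'.
  do 3![apply: functional_extensionality_dep => ?].
  by do 2![apply: funext => ?].
have {}et : t = t' by do 2![apply: funext => ?].
subst i' c' t' u'.
have {}em : m = m'.
  do 4![apply: functional_extensionality_dep => ?].
  by do 2![apply: funext => ?]; apply: arr_inj.
by subst m'; congr TensorStruct; apply: Prop_irrelevance.
Qed.

(** The equation of the schemes identifies objects and arrows. Under this
    identification [K] is the identity, and its axioms say that the operations of
    [V] and [W] agree. *)
Lemma scheme_id_eq V W (e : U_ob V = U_ob W) (K : strT_functor V W) :
  U_hom K = ecast E (tscheme_hom (U_ob V) E) e (tscheme_id (U_ob V)) -> V = W.
Proof.
case: V W e K => [ob hom s] [ob' hom' s'] e K.
have eo : ob = ob' := congr1 sOb e; subst ob'.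
have ef := TScheme_inj e.
have eh : hom = hom'.
  apply: functional_extensionality_dep => x; apply: functional_extensionality_dep => y.
  exact: (congr1 (fun h => h (NeWord x [::]) (NeWord y [::])) ef).
subst hom'.
have [c1 c2] := cast_scheme_id ef e => UK.
have Ko x : sob K x = x by rewrite -[RHS]c1 -UK.
have Kh x y (f : hom x y) : Arr (shom K f) = Arr f.
  have E := congr1 (@vertex_arr (StrT s')) (c2 _ _ (lab (@letter_mor (StrT s) x y f))).
  rewrite -UK in E.
  apply: etrans (esym (@U_mor_arr _ _ K (@letter_mor (StrT s) x y f))) (etrans E _).
  rewrite /vertex_arr /=; congr Arr.
  exact: (@ecast_fibre _ _ _ ef (NeWord x [::]) (NeWord y [::]) (hom x y) erefl erefl f).
case: K {UK} Ko Kh => so sh /= i1 i2 i3 i4 i5 Ko Kh.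
have {}Ko : so = id by apply: funext.
subst so.
have {}Kh x y (f : hom x y) : sh x y f = f by apply: arr_inj.
congr StrT; apply: tensor_struct_eq.
- by move=> x; rewrite -[LHS]Kh i1.
- by move=> x y z g f; rewrite -[LHS]Kh i2 !Kh.
- exact: i3.
- exact: i4.
- by move=> x y x' y' f g; have := i5 _ _ _ _ f g; rewrite !Kh.
Qed.

Lemma comparison_inj : injective (fob (Phi A)).
Proof.
move=> V W /= e.
pose g := ecast B (alg_hom (comparison_ob A V) B) e
  (cid (comparison_ob A V : tensor_manifolds A)).
have eg (B C : algebra (induced_monad A)) (e' : B = C) :
    alg_map (ecast C (alg_hom B C) e' (cid (B : tensor_manifolds A)))
    = ecast E (tscheme_hom (carrier B) E) (congr1 (@carrier _ _) e')
        (tscheme_id (carrier B)).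
  by case: _ / e'.
apply: (@scheme_id_eq V W (congr1 (@carrier _ _) e) (alg_functor g)).
by rewrite -[LHS]/(alg_map (comparison_hom A (alg_functor g))) alg_functorE eg.
Qed.

End Comparison.

Theorem theorem6p3p1 :
  inhabited free_adjunction /\
  forall A : free_adjunction, is_embedding (Phi A).
Proof.
split; first by split; exact: free_adjunction_ex.
move=> A; split; first exact: comparison_full.
- exact: comparison_faithful.
- exact: comparison_inj.
Qed.
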